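(* Let $\mathcal{H}$ be a Krein space with fundamental symmetry $J$, let $\mathcal{Q}$ be the set of $J$-normal projections, and let $\mathcal{U}_J$ be the Banach-Lie group of bounded $J$-unitary operators acting on $\mathcal{Q}$ by $U\cdot Q=UQU^{\#}$. Given $Q_0\in\mathcal{Q}$, the orbit $\mathcal{U}_J\cdot Q_0=\{UQ_0U^{\#}:U\in\mathcal{U}_J\}$ is a real analytic homogeneous space of $\mathcal{U}_J$.
   Context: $(\mathcal{H},\langle\cdot,\cdot\rangle)$ is a complex separable Hilbert space and $L(\mathcal{H})$ is the algebra of bounded operators on it. $J\in L(\mathcal{H})$ is a fixed symmetry ($J=J^*=J^{-1}$), and the Krein space structure is given by the indefinite inner product $[f,g]=\langle Jf,g\rangle$. For $T\in L(\mathcal{H})$ the $J$-adjoint is $T^{\#}=JT^*J$. The set of $J$-normal projections is $\mathcal{Q}=\{Q\in L(\mathcal{H}): Q^2=Q,\ QQ^{\#}=Q^{\#}Q\}$. The group $\mathcal{U}_J=\{U\in L(\mathcal{H}):UU^{\#}=U^{\#}U=I\}$, with the operator norm topology, is a real Banach-Lie group with Lie algebra $\mathfrak{u}_J=\{X\in L(\mathcal{H}):X^{\#}=-X\}$. Saying that the orbit $\mathcal{U}_J\cdot Q_0$ is a real analytic homogeneous space of $\mathcal{U}_J$ means that the isotropy group $\mathcal{G}=\{U\in\mathcal{U}_J:UQ_0=Q_0U\}$ is a Banach-Lie subgroup of $\mathcal{U}_J$ (it is a Banach-Lie group in the norm topology of $L(\mathcal{H})$ and its Lie algebra $\{X\in\mathfrak{u}_J:XQ_0=Q_0X\}$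 is a closed complemented real subspace of $\mathfrak{u}_J$). Consequently $\mathcal{U}_J\cdot Q_0\simeq\mathcal{U}_J/\mathcal{G}$, endowed with the quotient topology, has a real analytic Banach manifold structure for which $U\mapsto UQ_0U^{\#}$ is a real analytic submersion of $\mathcal{U}_J$ onto $\mathcal{U}_J\cdot Q_0$. *)

(* Defs.v *)
From HB Require Import structures.
From mathcomp Require Import all_boot all_order all_algebra complex.
From mathcomp Require Import all_classical all_reals all_analysis.
From mathcomp Require Import ring lra.
Set Implicit Arguments.
Unset Strict Implicit.
Unset Printing Implicit Defensive.
Import Order.TTheory GRing.Theory Num.Theory numFieldNormedType.Exports.
Local Open Scope classical_set_scope.
Local Open Scope complex_scope.
Local Open Scope ring_scope.

(* Complex Hilbert spaces; the inner product is linear in its first argument. *)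
HB.mixin Record CompleteNormedModule_isHilbert (R : realType) H
    & CompleteNormedModule R[i] H := {
  dot : H -> H -> R[i] ;
  dot_linearl : forall (a : R[i]) (x y z : H),
    dot (a *: x + y) z = a * dot x z + dot y z ;
  dot_conj : forall x y : H, dot x y = (dot y x)^* ;
  dotxx : forall x : H, dot x x = `|x| ^+ 2
}.

#[short(type="hilbertType")]
HB.structure Definition Hilbert (R : realType) :=
  {H of CompleteNormedModule R[i] H & CompleteNormedModule_isHilbert R H}.

Section BoundedOperators.
Variables (R : realType) (H : hilbertType R).
Implicit Types (x y z : H) (a b : R).

(* The norm of a normed module over R[i] takes its values in R[i]. *)
Definition rnorm x : R := complex.Re `|x|.

Lemma rnormE x : `|x| = (rnorm x)%:C.
Proof. by rewrite /rnorm RRe_real // normr_real. Qed.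

Lemma rnorm_ge0 x : 0 <= rnorm x.
Proof. by rewrite -lecR -rnormE normr_ge0. Qed.

Lemma rnorm0 : rnorm 0 = 0.
Proof. by apply: complexI; rewrite -rnormE normr0. Qed.

Lemma rnorm_eq0 x : rnorm x = 0 -> x = 0.
Proof. by move=> x0; apply/normr0_eq0; rewrite rnormE x0. Qed.

Lemma rnormD x y : rnorm (x + y) <= rnorm x + rnorm y.
Proof. by rewrite -lecR rmorphD /= -!rnormE ler_normD. Qed.

Lemma rnormN x : rnorm (- x) = rnorm x.
Proof. by rewrite /rnorm normrN. Qed.

Lemma rnormZ a x : rnorm (a%:C *: x) = `|a| * rnorm x.
Proof.
apply: complexI; rewrite -rnormE normrZ rmorphM /= -rnormE normc_def /=.
by rewrite expr0n addr0 sqrtr_sqr.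
Qed.

Definition op_bound (f : H -> H) (M : R) : Prop :=
  0 <= M /\ forall x, rnorm (f x) <= M * rnorm x.

Definition is_bounded_op (f : H -> H) : bool :=
  `[< (forall (c : R[i]) x y, f (c *: x + y) = c *: f x + f y) /\
      exists M, op_bound f M >].

Record bop := Bop { bopf :> H -> H ; _ : is_bounded_op bopf }.
HB.instance Definition _ := [isSub for bopf].
HB.instance Definition _ := [Choice of bop by <:].

Implicit Types S T : bop.

Lemma bop_ext S T : S =1 T -> S = T.
Proof. by move=> e; apply: val_inj; apply: funext. Qed.

Lemma bopP T (c : R[i]) x y : T (c *: x + y) = c *: T x + T y.
Proof. by have /asboolP[h _] := valP T; apply: h. Qed.

HB.instance Definition _ T :=
  GRing.isLinear.Build R[i] H H *:%R (T : H -> H) (@bopP T).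

Lemma bop_bounded T : exists M, op_bound T M.
Proof. by have /asboolP[_ h] := valP T. Qed.

Lemma op_boundD f g M N :
  op_bound f M -> op_bound g N -> op_bound (fun x => f x + g x) (M + N).
Proof.
move=> [M0 Mf] [N0 Ng]; split=> [|x]; first exact: addr_ge0.
by rewrite mulrDl (le_trans (rnormD _ _))// lerD.
Qed.

Lemma op_boundZ a f M :
  op_bound f M -> op_bound (fun x => a%:C *: f x) (`|a| * M).
Proof.
move=> [M0 Mf]; split=> [|x]; first by rewrite mulr_ge0.
by rewrite rnormZ -mulrA ler_wpM2l.
Qed.

Lemma op_bound_comp f g M N :
  op_bound f M -> op_bound g N -> op_bound (f \o g) (M * N).
Proof.
move=> [M0 Mf] [N0 Ng]; split=> [|x /=]; first exact: mulr_ge0.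
by rewrite (le_trans (Mf _))// -mulrA ler_wpM2l.
Qed.

Fact bop_zero_subproof : is_bounded_op (fun=> 0).
Proof.
apply/asboolP; split=> [c x y|]; first by rewrite scaler0 addr0.
by exists 0; split=> // x; rewrite rnorm0 mul0r.
Qed.
Fact bop_one_subproof : is_bounded_op idfun.
Proof. by apply/asboolP; split=> //; exists 1; split=> // x; rewrite mul1r. Qed.
Fact bop_add_subproof S T : is_bounded_op (fun x => S x + T x).
Proof.
apply/asboolP; split=> [c x y|]; first by rewrite !linearP scalerDr addrACA.
have [M hM] := bop_bounded S; have [N hN] := bop_bounded T.
by exists (M + N); apply: op_boundD.
Qed.
Fact bop_scale_subproof a T : is_bounded_op (fun x => a%:C *: T x).
Proof.
apply/asboolP; split=> [c x y|].
  by rewrite linearP scalerDr !scalerA mulrC.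
by have [M hM] := bop_bounded T; exists (`|a| * M); apply: op_boundZ.
Qed.
Fact bop_opp_subproof T : is_bounded_op (fun x => - T x).
Proof.
apply/asboolP; split=> [c x y|]; first by rewrite linearP opprD scalerN.
by have [M [M0 hM]] := bop_bounded T; exists M; split=> // x; rewrite rnormN.
Qed.
Fact bop_mul_subproof S T : is_bounded_op (S \o T).
Proof.
apply/asboolP; split=> [c x y|]; first by rewrite /= !linearP.
have [M hM] := bop_bounded S; have [N hN] := bop_bounded T.
by exists (M * N); apply: op_bound_comp.
Qed.

Definition bop_zero := Bop bop_zero_subproof.
Definition bop_one := Bop bop_one_subproof.
Definition bop_add S T := Bop (bop_add_subproof S T).
Definition bop_opp T := Bop (bop_opp_subproof T).
Definition bop_mul S T := Bop (bop_mul_subproof S T).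
Definition bop_scale a T := Bop (bop_scale_subproof a T).

Fact bop_addA : associative bop_add.
Proof. by move=> *; apply: bop_ext => x; apply: addrA. Qed.
Fact bop_addC : commutative bop_add.
Proof. by move=> *; apply: bop_ext => x; apply: addrC. Qed.
Fact bop_add0 : left_id bop_zero bop_add.
Proof. by move=> *; apply: bop_ext => x; apply: add0r. Qed.
Fact bop_addN : left_inverse bop_zero bop_opp bop_add.
Proof. by move=> *; apply: bop_ext => x; apply: addNr. Qed.
HB.instance Definition _ :=
  GRing.isZmodule.Build bop bop_addA bop_addC bop_add0 bop_addN.

Fact bop_mulA : associative bop_mul. Proof. by move=> *; apply: bop_ext. Qed.
Fact bop_mul1l : left_id bop_one bop_mul.
Proof. by move=> *; apply: bop_ext. Qed.
Fact bop_mul1r : right_id bop_one bop_mul.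
Proof. by move=> *; apply: bop_ext. Qed.
Fact bop_mulDl : left_distributive bop_mul +%R.
Proof. by move=> *; apply: bop_ext. Qed.
Fact bop_mulDr : right_distributive bop_mul +%R.
Proof. by move=> *; apply: bop_ext => x; apply: raddfD. Qed.
HB.instance Definition _ := GRing.Zmodule_isPzRing.Build bop
  bop_mulA bop_mul1l bop_mul1r bop_mulDl bop_mulDr.

Fact bop_scaleA a b T : bop_scale a (bop_scale b T) = bop_scale (a * b) T.
Proof. by apply: bop_ext => x; rewrite /= scalerA rmorphM. Qed.
Fact bop_scale1 : left_id 1 bop_scale.
Proof. by move=> T; apply: bop_ext => x; rewrite /= scale1r. Qed.
Fact bop_scaleDr : right_distributive bop_scale +%R.
Proof. by move=> *; apply: bop_ext => x; apply: scalerDr. Qed.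
Fact bop_scaleDl T : {morph bop_scale^~ T : a b / a + b}.
Proof. by move=> a b; apply: bop_ext => x; rewrite /= rmorphD /= scalerDl. Qed.
(* Only the underlying real vector space of L(H) is needed: U_J is a real Lie
   group. *)
HB.instance Definition _ := GRing.Zmodule_isLmodule.Build R bop
  bop_scaleA bop_scale1 bop_scaleDr bop_scaleDl.

Definition opnorm T : R := inf [set M | op_bound T M].

Lemma has_inf_op_bound T : has_inf [set M | op_bound T M].
Proof. by split; [exact: bop_bounded | exists 0 => M []]. Qed.

Lemma opnorm_le T M : op_bound T M -> opnorm T <= M.
Proof. by move=> h; apply: ge_inf => //; case: (has_inf_op_bound T). Qed.

Lemma opnorm_bound T : op_bound T (opnorm T).
Proof.
have ge0 : 0 <= opnorm T.
  by apply: lb_le_inf => [|M []//]; exact: bop_bounded.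
split=> // x; have [x0|x0] := eqVneq (rnorm x) 0.
  by rewrite (rnorm_eq0 x0) raddf0 rnorm0 mulr0.
have xgt0 : 0 < rnorm x by rewrite lt_def x0 rnorm_ge0.
rewrite -ler_pdivrMr//; apply: lb_le_inf; first exact: bop_bounded.
by move=> M [_ hM]; rewrite ler_pdivrMr.
Qed.

Fact opnormD S T : opnorm (S + T) <= opnorm S + opnorm T.
Proof. by apply/opnorm_le/op_boundD; apply: opnorm_bound. Qed.

Fact opnorm_eq0 T : opnorm T = 0 -> T = 0.
Proof.
move=> T0; apply: bop_ext => x; apply: rnorm_eq0; apply/eqP.
have [_ /(_ x)] := opnorm_bound T.
by rewrite T0 mul0r => h; rewrite eq_le h rnorm_ge0.
Qed.

Fact opnormZ a T : opnorm (a *: T) = `|a| * opnorm T.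
Proof.
have le_opZ b S : opnorm (b *: S) <= `|b| * opnorm S.
  by apply/opnorm_le/op_boundZ; apply: opnorm_bound.
apply/eqP; rewrite eq_le le_opZ /=.
have [->|a0] := eqVneq a 0.
  by rewrite normr0 mul0r; case: (opnorm_bound (0 *: T)).
rewrite -ler_pdivlMl ?normr_gt0// -normfV.
by rewrite (le_trans _ (le_opZ _ _))// scalerA mulVf// scale1r.
Qed.

HB.instance Definition _ := Lmodule_isNormed.Build R bop
  opnormD opnormZ opnorm_eq0.

Lemma bop_normE T : `|T| = opnorm T. Proof. by []. Qed.

Lemma bop_norm_le T x : rnorm (T x) <= `|T| * rnorm x.
Proof. by case: (opnorm_bound T) => _; apply. Qed.

Lemma rnorm_ltc x (e : R[i]) : 0 < e -> (`|x| < e) = (rnorm x < complex.Re e).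
Proof. by move=> e0; rewrite rnormE -[in LHS](RRe_real (gtr0_real e0)) ltcR. Qed.

Lemma Re_gt0 (e : R[i]) : 0 < e -> 0 < complex.Re e.
Proof. by rewrite ltcE => /andP[]. Qed.

Lemma bop_cauchy_dist (F : set_system bop) (FF : ProperFilter F) :
  cauchy F -> forall e, 0 < e -> \forall S \near F, \forall T \near F, `|S - T| < e.
Proof.
move=> /cauchy_ballP Fc e e0.
have [[A B] /= [FA FB] AB] := Fc e e0.
near=> S; near=> T; have /= := AB (S, T).
rewrite -ball_normE /ball_ /=; apply; split; first by near: S.
by near: T.
Unshelve. all: by end_near. Qed.

Lemma bop_eval_cvg (F : set_system bop) (FF : ProperFilter F) x :
  cauchy F -> cvg ((fun T : bop => T x) @ F).
Proof.
move=> /bop_cauchy_dist Fc; apply: cauchy_cvg; apply/cauchyP => e e0.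
have x1 : 0 < rnorm x + 1 by rewrite ltr_wpDl ?rnorm_ge0.
have e1 : 0 < complex.Re e / (rnorm x + 1) by rewrite divr_gt0 ?Re_gt0.
near F => S; exists (S x).
rewrite /nbhs /= /fmap /=.
have : \forall T \near F, `|S - T| < complex.Re e / (rnorm x + 1).
  by near: S; apply: Fc.
apply: filterS => T ST; rewrite -ball_normE /ball_ /= rnorm_ltc//.
rewrite (le_lt_trans (bop_norm_le (S - T) x))//.
rewrite (@le_lt_trans _ _ (`|S - T| * (rnorm x + 1)))//.
  by rewrite ler_wpM2l// lerDl.
by rewrite -ltr_pdivlMr.
Unshelve. all: by end_near. Qed.

Lemma bop_complete (F : set_system bop) :
  ProperFilter F -> cauchy F -> cvg F.
Proof.
move=> FF Fcau; have Fc := bop_cauchy_dist FF Fcau.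
pose L x := lim ((fun T : bop => T x) @ F).
have LP x : (fun T : bop => T x) @ F --> L x by apply: bop_eval_cvg.
have Llin (c : R[i]) x y : L (c *: x + y) = c *: L x + L y.
  apply: (@cvg_unique _ (@norm_hausdorff _ H) ((fun T : bop => T (c *: x + y)) @ F)).
    exact: LP.
  rewrite (_ : (fun T => _) = fun T : bop => c *: T x + T y); last first.
    by apply/funext => T; rewrite linearP.
  by apply: cvgD => //; apply: cvgZl_tmp.
have Lb S e x : 0 < e -> (\forall T \near F, `|S - T| < e) ->
    rnorm (S x - L x) <= e * rnorm x.
  move=> e0 FS; apply/ler_addgt0Pr => d d0.
  have dC : (0 : R[i]) < d%:C by rewrite ltcR.
  near F => T.
  have -> : S x - L x = (S - T) x + (T x - L x) by rewrite /= addrA subrK.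
  rewrite (le_trans (rnormD _ _))// lerD//.
    rewrite (le_trans (bop_norm_le _ _))// ler_wpM2r ?rnorm_ge0// ltW//.
    by near: T.
  rewrite -[T x - _]opprB rnormN ltW// -[d]/(complex.Re d%:C) -rnorm_ltc//.
  by near: T; move: dC; apply: cvgr_dist_lt; apply: LP.
have LB : is_bounded_op L.
  apply/asboolP; split=> //.
  near F => S; exists (1 + `|S|); split=> [|x]; first by rewrite addr_ge0.
  rewrite mulrDl (_ : L x = - (S x - L x) + S x); last by rewrite opprB subrK.
  rewrite (le_trans (rnormD _ _))// rnormN lerD ?bop_norm_le//.
  by apply: Lb => //; near: S; apply: Fc.
apply/cvg_ex; exists (Bop LB); apply/cvgrPdist_le => e e0; near=> S.
rewrite distrC; apply: opnorm_le; split=> [|x]; first exact: ltW.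
by apply: Lb => //; near: S; apply: Fc.
Unshelve. all: by end_near. Qed.
HB.instance Definition _ := Uniform_isComplete.Build bop bop_complete.

End BoundedOperators.

Section Adjoint.
Variables (R : realType) (H : hilbertType R).
Implicit Types (x y z : H) (S T : bop H).

Definition is_adjoint T S : Prop := forall x y, dot (T x) y = dot x (S y).

(* Existence and uniqueness are [adjP] and [adj_uniq] below. *)
Definition adj T : bop H := xget 0 [set S | is_adjoint T S].

Let rdot x y : R := complex.Re (dot x y).

Let rdotxx x : rdot x x = rnorm x ^+ 2.
Proof.
apply: complexI; rewrite rmorphXn /= -rnormE -dotxx /rdot RRe_real// dotxx.
by rewrite rpredX// normr_real.
Qed.

Let dotDl x y z : dot (x + y) z = dot x z + dot y z.
Proof. by rewrite -[x in LHS]scale1r dot_linearl mul1r. Qed.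

Let dot0l x : dot 0 x = 0.
Proof. by apply: (addrI (dot 0 x)); rewrite -dotDl !addr0. Qed.

Let dotZl (c : R[i]) x y : dot (c *: x) y = c * dot x y.
Proof. by rewrite -[c *: x]addr0 dot_linearl dot0l addr0. Qed.

Let dotBr x y z : dot x (y - z) = dot x y - dot x z.
Proof.
rewrite dot_conj -scaleN1r addrC dot_linearl mulN1r rmorphD rmorphN /=.
by rewrite -!dot_conj addrC.
Qed.

Lemma dot_linearr (c : R[i]) x y z :
  dot x (c *: y + z) = c^* * dot x y + dot x z.
Proof. by rewrite dot_conj dot_linearl rmorphD rmorphM /= -!dot_conj. Qed.

Let rdotC x y : rdot x y = rdot y x.
Proof. by rewrite /rdot dot_conj; case: (dot y x). Qed.

Let rdotD x y z : rdot (x + y) z = rdot x z + rdot y z.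
Proof. by rewrite /rdot dotDl raddfD. Qed.

Let rdotZ (a : R) x y : rdot (a%:C *: x) y = a * rdot x y.
Proof. by rewrite /rdot dotZl; case: (dot x y) => u v /=; rewrite mul0r subr0. Qed.

Let rdotN x y : rdot (- x) y = - rdot x y.
Proof. by rewrite -scaleN1r -(rmorphN1 (real_complex R)) rdotZ mulN1r. Qed.

Let rnorm_sqDZ x y (t : R) :
  rnorm (x + t%:C *: y) ^+ 2 = rnorm x ^+ 2 + 2 * t * rdot y x + t ^+ 2 * rnorm y ^+ 2.
Proof.
rewrite -!rdotxx rdotD ![rdot _ (_ + _)]rdotC !rdotD !rdotZ [rdot x (t%:C *: y)]rdotC.
by rewrite [rdot y (_ *: _)]rdotC !rdotZ; ring.
Qed.

Let discr (a b c : R) : 0 <= a ->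
  (forall t : R, 0 <= c + 2 * t * b + t ^+ 2 * a) -> b ^+ 2 <= a * c.
Proof.
move=> a0 h; have [a1|a1] := eqVneq a 0.
  have [->|b0] := eqVneq b 0; first by rewrite a1 expr0n mul0r.
  have := h (- (c + 1) / (2 * b)); rewrite a1 mulr0 addr0.
  have -> : 2 * (- (c + 1) / (2 * b)) * b = - (c + 1) by field.
  by rewrite opprD addrA subrr add0r ler0N1.
have := h (- b / a).
have -> : c + 2 * (- b / a) * b + (- b / a) ^+ 2 * a = (a * c - b ^+ 2) / a.
  by field.
by rewrite pmulr_lge0 ?subr_ge0// invr_gt0 lt_def a1.
Qed.

Let rdot_le x y : rdot x y <= rnorm x * rnorm y.
Proof.
rewrite (le_trans (ler_norm _))// -ler_sqr ?nnegrE ?mulr_ge0 ?rnorm_ge0//.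
rewrite real_normK ?num_real// exprMn mulrC; apply: discr => [|t]; first exact: sqr_ge0.
by rewrite rdotC -rnorm_sqDZ sqr_ge0.
Qed.

Let riesz (phi : H -> R[i]) :
  (forall (c : R[i]) x y, phi (c *: x + y) = c * phi x + phi y) ->
  (exists M, 0 <= M /\ forall x, complex.Re (phi x) <= M * rnorm x) ->
  exists z, forall x, phi x = dot x z.
Proof.
move=> phil [M [M0 phiM]].
pose f x := complex.Re (phi x).
have phi0 : phi 0 = 0.
  by have := phil 1 0 0; rewrite scaler0 mul1r addr0 => h; apply: (addrI (phi 0)); rewrite -h addr0.
have fD x y : f (x + y) = f x + f y.
  by rewrite /f -[x in LHS]scale1r phil mul1r raddfD.
have fZ (a : R) x : f (a%:C *: x) = a * f x.
  rewrite /f -[_ *: _]addr0 phil phi0 addr0.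
  by case: (phi x) => u v /=; rewrite mul0r subr0.
pose g x := rnorm x ^+ 2 - 2 * f x.
pose m := inf (range g).
have g_lb x : - M ^+ 2 <= g x.
  by have := phiM x; rewrite -/(f x) /g; have := sqr_ge0 (rnorm x - M); nra.
have g_inf : has_inf (range g).
  by split; [exists (g 0), 0|exists (- M ^+ 2) => _ [x _ <-]].
have m_le x : m <= g x by apply: ge_inf; [case: g_inf|exists x].
have near_min e : 0 < e -> exists x, g x < m + e.
  by move=> e0; have [_ [x _ <-] xe] := inf_adherent e0 g_inf; exists x.
have var a e x : 0 <= e -> g a < m + e ->
    (rdot x a - f x) ^+ 2 <= rnorm x ^+ 2 * e.
  move=> e0 ae; apply: discr => [|t]; first exact: sqr_ge0.
  have := m_le (a + t%:C *: x); rewrite /g rnorm_sqDZ fD fZ.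
  by move: ae; rewrite /g; nra.
have par a b e : g a < m + e -> g b < m + e -> rnorm (a - b) ^+ 2 <= 4 * e.
  move=> ae be; have := m_le ((2^-1)%:C *: (a + b)).
  have -> : a - b = a + (-1)%:C *: b by rewrite rmorphN1 scaleN1r.
  move: ae be; rewrite /g fZ fD rnormZ exprMn.
  have -> : rnorm (a + b) ^+ 2 = rnorm (a + 1%:C *: b) ^+ 2 by rewrite scale1r.
  rewrite !rnorm_sqDZ ger0_norm// => *; lra.
have inv0 n : (0 : R) < n.+1%:R^-1 by rewrite invr_gt0.
have [u uP] : {u : nat -> H & forall n, g (u n) < m + n.+1%:R^-1}.
  exact: (boolp.choice (fun n => near_min _ (inv0 n))).
have small e : 0 < e -> \forall n \near \oo, n.+1%:R^-1 < e :> R.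
  by move=> e0; exact: (near_infty_natSinv_lt (PosNum e0)).
have /cvg_ex[z uz] : cvg (u @ \oo).
  apply: cauchy_cvg; apply/cauchyP => e e0; pose d := complex.Re e.
  have d0 : 0 < d by exact: Re_gt0.
  have d4 : 0 < d ^+ 2 / 4 by rewrite divr_gt0// exprn_gt0.
  near \oo => N; exists (u N).
  have := small _ d4; rewrite [X in _ -> X]/nbhs /= /fmap /=; apply: filterS => n hn.
  rewrite -ball_normE /ball_ /= rnorm_ltc//.
  rewrite -ltr_sqr ?nnegrE ?rnorm_ge0 ?(ltW d0)//.
  have hN : N.+1%:R^-1 < d ^+ 2 / 4 by near: N; apply: small.
  pose e' := Num.max (N.+1%:R^-1 : R) n.+1%:R^-1.
  rewrite (@le_lt_trans _ _ (4 * e'))//.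
    by apply: par; rewrite (lt_le_trans (uP _))// lerD2l le_max lexx ?orbT.
  by rewrite mulrC -ltr_pdivlMr// gt_max hN hn.
have main x : f x = rdot x z.
  apply/eqP; rewrite eq_sym -subr_eq0 -normr_le0; apply/ler_addgt0Pr => d d0.
  rewrite add0r.
  pose K := rnorm x + 1; have K0 : 0 < K by rewrite ltr_wpDl ?rnorm_ge0.
  have xK : rnorm x <= K by rewrite /K lerDl.
  have dK : 0 < d / (2 * K) by rewrite divr_gt0// mulr_gt0.
  have dKC : (0 : R[i]) < (d / (2 * K))%:C by rewrite ltcR.
  near \oo => n.
  have h1 : rnorm (z - u n) < d / (2 * K).
    rewrite -[X in _ < X]/(complex.Re (d / (2 * K))%:C) -rnorm_ltc//.
    by near: n; move: dKC; apply: cvgr_dist_lt.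
  have h2 : n.+1%:R^-1 < (d / (2 * K)) ^+ 2.
    by near: n; apply: small; rewrite exprn_gt0.
  have -> : rdot x z - f x = rdot (z - u n) x + (rdot x (u n) - f x).
    by rewrite [rdot (z - _) _]rdotC /rdot dotBr raddfB /= addrA subrK.
  have ab : `|rdot (z - u n) x| <= d / (2 * K) * K.
    rewrite ler_norml; apply/andP; split; last first.
      by rewrite (le_trans (rdot_le _ _))// ler_pM ?rnorm_ge0// ltW.
    rewrite lerNl (_ : - _ = rdot (u n - z) x); last first.
      by rewrite -[u n - z]opprB rdotN.
    rewrite (le_trans (rdot_le _ _))// -[u n - z]opprB rnormN.
    by rewrite ler_pM ?rnorm_ge0// ltW.
  have cd : `|rdot x (u n) - f x| <= K * (d / (2 * K)).
    have KdK := mulr_ge0 (ltW K0) (ltW dK).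
    rewrite -ler_sqr ?nnegrE// real_normK ?num_real//.
    rewrite (le_trans (var _ _ _ _ (uP n)))// exprMn ler_pM ?sqr_ge0 ?(ltW h2)//.
    by rewrite ler_sqr ?nnegrE ?rnorm_ge0// ltW.
  rewrite (le_trans (ler_normD _ _))// (le_trans (lerD ab cd))//.
  by rewrite [leLHS](_ : _ = d)//; field; rewrite gt_eqF.
exists z => x.
have fi : f ('i *: x) = rdot ('i *: x) z by exact: main.
have := main x; move: fi; rewrite /f /rdot -['i *: x]addr0 phil phi0 addr0 addr0 dotZl.
by case: (phi x) => a b; case: (dot x z) => c d /=; simpc => /oppr_inj -> ->.
Unshelve. all: by end_near. Qed.

Lemma adjP T : is_adjoint T (adj T).
Proof.
apply: (xgetPex 0).
have [M [M0 TM]] := bop_bounded T.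
have ex y : exists z, forall x, dot (T x) y = dot x z.
  apply: riesz => [c x x'|]; first by rewrite linearP dot_linearl.
  exists (M * rnorm y); split=> [|x]; first by rewrite mulr_ge0 ?rnorm_ge0.
  by rewrite (le_trans (rdot_le _ _))// mulrAC ler_wpM2r ?rnorm_ge0.
have [S SP] : {S : H -> H & forall y x, dot (T x) y = dot x (S y)}.
  exact: (boolp.choice ex).
have dot_inj a b : (forall x, dot x a = dot x b) -> a = b.
  move=> h; apply/eqP; rewrite -subr_eq0; apply/eqP/normr0_eq0/eqP.
  by rewrite -sqrf_eq0 -dotxx dotBr h subrr.
have SB : is_bounded_op S.
  apply/asboolP; split=> [c x y|].
    by apply: dot_inj => v; rewrite -SP !dot_linearr !SP.
  exists M; split=> // y.
  have [->|Sy0] := eqVneq (rnorm (S y)) 0; first by rewrite mulr_ge0 ?rnorm_ge0.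
  have Sy : 0 < rnorm (S y) by rewrite lt_def Sy0 rnorm_ge0.
  rewrite -(ler_pM2l Sy) -expr2 -rdotxx /rdot -SP.
  rewrite (le_trans (rdot_le _ _))//.
  by rewrite mulrCA mulrA ler_wpM2r ?rnorm_ge0.
by exists (Bop SB) => x y; exact: SP.
Qed.

Lemma adj_uniq T S : is_adjoint T S -> S = adj T.
Proof.
move=> TS; apply: bop_ext => y; apply/eqP; rewrite -subr_eq0; apply/eqP.
apply/normr0_eq0/eqP; rewrite -sqrf_eq0 -dotxx dotBr -TS.
by rewrite (adjP T _ y) subrr.
Qed.

End Adjoint.

HB.saturate prod.
Section ProdComplete.
Variables (R : realType) (U V : completeNormedModType R).

Lemma prod_complete (F : set_system (U * V)%type) :
  ProperFilter F -> cauchy F -> cvg F.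
Proof.
move=> FF Fc.
have c1 : cauchy (fst @ F).
  move=> A /= entA; rewrite near_simpl -near2E near_map2.
  by apply: filterS (Fc _ (prod_entP entA (@entourageT V))) => -[a b] [].
have c2 : cauchy (snd @ F).
  move=> A /= entA; rewrite near_simpl -near2E near_map2.
  by apply: filterS (Fc _ (prod_entP (@entourageT U) entA)) => -[a b] [].
have /cvg_ex[x Fx] : cvg (fst @ F) by exact: cauchy_cvg.
have /cvg_ex[y Fy] : cvg (snd @ F) by exact: cauchy_cvg.
apply/cvg_ex; exists (x, y) => W [[A B] /= [Ax By] ABW].
have FA : F (fst @^-1` A) by exact: Fx.
have FB : F (snd @^-1` B) by exact: Fy.
by apply: filterS (filterI FA FB) => -[a b] [/= Aa Bb]; exact: ABW.
Qed.

HB.instance Definition _ := Uniform_isComplete.Build (U * V)%type prod_complete.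

End ProdComplete.

Section RealAnalytic.
Variables (R : realType) (E F : normedModType R).

Definition multilinear n (p : ('I_n -> E) -> F) : Prop :=
  forall (v : 'I_n -> E) (i : 'I_n) (a : R) (x y : E),
    let upd z := fun j => if j == i then z else v j in
    p (upd (a *: x + y)) = a *: p (upd x) + p (upd y).

(* f is, near x, the sum of a power series of bounded n-linear maps p_n (not
   necessarily symmetric), the bounds ensuring convergence on the ball of
   radius r. *)
Definition analytic_at (f : E -> F) (x : E) : Prop :=
  exists (p : forall n, ('I_n -> E) -> F) (C r : R),
  [/\ 0 < r,
      forall n, multilinear (p n),
      forall n v, `|p n v| <= C * r ^- n * \prod_(i < n) `|v i| &
      \forall h \near (0 : E),
        series (fun n => p n (fun=> h)) @ \oo --> f (x + h)].

Definition analytic_on (A : set E) (f : E -> F) : Prop :=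
  forall x, A x -> analytic_at f x.

End RealAnalytic.

Section ClosedComplemented.
Variables (R : realType) (V : normedModType R).

Definition is_subspace (L : set V) : Prop :=
  L 0 /\ forall (a : R) (x y : V), L x -> L y -> L (a *: x + y).

Definition closed_complemented (L W : set V) : Prop :=
  [/\ is_subspace L, closed L, L `<=` W &
      exists N : set V, [/\ is_subspace N, closed N, N `<=` W,
        L `&` N = [set 0] &
        forall w, W w -> exists l n, [/\ L l, N n & w = l + n]]].

End ClosedComplemented.

Section Manifolds.
Variable R : realType.

(* chart_inv is only meaningful on chart_fun @` chart_dom *)
Record chart (T : Type) (E : completeNormedModType R) := Chart {
  chart_dom : set T ;
  chart_fun : T -> E ;
  chart_inv : E -> T }.

(* A subset of T, a family of open sets on it, and an atlas with values in a
   real Banach space; the axioms are in [banach_manifold]. *)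
Record manifold (T : Type) := Manifold {
  carrier : set T ;
  opens : set (set T) ;
  model : completeNormedModType R ;
  atlas : set (chart T model) }.
Arguments atlas {T} m.

Definition is_topology T (S : set T) (op : set (set T)) : Prop :=
  [/\ forall W, op W -> W `<=` S,
      op S,
      forall V W, op V -> op W -> op (V `&` W) &
      forall A, A `<=` op -> op (\bigcup_(W in A) W)].

Definition is_hausdorff T (S : set T) (op : set (set T)) : Prop :=
  forall x y, S x -> S y -> x <> y ->
    exists V W, [/\ op V, op W, V x, W y & V `&` W = set0].

(* c is a homeomorphism of an open set onto an open set of the model *)
Definition is_chart T (M : manifold T) (c : chart T (model M)) : Prop :=
  [/\ opens M (chart_dom c),
      forall x, chart_dom c x -> chart_inv c (chart_fun c x) = x,
      open (chart_fun c @` chart_dom c) &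
      forall W, W `<=` chart_dom c -> (opens M W <-> open (chart_fun c @` W))].

Definition banach_manifold T (M : manifold T) : Prop :=
  [/\ is_topology (carrier M) (opens M),
      is_hausdorff (carrier M) (opens M),
      forall c, atlas M c -> is_chart c,
      forall x, carrier M x -> exists2 c, atlas M c & chart_dom c x &
      forall c d, atlas M c -> atlas M d ->
        analytic_on (chart_fun c @` (chart_dom c `&` chart_dom d))
                    (chart_fun d \o chart_inv c)].

Definition local_rep T1 T2 (M : manifold T1) (N : manifold T2) (f : T1 -> T2)
    (c : chart T1 (model M)) (d : chart T2 (model N)) : model M -> model N :=
  chart_fun d \o f \o chart_inv c.

Definition analytic_map T1 T2 (M : manifold T1) (N : manifold T2)
    (f : T1 -> T2) : Prop :=
  [/\ forall x, carrier M x -> carrier N (f x),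
      forall W, opens N W -> opens M (carrier M `&` f @^-1` W) &
      forall c d, atlas M c -> atlas N d ->
        analytic_on (chart_fun c @` (chart_dom c `&` f @^-1` chart_dom d))
                    (local_rep f c d)].

Definition submersion T1 T2 (M : manifold T1) (N : manifold T2)
    (f : T1 -> T2) : Prop :=
  analytic_map M N f /\
  forall x c d, atlas M c -> atlas N d -> chart_dom c x -> chart_dom d (f x) ->
    let D := 'd (local_rep f c d) (chart_fun c x) in
    (forall w, exists v, D v = w) /\
    closed_complemented [set v | D v = 0] setT.

Definition prod_chart T1 T2 (E1 E2 : completeNormedModType R)
    (c : chart T1 E1) (d : chart T2 E2) : chart (T1 * T2) (E1 * E2)%type :=
  Chart (chart_dom c `*` chart_dom d)
    (fun x => (chart_fun c x.1, chart_fun d x.2))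
    (fun v => (chart_inv c v.1, chart_inv d v.2)).

Definition prod_manifold T1 T2 (M : manifold T1) (N : manifold T2) :
    manifold (T1 * T2) :=
  @Manifold (T1 * T2) (carrier M `*` carrier N)
    [set W | forall x, W x -> exists V1 V2,
       [/\ opens M V1, opens N V2, V1 x.1, V2 x.2 & V1 `*` V2 `<=` W]]
    (model M * model N)%type
    [set e | exists c d, [/\ atlas M c, atlas N d & e = prod_chart c d]].

Definition vector_manifold (E : completeNormedModType R) : manifold E :=
  Manifold setT open [set Chart setT id id].

Definition is_group T (S : set T) (mul : T -> T -> T) (one : T)
    (inv : T -> T) : Prop :=
  [/\ S one, forall x y, S x -> S y -> S (mul x y), forall x, S x -> S (inv x),
      forall x y z, S x -> S y -> S z -> mul x (mul y z) = mul (mul x y) z &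
      forall x, S x -> [/\ mul one x = x, mul x one = x,
                           mul (inv x) x = one & mul x (inv x) = one]].

Definition banach_lie_group T (G : manifold T) (mul : T -> T -> T) (one : T)
    (inv : T -> T) : Prop :=
  [/\ banach_manifold G,
      is_group (carrier G) mul one inv,
      analytic_map (prod_manifold G G) G (fun x => mul x.1 x.2) &
      analytic_map G G inv].

Definition subspace_opens (T : topologicalType) (S : set T) : set (set T) :=
  [set W | exists2 O, open O & W = S `&` O].

Definition quotient_opens T1 T2 (M : manifold T1) (f : T1 -> T2) :
    set (set T2) :=
  [set W | W `<=` f @` carrier M /\ opens M (carrier M `&` f @^-1` W)].

End Manifolds.
Arguments atlas {R T} m.

Section OperatorLieGroups.
Variables (R : realType) (H : hilbertType R).
Notation L := (bop H).

(* The tangent space at 1, seen inside L(H) by means of the differential of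
   the inclusion. *)
Definition lie_algebra (G : manifold R L) : set L :=
  [set X | exists c : chart L (model G), [/\ atlas G c, chart_dom c 1 &
     exists v, X = 'd (chart_inv c) (chart_fun c 1) v]].

(* A group of bounded operators which is a Banach-Lie group in the norm
   topology, immersed in L(H). *)
Definition operator_lie_group (G : manifold R L) (inv : L -> L) : Prop :=
  [/\ banach_lie_group G *%R 1 inv,
      opens G = subspace_opens (carrier G),
      analytic_map G (vector_manifold L) id &
      forall c, atlas G c -> chart_dom c 1 ->
        injective ('d (chart_inv c) (chart_fun c 1))].

Definition banach_lie_subgroup (G K : manifold R L) (inv : L -> L) : Prop :=
  [/\ operator_lie_group G inv,
      carrier G `<=` carrier K,
      analytic_map G K id &
      closed_complemented (lie_algebra G) (lie_algebra K)].

End OperatorLieGroups.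

Section Krein.
Variables (R : realType) (H : hilbertType R).
Notation L := (bop H).
Implicit Types (J Q T U X : L).

Definition separable_space : Prop := exists2 D : set H, countable D & dense D.

Definition is_symmetry J : Prop := adj J = J /\ J * J = 1.

Definition jadj J T : L := J * adj T * J.

Definition jnormal_projections J : set L :=
  [set Q | Q * Q = Q /\ Q * jadj J Q = jadj J Q * Q].

Definition junitary J : set L :=
  [set U | U * jadj J U = 1 /\ jadj J U * U = 1].

Definition junitary_lie J : set L := [set X | jadj J X = - X].

Definition isotropy J Q : set L := [set U | junitary J U /\ U * Q = Q * U].

Definition isotropy_lie J Q : set L :=
  [set X | junitary_lie J X /\ X * Q = Q * X].

Definition act J Q U : L := U * Q * jadj J U.

Definition junitary_orbit J Q : set L := act J Q @` junitary J.

(* The isotropy group is a Banach-Lie subgroup of U_J, and the orbit has a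
   manifold structure for which U |-> U Q U^# is a submersion.
   U_J and the isotropy group carry their Lie group structures for the norm
   topology (such a structure is unique); the orbit carries the topology of the
   quotient of U_J by the isotropy group, that is, the final topology for
   U |-> U Q U^#. *)
Definition analytic_homogeneous_space J Q : Prop :=
  exists UJ G O : manifold R L,
  [/\ [/\ carrier UJ = junitary J,
          operator_lie_group UJ (jadj J) &
          lie_algebra UJ = junitary_lie J],
      [/\ carrier G = isotropy J Q,
          banach_lie_subgroup G UJ (jadj J) &
          lie_algebra G = isotropy_lie J Q] &
      [/\ carrier O = junitary_orbit J Q,
          opens O = quotient_opens UJ (act J Q),
          banach_manifold O &
          submersion UJ O (act J Q)]].

End Krein.

(* Main.v *)
(* The isotropy group of Q is the commutant of the four orthogonal idempotents
   e_i obtained by multiplying Q or 1 - Q by Q^# or 1 - Q^#; hence the pinching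
   X |-> sum_i e_i X e_i is a bounded projection that commutes with #, and it
   complements the isotropy Lie algebra in u_J.
   Near 1, a J-unitary U is determined by its skew part T = (U - U^#)/2, because
   U = T + (1 + T^2)^(1/2); translating this parametrization gives the charts of
   U_J (the case Q = 1) and of the isotropy group.
   For X near Q on the orbit, S = sum_i e_i(X) e_i intertwines Q and X, so that
   its unitary part U = S (S^# S)^(-1/2) satisfies U Q U^# = X. The pinching of U
   is self-adjoint, hence T is off-diagonal, and X |-> T is a chart of the orbit
   whose inverse T |-> U Q U^# lifts to U_J; this local section makes the action
   open and a submersion.
   All these maps are built from products, inverses and square roots, and are
   analytic because inverses and square roots solve quadratic equations whose
   power series solutions converge by a majorant argument. *)
From HB Require Import structures.
Require Import Defs.
From mathcomp Require Import all_boot all_order all_algebra complex.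
From mathcomp Require Import all_classical all_reals all_analysis.
From mathcomp Require Import ring lra.
Set Implicit Arguments.
Unset Strict Implicit.
Unset Printing Implicit Defensive.
Import Order.TTheory GRing.Theory Num.Theory numFieldNormedType.Exports.
Local Open Scope classical_set_scope.
Local Open Scope complex_scope.
Local Open Scope ring_scope.

(** * Bounded maps and power series *)

(** No inverse function theorem and no composition theorem for power series is used. Analyticity is
    transported only through bounded linear and bilinear maps, inverses and square roots, each rule
    being stated for a function [f y] of a parameter, and every chart comes with an explicit
    inverse. This is the reason for taking the skew part where a logarithm would be customary: it is
    linear in U, and recovering U costs one square root. The J-adjoint does not satisfy the
    C*-identity in general, so S^# S carries no positivity and there is no polar decomposition to
    quote. Roots are taken only near 1; the ball of radius 1/2 in [bsqrt] fixes the branch, and what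
    is known of a root (self-adjointness, commutation) comes from contraction estimates in that
    ball. Four idempotents occur because Q need not be self-adjoint for #: X |-> Q X Q + (1 - Q) X
    (1 - Q) is a projection onto the commutant of Q, but it need not preserve u_J. The blocks built
    from both Q and Q^# are merely permuted by #. *)

Section TriangularSums.

(** Both sides run over the triangle k + l < N, by antidiagonals on the left and by rows on the
    right. *)
Lemma triangular_sum (V : zmodType) (f : nat -> nat -> V) N :
  \sum_(n < N) \sum_(k < n.+1) f k (n - k)%N =
  \sum_(k < N) \sum_(l < N - k) f k l.
Proof.
elim: N => [|N IH]; first by rewrite !big_ord0.
rewrite big_ord_recr /= IH [RHS]big_ord_recr /= subSnn big_ord1.
rewrite [X in _ + X = _]big_ord_recr /= subnn.
rewrite addrA -big_split; congr (_ + _); apply: eq_bigr => k _ /=.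
by rewrite subSn ?big_ord_recr //= ltnW.
Qed.

Variable R : realType.

(** Expanding the square gives all pairs k, l < N; the left side keeps those with k + l < N, and the
    dropped terms are nonnegative. *)
Lemma square_sum_ge (c : nat -> R) N : (forall k, 0 <= c k) ->
  \sum_(n < N) \sum_(k < n.+1) c k * c (n - k)%N <= (\sum_(k < N) c k) ^+ 2.
Proof.
move=> c0; rewrite (triangular_sum (fun k l => c k * c l)) expr2 mulr_suml.
apply: ler_sum => k _; rewrite -mulr_sumr ler_wpM2l//.
rewrite -[leRHS](big_mkord xpredT c) -[leLHS](big_mkord xpredT c).
by rewrite [leRHS](big_cat_nat (n := N - k))//= ?leq_subr// lerDl sumr_ge0.
Qed.

(* Writing S_N for the N-th partial sum of [b n * t ^+ n], the recursion gives
   S_(N+1) <= 1/(4 beta) + beta S_N ^ 2, and S <= 1/(2 beta) is preserved. *)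
Lemma quadratic_majorant (a b : nat -> R) (beta t : R) :
  0 < beta -> 0 < t -> (forall n, 0 <= a n) ->
  (forall n, b n = a n + beta * \sum_(k < n.-1) b k.+1 * b (n.-1 - k)%N) ->
  (forall N, \sum_(n < N) a n * t ^+ n <= (4 * beta)^-1) ->
  forall n, 0 <= b n <= (2 * beta)^-1 / t ^+ n.
Proof.
move=> beta0 t0 a0 bE aN.
have b0 n : 0 <= b n.
  elim/ltn_ind: n => -[|n] IH; rewrite bE addr_ge0 // mulr_ge0 ?(ltW beta0)//.
    by rewrite big_ord0.
  apply: sumr_ge0 => k _; rewrite mulr_ge0 ?IH //=.
    by rewrite ltnS.
  by rewrite ltnS leq_subr.
have bN N : \sum_(n < N) b n * t ^+ n <= (2 * beta)^-1.
  elim: N => [|N IH]; first by rewrite big_ord0 invr_ge0 mulr_ge0 ?(ltW beta0).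
  pose c k := b k.+1 * t ^+ k.+1.
  have c0 k : 0 <= c k by rewrite mulr_ge0// exprn_ge0// ltW.
  (* The convolution in [bE] is empty for n = 0 and n = 1. Peeling off these two terms leaves the
     Cauchy square of the shifted sequence [c], with N - 1 terms. *)
  have -> : \sum_(n < N.+1) b n * t ^+ n = \sum_(n < N.+1) a n * t ^+ n +
      beta * \sum_(n < N.-1) \sum_(k < n.+1) c k * c (n - k)%N.
    under eq_bigr do rewrite bE mulrDl.
    rewrite big_split /=; congr (_ + _).
    under eq_bigr do rewrite -mulrA.
    rewrite -mulr_sumr; congr (_ * _).
    rewrite -(big_mkord xpredT (fun n =>
      (\sum_(k < n.-1) b k.+1 * b (n.-1 - k)%N) * t ^+ n)).
    rewrite big_nat_recl//= big_ord0 mul0r add0r.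
    case: N {IH} => [|N]; first by rewrite big_nil big_ord0.
    rewrite big_nat_recl//= big_ord0 mul0r add0r big_mkord.
    apply: eq_bigr => n _ /=; rewrite mulr_suml; apply: eq_bigr => k _.
    rewrite /c [RHS]mulrACA -exprD.
    have kn : (k <= n)%N by rewrite -ltnS.
    by rewrite subSn // addSn addnS subnKC.
  have sq : \sum_(n < N.-1) \sum_(k < n.+1) c k * c (n - k)%N <=
      ((2 * beta)^-1) ^+ 2.
    apply: (le_trans (square_sum_ge _ c0)).
    have h : \sum_(k < N.-1) c k <= (2 * beta)^-1.
      apply: le_trans IH; case: N => [|N]; first by rewrite !big_ord0.
      rewrite big_ord_recl /= lerDr mulr_ge0 ?exprn_ge0 ?(ltW t0)//.
    rewrite ler_sqr // nnegrE ?sumr_ge0//.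
    by rewrite invr_ge0 mulr_ge0 ?(ltW beta0).
  apply: le_trans (lerD (aN _) (ler_wpM2l (ltW beta0) sq)) _.
  rewrite le_eqVlt; apply/orP; left; apply/eqP; field.
  by rewrite gt_eqF.
move=> n; rewrite b0 /= ler_pdivlMr ?exprn_gt0//.
apply: le_trans (bN n.+1); rewrite big_ord_recr /= lerDr.
by apply: sumr_ge0 => k _; rewrite mulr_ge0// exprn_ge0// ltW.
Qed.

End TriangularSums.

(** * Bounded linear and bilinear maps *)

Section BoundedMaps.
Variable R : realType.
Implicit Types E F G : normedModType R.

(** A predicate on bare functions, so that compositions and anonymous functions need no bundling;
    [lin_of] passes to the packed structure. *)
Definition blinear E F (f : E -> F) : Prop :=
  (forall a x y, f (a *: x + y) = a *: f x + f y) /\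
  exists M, 0 <= M /\ forall x, `|f x| <= M * `|x|.

Definition bbilinear E F G (B : E -> F -> G) : Prop :=
  [/\ forall y a x x', B (a *: x + x') y = a *: B x y + B x' y,
      forall x a y y', B x (a *: y + y') = a *: B x y + B x y' &
      exists M, 0 <= M /\ forall x y, `|B x y| <= M * `|x| * `|y|].

Definition lin_of E F (f : E -> F) (fl : blinear f) : {linear E -> F} :=
  HB.pack f (GRing.isLinear.Build R E F *:%R f fl.1).

Section Blinear.
Variables (E F : normedModType R) (f : E -> F) (fl : blinear f).

Lemma blin0 : f 0 = 0. Proof. exact: (linear0 (lin_of fl)). Qed.
Lemma blinD x y : f (x + y) = f x + f y. Proof. exact: (linearD (lin_of fl)). Qed.
Lemma blinB x y : f (x - y) = f x - f y. Proof. exact: (linearB (lin_of fl)). Qed.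
Lemma blinN x : f (- x) = - f x. Proof. exact: (linearN (lin_of fl)). Qed.
Lemma blinZ a x : f (a *: x) = a *: f x. Proof. exact: (linearZZ (lin_of fl)). Qed.
Lemma blin_sum I (r : seq I) (P : pred I) (g : I -> E) :
  f (\sum_(i <- r | P i) g i) = \sum_(i <- r | P i) f (g i).
Proof. exact: (linear_sum (lin_of fl)). Qed.

Lemma blin_continuous : continuous f.
Proof.
have [_ [M [_ fM]]] := fl.
apply: (@bounded_linear_continuous _ _ _ (lin_of fl)).
apply/linear_boundedP; near=> r => x.
apply: le_trans (fM x) _; rewrite ler_wpM2r//.
Unshelve. all: by end_near. Qed.
End Blinear.

Lemma blin_comp E F G (g : F -> G) (f : E -> F) :
  blinear g -> blinear f -> blinear (g \o f).
Proof.
move=> gl fl; have [_ [M [M0 gM]]] := gl; have [_ [N [N0 fN]]] := fl.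
split=> [a x y|]; first by rewrite /= fl.1 gl.1.
exists (M * N); split; first exact: mulr_ge0.
by move=> x; rewrite -mulrA (le_trans (gM _))// ler_wpM2l.
Qed.

Lemma blin_id E : blinear (@id E).
Proof. by split=> //; exists 1; split=> // x; rewrite mul1r. Qed.

Lemma blin_fst E F : blinear (@fst E F).
Proof.
split=> [a [x x'] [y y']//|]; exists 1; split=> // -[x y].
by rewrite mul1r prod_normE le_max lexx.
Qed.

Lemma blin_snd E F : blinear (@snd E F).
Proof.
split=> [a [x x'] [y y']//|]; exists 1; split=> // -[x y].
by rewrite mul1r prod_normE le_max lexx orbT.
Qed.

Lemma blin_add E F (f g : E -> F) :
  blinear f -> blinear g -> blinear (fun x => f x + g x).
Proof.
move=> fl gl; have [_ [M [M0 fM]]] := fl; have [_ [N [N0 gN]]] := gl.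
split=> [a x y|]; first by rewrite fl.1 gl.1 scalerDr addrACA.
exists (M + N); split; first exact: addr_ge0.
by move=> x; rewrite mulrDl (le_trans (ler_normD _ _))// lerD.
Qed.

Lemma blin_scale E F k (f : E -> F) : blinear f -> blinear (fun x => k *: f x).
Proof.
move=> fl; have [_ [M [M0 fM]]] := fl.
split=> [a x y|]; first by rewrite fl.1 scalerDr !scalerA mulrC.
exists (`|k| * M); split; first exact: mulr_ge0.
by move=> x; rewrite normrZ -mulrA ler_wpM2l.
Qed.

Lemma blin_sub E F (f g : E -> F) :
  blinear f -> blinear g -> blinear (fun x => f x - g x).
Proof.
move=> fl gl; have := blin_add fl (blin_scale (-1) gl).
by rewrite (_ : (fun x => _) = fun x => f x - g x)//; apply: funext => x; rewrite scaleN1r.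
Qed.

Section Bbilinear.
Variables (E F G : normedModType R) (B : E -> F -> G) (Bb : bbilinear B).

Lemma bbil_l y : blinear (B ^~ y).
Proof.
have [Bl _ [M [M0 BM]]] := Bb; split=> //.
by exists (M * `|y|); split=> [|x]; rewrite ?mulr_ge0// mulrAC.
Qed.

Lemma bbil_r x : blinear (B x).
Proof.
have [_ Br [M [M0 BM]]] := Bb; split=> //.
by exists (M * `|x|); split=> [|y]; rewrite ?mulr_ge0.
Qed.

(** The splitting B u v - B a b = B (u - a) v + B a (v - b) bounds the error by M |u - a| |v| + M
    |a| |v - b|, which tends to 0. *)
Lemma bbil_cvg T (Fi : set_system T) {FF : Filter Fi} (u : T -> E) (v : T -> F) a b :
  u @ Fi --> a -> v @ Fi --> b -> (fun x => B (u x) (v x)) @ Fi --> B a b.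
Proof.
move=> ua vb; have [_ _ [M [M0 BM]]] := Bb.
have hz : (fun x => M * `|u x - a| * `|v x| + M * `|a| * `|v x - b|) @ Fi --> (0 : R).
  rewrite (_ : (0 : R) = M * 0 * `|b| + M * `|a| * 0); last by rewrite !mulr0 mul0r add0r.
  have u0 : (fun x => `|u x - a|) @ Fi --> (0 : R).
    rewrite -(@normr0 _ E) -(subrr a); apply: cvg_norm; apply: cvgB => //; exact: cvg_cst.
  have v0 : (fun x => `|v x - b|) @ Fi --> (0 : R).
    rewrite -(@normr0 _ F) -(subrr b); apply: cvg_norm; apply: cvgB => //; exact: cvg_cst.
  apply: cvgD; apply: cvgM; [apply: cvgM| | | ] => //; try exact: cvg_cst.
  exact: cvg_norm.
apply/cvgrPdist_le => e e0; move/cvgrPdist_le : hz => /(_ e e0).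
apply: filterS => x; rewrite sub0r normrN ger0_norm; last first.
  by rewrite addr_ge0 ?mulr_ge0.
apply: le_trans; rewrite distrC.
have -> : B (u x) (v x) - B a b = B (u x - a) (v x) + B a (v x - b).
  by rewrite (blinB (bbil_l _)) (blinB (bbil_r _)) addrA subrK.
by rewrite (le_trans (ler_normD _ _))// lerD.
Qed.
End Bbilinear.

Lemma bbil_comp E F G E' F' (B : E -> F -> G) (f : E' -> E) (g : F' -> F) :
  bbilinear B -> blinear f -> blinear g -> bbilinear (fun x y => B (f x) (g y)).
Proof.
move=> Bb fl gl; have [Bl Br [M [M0 BM]]] := Bb.
have [_ [N [N0 fN]]] := fl; have [_ [K [K0 gK]]] := gl.
split=> [y a x x'|x a y y'|]; first by rewrite fl.1 Bl.
  by rewrite gl.1 Br.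
exists (M * N * K); split=> [|x y]; first by rewrite !mulr_ge0.
apply: le_trans (BM _ _) _.
have -> : M * N * K * `|x| * `|y| = M * (N * `|x|) * (K * `|y|) by ring.
by rewrite ler_pM ?mulr_ge0// ler_wpM2l.
Qed.

Lemma blin_bbil_comp E F G G' (B : E -> F -> G) (f : G -> G') :
  bbilinear B -> blinear f -> bbilinear (fun x y => f (B x y)).
Proof.
move=> Bb fl; have [Bl Br [M [M0 BM]]] := Bb; have [_ [N [N0 fN]]] := fl.
split=> [y a x x'|x a y y'|]; first by rewrite Bl fl.1.
  by rewrite Br fl.1.
exists (N * M); split=> [|x y]; first by rewrite !mulr_ge0.
by apply: le_trans (fN _) _; rewrite -!mulrA ler_wpM2l// mulrA.
Qed.

End BoundedMaps.

(** * Cauchy products of geometrically bounded series *)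

Section GeometricSeries.
Variable R : realType.

(** As n <= 2^n and 8 = 2^3, the term is at most |K| 2^-n. This is the shape of the error in
    [cauchy_product]. *)
Lemma cvg_sqrn_exprV8 (K : R) : (fun n => K * n%:R ^+ 2 * 8^-1 ^+ n : R) @ \oo --> 0.
Proof.
have h : (fun n => `|K| * 2^-1 ^+ n : R) @ \oo --> 0.
  rewrite -[X in _ --> X](mulr0 `|K|); apply: cvgM; first exact: cvg_cst.
  by apply: cvg_expr; rewrite ger0_norm ?invr_ge0// invf_lt1// ltr1n.
apply/cvgrPdist_le => e e0; move/cvgrPdist_le : h => /(_ e e0).
apply: filterS => n; rewrite !sub0r !normrN; apply: le_trans.
rewrite !normrM normr_id -mulrA ler_wpM2l//.
have n2 : (n%:R : R) <= 2 ^+ n by rewrite -natrX ler_nat ltnW// ltn_expl.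
have -> : (8 : R)^-1 ^+ n = 2^-1 ^+ n * 2^-1 ^+ n * 2^-1 ^+ n.
  by rewrite -!exprMn; congr (_ ^+ n); field.
rewrite ger0_norm ?exprn_ge0// ![in leLHS]ger0_norm ?exprn_ge0 ?mulr_ge0//.
rewrite mulrA [`|2^-1 ^+ n|]ger0_norm ?exprn_ge0// ler_piMl ?exprn_ge0//.
have -> : n%:R ^+ 2 * (2^-1 ^+ n * 2^-1 ^+ n) = (n%:R / 2 ^+ n) ^+ 2 :> R.
  by rewrite exprMn exprVn -expr2.
by rewrite exprn_ile1 // ?ler_pdivrMr ?exprn_gt0 ?mul1r// divr_ge0 ?exprn_ge0.
Qed.

(** The product of the partial sums exceeds the partial sum of the Cauchy product by the pairs k, l
    < N with k + l >= N. There are at most N^2 of them, each bounded by M C^2 8^-N. *)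
Lemma cauchy_product (E F G : normedModType R) (B : E -> F -> G) a b (C : R) al be :
  bbilinear B -> (forall n, `|a n| <= C * 8^-1 ^+ n) ->
  (forall n, `|b n| <= C * 8^-1 ^+ n) ->
  series a @ \oo --> al -> series b @ \oo --> be ->
  series (fun n => \sum_(k < n.+1) B (a k) (b (n - k)%N)) @ \oo --> B al be.
Proof.
move=> Bb aC bC aal bbe; have [_ _ [M [M0 BM]]] := Bb.
have C0 : 0 <= C.
  by apply: le_trans (normr_ge0 (a 0%N)) _; rewrite (le_trans (aC 0%N))// mulr1.
have h : (fun N => B (series a N) (series b N)) @ \oo --> B al be by exact: bbil_cvg.
pose tail N := \sum_(k < N) \sum_(N - k <= l < N) B (a k) (b l).
suff tail0 : tail @ \oo --> (0 : G).
  rewrite -[X in _ --> X]subr0.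
  rewrite [X in X @ _ --> _](_ : _ = fun N => B (series a N) (series b N) - tail N).
    exact: (cvgB h tail0).
  apply/funext => N; rewrite /series /= !big_mkord.
  rewrite [LHS](triangular_sum (fun k l => B (a k) (b l))).
  rewrite (blin_sum (bbil_l Bb _)) -sumrB; apply: eq_bigr => k _.
  rewrite (blin_sum (bbil_r Bb _)) -(big_mkord xpredT (fun l => B (a k) (b l))).
  rewrite -(big_mkord xpredT (fun l => B (a k) (b l))) /=.
  by rewrite [X in _ = X - _](big_cat_nat (n := (N - k)%N))//= ?leq_subr// addrK.
apply/cvgrPdist_le => e e0.
move/cvgrPdist_le : (cvg_sqrn_exprV8 (M * C * C)) => /(_ e e0).
apply: filterS => N; rewrite !sub0r !normrN; apply: le_trans.
rewrite [leRHS]ger0_norm ?mulr_ge0 ?exprn_ge0//.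
apply: le_trans (ler_norm_sum _ _ _) _.
have -> : M * C * C * N%:R ^+ 2 * 8^-1 ^+ N =
  \sum_(k < N) N%:R * (M * C * C * 8^-1 ^+ N) :> R.
  by rewrite sumr_const card_ord -mulr_natl; ring.
apply: ler_sum => k _.
apply: le_trans (ler_norm_sum _ _ _) _.
apply: (@le_trans _ _ (\sum_(N - k <= l < N) (M * C * C * 8^-1 ^+ N))).
  rewrite !big_nat; apply: ler_sum => l /andP[kl lN].
  apply: le_trans (BM _ _) _.
  apply: (@le_trans _ _ (M * (C * 8^-1 ^+ k) * (C * 8^-1 ^+ l))).
    by rewrite ler_pM// ?mulr_ge0// ler_wpM2l.
  have -> : M * (C * 8^-1 ^+ k) * (C * 8^-1 ^+ l) = M * C * C * 8^-1 ^+ (k + l) :> R.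
    by rewrite exprD; ring.
  rewrite ler_wpM2l ?mulr_ge0// ler_wiXn2l ?invr_ge0 ?invf_le1// ?ler1n//.
  by rewrite -leq_subLR.
rewrite sumr_const_nat -[leLHS]mulr_natl ler_wpM2r ?mulr_ge0 ?exprn_ge0// ler_nat.
exact: leq_subr.
Qed.

Lemma cvg_series_V8 (F : completeNormedModType R) (a : nat -> F) (C : R) :
  (forall n, `|a n| <= C * 8^-1 ^+ n) -> cvgn (series a).
Proof.
move=> aC; apply: normed_cvg; apply: (series_le_cvg (v_ := geometric C 8^-1)).
- by move=> n /=.
- by move=> n /=; apply: le_trans (aC n).
- by move=> n /=.
- apply: is_cvg_geometric_series.
  by rewrite ger0_norm ?invr_ge0// invf_lt1// ltr1n.
Qed.

Lemma series_limit_le (F : normedModType R) (a : nat -> F) l K :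
  (forall N, `|series a N| <= K) -> series a @ \oo --> l -> `|l| <= K.
Proof.
move=> aK al; apply/ler_addgt0Pr => e e0; near \oo => N.
rewrite -[l](subrK (series a N)) (le_trans (ler_normD _ _))// addrC lerD//.
by near: N; move/cvgrPdist_le : al; apply.
Unshelve. all: by end_near. Qed.

End GeometricSeries.

(** * Calculus of analytic maps *)

Section PowerSeries.
Variable R : realType.
Implicit Types E F G : normedModType R.

Definition upd E (v : nat -> E) i z : nat -> E :=
  fun j => if j == i then z else v j.

(** In a product of a k-linear and an l-linear map, the second factor reads its arguments from
    position k on. Infinite sequences make this a plain shift, without casts between index types. *)
Definition shiftn E k (v : nat -> E) : nat -> E := fun i => v (k + i)%N.

(* An n-linear map, encoded as a function of infinite sequences which only
   depends on the first n entries. *)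
Definition homog E F n (P : (nat -> E) -> F) : Prop :=
  (forall v w, (forall i, (i < n)%N -> v i = w i) -> P v = P w) /\
  forall v i a x y, (i < n)%N ->
    P (upd v i (a *: x + y)) = a *: P (upd v i x) + P (upd v i y).

Definition has_pseries E F (f : E -> F) x (P : nat -> (nat -> E) -> F) C r : Prop :=
  [/\ 0 < r, forall n, homog n (P n),
      forall n v, `|P n v| <= C * r ^- n * \prod_(i < n) `|v i| &
      \forall h \near (0 : E), series (fun n => P n (fun=> h)) @ \oo --> f (x + h)].

Definition extn E n (v : 'I_n -> E) : nat -> E :=
  fun i => oapp v 0 (insub i).

Lemma extnE E n (v : 'I_n -> E) (i : 'I_n) : extn v i = v i.
Proof. by rewrite /extn valK. Qed.

(** Padding a tuple by zeros with [extn] is harmless, because a map satisfying [homog n] reads only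
    the first n entries. *)
Lemma analytic_atP E F (f : E -> F) x :
  analytic_at f x <-> exists P C r, has_pseries f x P C r.
Proof.
split=> [[p [C [r [r0 ml bd cv]]]]|[P [C [r [r0 hom bd cv]]]]].
  exists (fun n v => p n (fun i => v i)), C, r; split=> // n.
  split=> [v w vw|v i a y z i_n]; first by congr (p n); apply/funext => i; exact: vw.
  exact: (ml n (fun i => v i) (Ordinal i_n)).
exists (fun n v => P n (extn v)), C, r; split=> //.
- move=> n v i a y z upd'.
  have E' w : P n (extn (upd' w)) = P n (upd (extn v) i w).
    apply: (hom n).1 => j jn; rewrite (extnE (upd' w) (Ordinal jn)) /upd' /upd.
    by rewrite -(extnE v (Ordinal jn)).
  by rewrite !E' (hom n).2.
- by move=> n v; apply: le_trans (bd _ _) _; under eq_bigr do rewrite extnE.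
- move: cv; apply: filterS => h.
  rewrite (_ : (fun n => P n (fun=> h)) = (fun n => P n (@extn _ n (fun=> h))))//.
  apply/funext => n; apply: (hom n).1 => i i_n.
  by rewrite (extnE (fun=> h) (Ordinal i_n)).
Qed.

Lemma pseries_coef_ge0 E F (P : nat -> (nat -> E) -> F) (C r : R) :
  (forall n v, `|P n v| <= C * r ^- n * \prod_(i < n) `|v i|) -> 0 <= C.
Proof.
move=> bd; apply: le_trans (normr_ge0 (P 0%N (fun=> 0))) (le_trans (bd 0%N _) _).
by rewrite big_ord0 expr0 invr1 !mulr1.
Qed.

Lemma has_pseriesW E F (f : E -> F) x P C r C' r' :
  0 < r' -> r' <= r -> C <= C' -> has_pseries f x P C r -> has_pseries f x P C' r'.
Proof.
move=> r'0 r'r CC' [r0 hom bd cv]; split=> // n v.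
have C0 := pseries_coef_ge0 bd.
apply: le_trans (bd n v) _; rewrite ler_wpM2r ?prodr_ge0//.
apply: ler_pM => //; first by rewrite invr_ge0 exprn_ge0// ltW.
rewrite lef_pV2 ?posrE ?exprn_gt0//.
by apply: lerXn2r => //; rewrite nnegrE ltW.
Qed.

Lemma pseries_const E F (f : E -> F) x P C r :
  has_pseries f x P C r -> forall v, P 0%N v = f x.
Proof.
move=> [r0 hom bd cv] v; have := nbhs_singleton cv; rewrite addr0 => h.
have Pn n : P n.+1 (fun=> 0) = 0.
  apply/normr0_eq0/eqP; rewrite eq_le normr_ge0 andbT (le_trans (bd _ _))//.
  by rewrite big_ord_recl /= normr0 mul0r mulr0.
have h' : series (fun n => P n (fun=> (0 : E))) @ \oo --> P 0%N v.
  apply: cvg_near_cst; near=> n; rewrite /series /=.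
  have n0 : (0 < n)%N by near: n; exact: nbhs_infty_gt.
  rewrite -(prednK n0) big_nat_recl//= big1 ?addr0; last by move=> i _; exact: Pn.
  exact: (hom 0%N).1.
apply: cvg_unique h' h; exact: norm_hausdorff.
Unshelve. all: by end_near. Qed.

(** Within radius r / 8 the terms decay with the ratio 1/8 that [cauchy_product] and [cvg_series_V8]
    ask for. *)
Lemma homog_geometric E F (P : nat -> (nat -> E) -> F) (C r : R) : 0 < r ->
  (forall n v, `|P n v| <= C * r ^- n * \prod_(i < n) `|v i|) ->
  forall h, `|h| <= r / 8 -> forall n, `|P n (fun=> h)| <= C * 8^-1 ^+ n.
Proof.
move=> r0 bd h hr n.
have C0 := pseries_coef_ge0 bd.
apply: le_trans (bd n _) _; rewrite prodr_const card_ord -mulrA ler_wpM2l//.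
rewrite -exprVn -exprMn; apply: lerXn2r; rewrite ?nnegrE ?mulr_ge0 ?invr_ge0 ?(ltW r0)//.
by rewrite mulrC ler_pdivrMr// [_ * r]mulrC.
Qed.

Lemma homogD E F n (P Q : (nat -> E) -> F) :
  homog n P -> homog n Q -> homog n (fun v => P v + Q v).
Proof.
move=> [lP mP] [lQ mQ]; split=> [v w vw|v i a x y i_n].
  by rewrite (lP v w)// (lQ v w).
by rewrite mP// mQ// scalerDr addrACA.
Qed.

Lemma homog0 E F n : homog n (fun _ : nat -> E => 0 : F).
Proof. by split=> // *; rewrite scaler0 addr0. Qed.

Lemma homog_sum E F n I (s : seq I) (P : I -> (nat -> E) -> F) :
  (forall i, homog n (P i)) -> homog n (fun v => \sum_(i <- s) P i v).
Proof.
move=> PH; elim: s => [|i s IH].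
  rewrite (_ : (fun v => _) = fun=> 0); first exact: homog0.
  by apply/funext => v; rewrite big_nil.
rewrite (_ : (fun v => _) = fun v => P i v + \sum_(j <- s) P j v); first exact: homogD.
by apply/funext => v; rewrite big_cons.
Qed.

Lemma homog_blinear E F G n (P : (nat -> E) -> F) (f : F -> G) :
  blinear f -> homog n P -> homog n (fun v => f (P v)).
Proof.
by move=> fl [lP mP]; split=> [v w vw|*]; rewrite ?(lP v w) ?mP ?fl.1.
Qed.

Lemma homog_bbilinear E F1 F2 G k l (P : (nat -> E) -> F1) (Q : (nat -> E) -> F2)
    (B : F1 -> F2 -> G) :
  bbilinear B -> homog k P -> homog l Q ->
  homog (k + l) (fun v => B (P v) (Q (shiftn k v))).
Proof.
move=> Bb [lP mP] [lQ mQ]; split=> [v w vw|v i a x y i_n].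
  rewrite (lP v w); last by move=> i ik; apply: vw; rewrite ltn_addr.
  by rewrite (lQ _ (shiftn k w))// => i il; apply: vw; rewrite ltn_add2l.
have [ik|ki] := ltnP i k.
  have sE z : shiftn k (upd v i z) = shiftn k v.
    apply/funext => j; rewrite /shiftn /upd ifN//.
    by apply/eqP => kj; move: ik; rewrite -kj ltnNge leq_addr.
  by rewrite !sE mP// (bbil_l Bb _).1.
have sE z : shiftn k (upd v i z) = upd (shiftn k v) (i - k)%N z.
  apply/funext => j; rewrite /shiftn /upd -[in LHS](subnKC ki).
  by rewrite eqn_add2l.
have pE z : P (upd v i z) = P v.
  apply: lP => j jk; rewrite /upd ifN//; apply/eqP => ji.
  by move: jk; rewrite ji ltnNge ki.
rewrite !sE !pE mQ ?(bbil_r Bb _).1//.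
by rewrite ltn_subLR.
Qed.

Lemma prod_shiftn E (v : nat -> E) k l :
  \prod_(i < k + l) `|v i| = \prod_(i < k) `|v i| * \prod_(i < l) `|shiftn k v i|.
Proof. by rewrite big_split_ord. Qed.

Lemma analytic_cst E F (c : F) x : analytic_at (fun _ : E => c) x.
Proof.
apply/analytic_atP; exists (fun n _ => if n is 0 then c else 0), `|c|, 1.
split=> //; first by case=> [|n]; split=> // *; rewrite scaler0 addr0.
  by case=> [|n] v; rewrite ?normr0 ?mulr_ge0 ?prodr_ge0// big_ord0 expr1n invr1 !mulr1.
apply: nearW => h; apply: cvg_near_cst; near=> n; rewrite /series /=.
have n0 : (0 < n)%N by near: n; exact: nbhs_infty_gt.
by rewrite -(prednK n0) big_nat_recl//= big1 ?addr0.
Unshelve. all: by end_near. Qed.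

Lemma analytic_blinear E F (f : E -> F) x : blinear f -> analytic_at f x.
Proof.
move=> fl; have [_ [M [M0 fM]]] := fl.
apply/analytic_atP.
exists (fun n v => match n with 0 => f x | 1 => f (v 0%N) | _ => 0 end),
  (`|f x| + M), 1.
split=> //.
- case=> [|[|n]]; split=> //.
  + by move=> v w vw; rewrite vw.
  + by move=> v i a y z; rewrite ltnS leqn0 => /eqP ->; rewrite /upd /= fl.1.
  + by move=> *; rewrite scaler0 addr0.
- case=> [|[|n]] v; rewrite ?normr0 ?mulr_ge0 ?addr_ge0 ?prodr_ge0//.
    by rewrite big_ord0 expr1n invr1 !mulr1 lerDl.
  rewrite big_ord1 expr1n invr1 mulr1 (le_trans (fM _))// ler_wpM2r//.
  by rewrite lerDr.
- apply: nearW => h; apply: cvg_near_cst; near=> n; rewrite /series /=.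
  have n1 : (1 < n)%N by near: n; exact: nbhs_infty_gt.
  have n0 : (0 < n.-1)%N by rewrite -ltnS prednK// ltnW.
  rewrite -(prednK (ltnW n1)) big_nat_recl//= -(prednK n0) big_nat_recl//=.
  by rewrite big1 ?addr0 ?(blinD fl).
Unshelve. all: by end_near. Qed.

Lemma analytic_id E (x : E) : analytic_at id x.
Proof. exact/analytic_blinear/blin_id. Qed.

Lemma analyticD E F (f g : E -> F) x :
  analytic_at f x -> analytic_at g x -> analytic_at (fun y => f y + g y) x.
Proof.
move=> /analytic_atP[P [C [r H]]] /analytic_atP[P' [C' [r' H']]].
have [r0 _ _ _] := H; have [r'0 _ _ _] := H'.
set s := Num.min r r'; have s0 : 0 < s by rewrite lt_min r0.
have {}H : has_pseries f x P C s.
  by apply: has_pseriesW H => //; rewrite ge_min lexx.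
have {}H' : has_pseries g x P' C' s.
  by apply: has_pseriesW H' => //; rewrite ge_min lexx orbT.
have [_ hom bd cv] := H; have [_ hom' bd' cv'] := H'.
apply/analytic_atP; exists (fun n v => P n v + P' n v), (C + C'), s; split=> //.
- by move=> n; exact: homogD.
- move=> n v; apply: le_trans (ler_normD _ _) _.
  by rewrite -mulrA mulrDl lerD// mulrA.
- near=> h; rewrite [X in X @ _](_ : _ = fun n =>
    series (fun n => P n (fun=> h)) n + series (fun n => P' n (fun=> h)) n); last first.
    by apply/funext => n; rewrite /series /= big_split.
  by apply: cvgD; near: h.
Unshelve. all: by end_near. Qed.

Lemma analytic_blin_comp E F G (g : F -> G) (f : E -> F) x :
  blinear g -> analytic_at f x -> analytic_at (fun y => g (f y)) x.
Proof.
move=> gl /analytic_atP[P [C [r [r0 hom bd cv]]]]; have [_ [M [M0 gM]]] := gl.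
apply/analytic_atP; exists (fun n v => g (P n v)), (M * C), r; split=> //.
- by move=> n; exact: homog_blinear.
- by move=> n v; apply: le_trans (gM _) _; rewrite -!mulrA ler_wpM2l// mulrA.
- near=> h; rewrite [X in X @ _](_ : _ = fun n =>
    g (series (fun n => P n (fun=> h)) n)); last first.
    by apply/funext => n; rewrite /series /= (blin_sum gl).
  apply: (@continuous_cvg _ _ _ _ _ (series (fun n => P n (fun=> h))) g).
    exact: blin_continuous.
  by near: h.
Unshelve. all: by end_near. Qed.

Lemma analytic_comp_blin E F G (f : F -> G) (g : E -> F) x :
  blinear g -> analytic_at f (g x) -> analytic_at (fun y => f (g y)) x.
Proof.
move=> gl /analytic_atP[P [C [r H]]]; have [_ [M [M0 gM]]] := gl.
(* The bound M of [g] may be 0, so the radius is divided by M + 1. *)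
have [r0 hom bd cv] := H; have K0 : 0 < M + 1 by rewrite ltr_wpDl.
have C0 := pseries_coef_ge0 bd.
apply/analytic_atP; exists (fun n v => P n (fun i => g (v i))), C, (r / (M + 1)).
split=> //; first by rewrite divr_gt0.
- move=> n; split=> [v w vw|v i a y z i_n].
    by apply: (hom n).1 => i i_n; rewrite vw.
  have E' u : (fun j => g (upd v i u j)) = upd (fun j => g (v j)) i (g u).
    by apply/funext => j; rewrite /upd; case: ifP.
  by rewrite !E' gl.1 (hom n).2.
- move=> n v; apply: le_trans (bd _ _) _.
  rewrite exprMn exprVn invfM invrK -!mulrA ler_wpM2l//.
  rewrite ler_wpM2l ?invr_ge0 ?exprn_ge0 ?(ltW r0)//.
  have -> : (M + 1) ^+ n * \prod_(i < n) `|v i| = \prod_(i < n) ((M + 1) * `|v i|).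
    by rewrite big_split /= prodr_const card_ord.
  apply: ler_prod => i _; rewrite normr_ge0 /= (le_trans (gM _))//.
  by rewrite ler_wpM2r// lerDl.
- have g0 : g @ (0 : E) --> (0 : F) by rewrite -(blin0 gl); exact: blin_continuous.
  have cv' : \forall h \near (0 : E),
    series (fun n => P n (fun=> g h)) @ \oo --> f (g x + g h) := g0 _ cv.
  by move: cv'; apply: filterS => h; rewrite (blinD gl).
Qed.

(** The coefficient of degree n has n + 1 terms, each within M K^2 s^-n; since n + 1 <= 2^n, halving
    the radius absorbs their number. *)
Lemma analytic_bbil E F1 F2 G (B : F1 -> F2 -> G) (f : E -> F1) (g : E -> F2) x :
  bbilinear B -> analytic_at f x -> analytic_at g x ->
  analytic_at (fun y => B (f y) (g y)) x.
Proof.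
move=> Bb /analytic_atP[P [C [r H]]] /analytic_atP[P' [C' [r' H']]].
have [_ _ [M [M0 BM]]] := Bb.
have [r0 _ _ _] := H; have [r'0 _ _ _] := H'.
set s := Num.min r r'; have s0 : 0 < s by rewrite lt_min r0.
set K := Num.max C C'.
have {}H : has_pseries f x P K s.
  by apply: has_pseriesW H => //; rewrite ?ge_min ?le_max lexx.
have {}H' : has_pseries g x P' K s.
  by apply: has_pseriesW H' => //; rewrite ?ge_min ?le_max lexx orbT.
have [_ hom bd cv] := H; have [_ hom' bd' cv'] := H'.
have K0 := pseries_coef_ge0 bd.
have s20 : 0 < s / 2 by rewrite divr_gt0.
apply/analytic_atP; exists
  (fun n v => \sum_(k < n.+1) B (P k v) (P' (n - k)%N (shiftn k v))),
  (M * K * K), (s / 2); split=> //.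
- move=> n; apply: homog_sum => k; have kn : (k <= n)%N by rewrite -ltnS.
  by have := homog_bbilinear Bb (hom k) (hom' (n - k)%N); rewrite subnKC.
- move=> n v; apply: le_trans (ler_norm_sum _ _ _) _.
  apply: (@le_trans _ _ (\sum_(k < n.+1) M * K * K * s ^- n * \prod_(i < n) `|v i|)).
    apply: ler_sum => k _; have kn : (k <= n)%N by rewrite -ltnS.
    have pE := prod_shiftn v k (n - k); rewrite subnKC// in pE; rewrite pE.
    have sE : s ^- n = s ^- k * s ^- (n - k).
      by rewrite -[in LHS](subnKC kn) exprD invfM.
    apply: le_trans (BM _ _) _.
    have -> : M * K * K * s ^- n *
        (\prod_(i < k) `|v i| * \prod_(i < n - k) `|shiftn k v i|) =
        M * (K * s ^- k * \prod_(i < k) `|v i|) *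
        (K * s ^- (n - k) * \prod_(i < n - k) `|shiftn k v i|).
      by rewrite sE; ring.
    by rewrite ler_pM ?mulr_ge0// ler_wpM2l.
  rewrite sumr_const card_ord -[leLHS]mulr_natl mulrA ler_wpM2r ?prodr_ge0//.
  rewrite exprMn exprVn invfM invrK mulrCA -!mulrA ler_wpM2l//.
  do 2!rewrite ler_wpM2l//.
  rewrite mulrC ler_wpM2l ?invr_ge0 ?exprn_ge0 ?(ltW s0)//.
  by rewrite -natrX ler_nat ltn_expl.
- near=> h; apply: (@cauchy_product _ _ _ _ B (fun k => P k (fun=> h))
    (fun k => P' k (fun=> h)) K _ _ Bb).
  + by apply: (homog_geometric s0 bd); near: h; apply: nbhs0_le; rewrite divr_gt0.
  + by apply: (homog_geometric s0 bd'); near: h; apply: nbhs0_le; rewrite divr_gt0.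
  + by near: h.
  + by near: h.
Unshelve. all: by end_near. Qed.

Lemma analytic_near E F (f g : E -> F) x :
  (\forall y \near x, f y = g y) -> analytic_at f x -> analytic_at g x.
Proof.
move=> fg [p [C [r [r0 ml bd cv]]]]; exists p, C, r; split=> //.
have fg' : \forall h \near (0 : E), f (x + h) = g (x + h) by move/nbhs0P : fg.
by near=> h; rewrite -(near fg' h)//; near: h.
Unshelve. all: by end_near. Qed.

Lemma analytic_differential E F (f : E -> F) x : analytic_at f x ->
  exists df : E -> F, blinear df /\
    exists2 K : R, 0 <= K & \forall h \near (0 : E),
      `|f (x + h) - f x - df h| <= K * `|h| ^+ 2.
Proof.
move=> /analytic_atP[P [C [r H]]]; have [r0 hom bd cv] := H.
have C0 := pseries_coef_ge0 bd.
pose df h := P 1%N (fun=> h).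
have dfl : blinear df.
  split=> [a y z|].
    have E' u : df u = P 1%N (upd (fun=> u) 0 u).
      by congr (P 1%N _); apply/funext => j; rewrite /upd; case: ifP.
    have E'' u : df u = P 1%N (upd (fun=> 0) 0 u).
      by apply: (hom 1%N).1 => -[|//] _; rewrite /upd eqxx.
    by rewrite !E'' (hom 1%N).2.
  exists (C / r); split; first by rewrite divr_ge0// ltW.
  by move=> h; apply: le_trans (bd _ _) _; rewrite big_ord1 expr1.
(* With q = |h| / r <= 1/2, the terms of degree at least 2 sum to at most C q^2 (1 + 1/2 + 1/4 +
   ...) = 2 C q^2. *)
exists df; split=> //; exists (2 * C / r ^+ 2).
  by rewrite divr_ge0 ?exprn_ge0 ?mulr_ge0 ?(ltW r0).
near=> h.
have cvh : series (fun n => P n (fun=> h)) @ \oo --> f (x + h) by near: h.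
have hr : `|h| <= r / 2 by near: h; apply: nbhs0_le; rewrite divr_gt0.
pose q := `|h| / r.
have q0 : 0 <= q by rewrite divr_ge0// ltW.
have q2 : q <= 2^-1 by rewrite /q ler_pdivrMr// mulrC.
have cv2 : series (fun n => P n.+2 (fun=> h)) @ \oo --> f (x + h) - f x - df h.
  rewrite [X in X @ _](_ : _ = fun n =>
    series (fun n => P n (fun=> h)) (n + 2)%N - f x - df h).
    by apply: cvgB; [apply: cvgB|]; [rewrite (cvg_shiftn 2)|exact: cvg_cst|exact: cvg_cst].
  apply/funext => n; rewrite /series /= addn2 big_nat_recl// big_nat_recl//=.
  by rewrite (pseries_const H) -/(df h) [f x + _]addrC addrK addrC addKr.
have -> : 2 * C / r ^+ 2 * `|h| ^+ 2 = 2 * C * q ^+ 2.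
  by rewrite /q exprMn exprVn; ring.
apply: series_limit_le cv2 => N.
apply: le_trans (ler_norm_sum _ _ _) _.
have step n : `|P n.+2 (fun=> h)| <= C * q ^+ 2 * 2^-1 ^+ n.
  apply: le_trans (bd _ _) _; rewrite prodr_const card_ord -mulrA -exprVn -exprMn.
  rewrite -mulrA ler_wpM2l// [_^-1 * _]mulrC -/q -addn2 exprD mulrC ler_wpM2l ?exprn_ge0//.
  by rewrite lerXn2r ?nnegrE ?invr_ge0.
apply: (@le_trans _ _ (C * q ^+ 2 * 2)); last by rewrite mulrC mulrA.
apply: (@le_trans _ _ (\sum_(0 <= n < N) C * q ^+ 2 * 2^-1 ^+ n)).
  by apply: ler_sum => n _; exact: step.
rewrite -mulr_sumr big_mkord ler_wpM2l//; first by rewrite mulr_ge0 ?(exprn_ge0 _ q0).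
apply: (@le_trans _ _ (2 - 2 * 2^-1 ^+ N)); last first.
  by rewrite gerBl mulr_ge0// exprn_ge0// invr_ge0.
rewrite le_eqVlt; apply/orP; left; apply/eqP.
elim: N => [|N IH]; first by rewrite big_ord0 expr0 mulr1 subrr.
by rewrite big_ord_recr /= IH exprS; field.
Unshelve. all: by end_near. Qed.

(** A quadratic remainder is little-o, since K |h| <= e once |h| <= e / (K + 1). All differentials
    below are identified through such an estimate. *)
Lemma diff_of_estimate E F (f : E -> F) x (df : E -> F) (K : R) :
  blinear df -> 0 <= K ->
  (\forall h \near (0 : E), `|f (x + h) - f x - df h| <= K * `|h| ^+ 2) ->
  differentiable f x /\ 'd f x = df :> (E -> F).
Proof.
move=> dfl K0 est.
have E1 : f \o shift x = cst (f x) + lin_of dfl +o_ (0 : E) id.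
  apply/eqaddoP => e e0; near=> h.
  rewrite /= !fctE /= /cst.
  have -> : f (h + x) - (f x + df h) = f (x + h) - f x - df h.
    by rewrite opprD addrA [h + x]addrC.
  apply: le_trans (near est h _) _ => //.
  have hK : `|h| <= e / (K + 1).
    by near: h; apply: nbhs0_le; rewrite divr_gt0// ltr_wpDl.
  rewrite expr2 mulrA ler_wpM2r//.
  apply: le_trans (ler_wpM2l K0 hK) _.
  by rewrite mulrCA ler_piMr ?(ltW e0)// ler_pdivrMr ?mul1r ?lerDl// ltr_wpDl.
have dE : 'd f x = df :> (E -> F).
  by apply: (@diff_unique _ _ _ _ (lin_of dfl)) => //; exact: (blin_continuous dfl).
split=> //; apply/diff_locallyP; split; first by rewrite dE; exact: (blin_continuous dfl).
by rewrite dE.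
Unshelve. all: by end_near. Qed.

Lemma analytic_differentiable E F (f : E -> F) x :
  analytic_at f x -> differentiable f x.
Proof.
move=> /analytic_differential[df [dfl [K K0 est]]].
by case: (diff_of_estimate dfl K0 est).
Qed.

Lemma analytic_continuous E F (f : E -> F) x :
  analytic_at f x -> {for x, continuous f}.
Proof. by move=> /analytic_differentiable/differentiable_continuous. Qed.

End PowerSeries.

(** * Quadratic equations in analytic functions *)

(** [qf m] carries fuel m and is stable at index n as soon as m > n, so its diagonal solves the
    equation. Plain recursion does not suffice, as the Taylor coefficients refer to all lower
    degrees. *)
Lemma strong_recursion T (t0 : T) (Phi : nat -> (nat -> T) -> T) :
  (forall n f g, (forall k, (k < n)%N -> f k = g k) -> Phi n f = Phi n g) ->
  exists q, forall n, q n = Phi n q.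
Proof.
move=> ext.
pose qf := fix qf (m n : nat) {struct m} : T :=
  if m is m'.+1 then Phi n (qf m') else t0.
have qfE m m' n : (n < m)%N -> (n < m')%N -> qf m n = qf m' n.
  elim: m m' n => [//|m IH] [//|m'] n nm nm' /=.
  by apply: ext => k kn; apply: IH; apply: leq_trans kn _.
exists (fun n => qf n.+1 n) => n; rewrite -[LHS]/(Phi n (qf n)).
by apply: ext => k kn; apply: (qfE n k.+1).
Qed.

Section QuadraticFixpoint.
Variables (R : realType) (E : normedModType R) (F : completeNormedModType R).
Variables (B B' : F -> F -> F) (Bb : bbilinear B) (Bb' : bbilinear B').

(* The Taylor coefficients of the solution are determined recursively and the
   resulting series is controlled by [quadratic_majorant]. *)
Lemma quadratic_fixpoint (f : E -> F) x : analytic_at f x -> f x = 0 ->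
  exists w : E -> F, [/\ analytic_at w x, w x = 0 &
    \forall h \near (0 : E), w (x + h) =
      f (x + h) + B (w (x + h)) (w (x + h)) + B' (w (x + h)) (f (x + h))].
Proof.
move=> /analytic_atP[P [C [r H]]] fx0.
have [r0 hom bd cv] := H; have C0 := pseries_coef_ge0 bd.
have [_ _ [M [M0 BM]]] := Bb; have [_ _ [M' [M'0 BM']]] := Bb'.
(* One constant dominates both bilinear terms, so that a single scalar recursion majorizes the
   equation; the summand 1 makes it positive and at least 1. *)
pose be := M + M' + 1.
have be0 : 0 < be by rewrite ltr_wpDl ?addr_ge0.
pose T := (nat -> E) -> F.
pose Phi n (q : nat -> T) : T := fun v => P n v + \sum_(k < n.-1)
  (B (q k.+1 v) (q (n.-1 - k)%N (shiftn k.+1 v)) +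
   B' (q k.+1 v) (P (n.-1 - k)%N (shiftn k.+1 v))).
have [q qE] : exists q, forall n, q n = Phi n q.
  apply: (@strong_recursion T (fun=> 0)) => n g g' gg'; apply/funext => v.
  congr (_ + _); apply: eq_bigr => k _.
  have kn : (k.+1 < n)%N by rewrite -ltn_predRL.
  have n0 : (0 < n)%N by exact: ltn_trans kn.
  by rewrite !gg'// (leq_ltn_trans (leq_subr _ _))// ltn_predL.
have [b bE] : exists b : nat -> R, forall n,
    b n = (if n is 0 then 0 else C * r ^- n) +
          be * \sum_(k < n.-1) b k.+1 * b (n.-1 - k)%N.
  apply: (@strong_recursion R 0) => n g g' gg'; congr (_ + _ * _).
  apply: eq_bigr => k _; have kn : (k.+1 < n)%N by rewrite -ltn_predRL.
  have n0 : (0 < n)%N by exact: ltn_trans kn.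
  by rewrite !gg'// (leq_ltn_trans (leq_subr _ _))// ltn_predL.
(* Chosen so that, with t = r th, the sum of C th^n over n >= 1 is at most 2 C th <= 1 / (4 be), the
   hypothesis of [quadratic_majorant]. The first bound uses th <= 1/2. *)
pose th := (8 * be * (C + 1))^-1.
have C1 : 0 < C + 1 by rewrite ltr_wpDl.
have th0 : 0 < th by rewrite invr_gt0 !mulr_gt0.
have th2 : th <= 2^-1.
  rewrite lef_pV2 ?posrE ?mulr_gt0//.
  have h1 : 1 <= be by rewrite lerDr addr_ge0.
  have h2 : 1 <= C + 1 by rewrite lerDr.
  by have := ler_pM ler01 ler01 h1 h2; lra.
have thC : C * th * 2 <= (4 * be)^-1.
  rewrite /th mulrAC ler_pdivrMr ?mulr_gt0//.
  have -> : (4 * be)^-1 * (8 * be * (C + 1)) = (C + 1) * 2 by field; rewrite gt_eqF.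
  by rewrite ler_pM2r// lerDl.
clearbody th; pose t := r * th; have t0 : 0 < t by rewrite mulr_gt0.
pose a n : R := if n is 0 then 0 else C * r ^- n.
have a0 n : 0 <= a n by case: n => //= n; rewrite mulr_ge0 ?invr_ge0 ?exprn_ge0 ?(ltW r0).
have aN N : \sum_(n < N) a n * t ^+ n <= (4 * be)^-1.
  apply: le_trans thC.
  apply: (@le_trans _ _ (C * th * (2 - 2 * 2^-1 ^+ N.-1))); last first.
    by rewrite ler_wpM2l ?mulr_ge0 ?(ltW th0)// gerBl mulr_ge0// exprn_ge0// invr_ge0.
  case: N => [|N]; first by rewrite big_ord0 expr0 mulr1 subrr mulr0.
  rewrite big_ord_recl /= mul0r add0r.
  elim: N => [|N IH]; first by rewrite big_ord0 expr0 mulr1 subrr mulr0.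
  rewrite big_ord_recr /=; apply: le_trans (lerD IH (lexx _)) _.
  rewrite -lerBrDl -mulrBr.
  have -> : 2 - 2 * 2^-1 ^+ N.+1 - (2 - 2 * 2^-1 ^+ N) = 2^-1 ^+ N :> R.
    by rewrite exprS; field.
  rewrite /t -exprVn.
  have -> : C * r^-1 ^+ N.+1 * (r * th) ^+ N.+1 = C * th * th ^+ N.
    rewrite exprMn mulrA -[C * _ * _]mulrA -exprMn mulVf ?gt_eqF//.
    by rewrite expr1n mulr1 exprS mulrA.
  rewrite ler_wpM2l ?mulr_ge0 ?(ltW th0)//.
  by rewrite lerXn2r ?nnegrE ?invr_ge0 ?(ltW th0).
have bP := quadratic_majorant be0 t0 a0 bE aN.
have b0 n : 0 <= b n by have /andP[] := bP n.
have qb n v : `|q n v| <= b n * \prod_(i < n) `|v i|.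
  elim/ltn_ind: n v => n IH v; rewrite qE bE mulrDl; apply: le_trans (ler_normD _ _) _.
  apply: lerD.
    case: n {IH} => [|n]; first by rewrite (pseries_const H) fx0 normr0 mul0r.
    exact: bd.
  apply: le_trans (ler_norm_sum _ _ _) _.
  rewrite -mulrA mulr_suml mulr_sumr; apply: ler_sum => k _.
  have kn : (k.+1 < n)%N by rewrite -ltn_predRL.
  have n0 : (0 < n)%N by exact: ltn_trans kn.
  set l := (n.-1 - k)%N.
  have ln : (l < n)%N by rewrite (leq_ltn_trans (leq_subr _ _))// ltn_predL.
  have l0 : (0 < l)%N by rewrite subn_gt0 ltn_predRL.
  have nE : (k.+1 + l)%N = n by rewrite addSn subnKC ?prednK// ltnW// ltn_predRL.
  have pE := prod_shiftn v k.+1 l; rewrite nE in pE; rewrite pE.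
  set p1 := \prod_(i < k.+1) _; set p2 := \prod_(i < l) _.
  have p10 : 0 <= p1 by exact: prodr_ge0.
  have p20 : 0 <= p2 by exact: prodr_ge0.
  have h1 := IH _ kn v; have h2 := IH _ ln (shiftn k.+1 v).
  (* In positive degree the coefficients of [f] lie below the majorant too, so the mixed term [B']
     obeys the same bound as [B]. *)
  have h3 : `|P l (shiftn k.+1 v)| <= b l * p2.
    apply: le_trans (bd _ _) _; apply: ler_wpM2r => //.
    rewrite bE; case: (l) l0 => // l' _.
    by rewrite lerDl mulr_ge0 ?(ltW be0)// sumr_ge0// => i _; exact: mulr_ge0.
  apply: (@le_trans _ _ ((M + M') * (b k.+1 * p1) * (b l * p2))); last first.
    have -> : be * (b k.+1 * b l * (p1 * p2)) = be * (b k.+1 * p1) * (b l * p2) by ring.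
    by rewrite !ler_wpM2r ?mulr_ge0// /be lerDl.
  rewrite !mulrDl; apply: le_trans (ler_normD _ _) _; apply: lerD.
    apply: le_trans (BM _ _) _; rewrite ler_pM ?mulr_ge0// ler_wpM2l//.
  apply: le_trans (BM' _ _) _; rewrite ler_pM ?mulr_ge0// ler_wpM2l//.
have qbd n v : `|q n v| <= (2 * be)^-1 * t ^- n * \prod_(i < n) `|v i|.
  apply: le_trans (qb n v) _; rewrite ler_wpM2r ?prodr_ge0//.
  by have /andP[] := bP n.
have qhom n : homog n (q n).
  elim/ltn_ind: n => n IH.
  rewrite (_ : q n = Phi n q); last exact: qE.
  apply: homogD => //; apply: homog_sum => k.
  have kn : (k.+1 < n)%N by rewrite -ltn_predRL.
  have n0 : (0 < n)%N by exact: ltn_trans kn.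
  set l := (n.-1 - k)%N.
  have ln : (l < n)%N by rewrite (leq_ltn_trans (leq_subr _ _))// ltn_predL.
  have nE : (k.+1 + l)%N = n by rewrite addSn subnKC ?prednK// ltnW// ltn_predRL.
  have h1 := homog_bbilinear Bb (IH _ kn) (IH _ ln).
  have h2 := homog_bbilinear Bb' (IH _ kn) (hom l).
  by rewrite nE in h1 h2; exact: homogD.
have q0 v : q 0%N v = 0 by rewrite qE /Phi big_ord0 addr0 (pseries_const H).
have P0 v : P 0%N v = 0 by rewrite (pseries_const H).
pose w y := lim (series (fun n => q n (fun=> y - x)) @ \oo).
have wE h : w (x + h) = lim (series (fun n => q n (fun=> h)) @ \oo).
  by rewrite /w addrC addKr.
have qgeo := homog_geometric t0 qbd; have Pgeo := homog_geometric r0 bd.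
have wcv h : `|h| <= t / 8 -> series (fun n => q n (fun=> h)) @ \oo --> w (x + h).
  by move=> ht; rewrite wE; apply: (cvg_series_V8 (qgeo h ht)).
exists w; split.
- apply/analytic_atP; exists q, (2 * be)^-1, t; split=> //.
  by near=> h; apply: wcv; near: h; apply: nbhs0_le; rewrite divr_gt0.
- rewrite -[x]addr0 wE; apply: cvg_lim; first exact: norm_hausdorff.
  apply: cvg_near_cst; apply: nearW => n; rewrite /series /= big1// => -[|i] _ //.
  apply/normr0_eq0/eqP; rewrite eq_le normr_ge0 andbT (le_trans (qbd _ _))//.
  by rewrite big_ord_recl /= normr0 mul0r mulr0.
- near=> h.
  have ht : `|h| <= t / 8 by near: h; apply: nbhs0_le; rewrite divr_gt0.
  have hr : `|h| <= r / 8 by near: h; apply: nbhs0_le; rewrite divr_gt0.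
  have cvf : series (fun n => P n (fun=> h)) @ \oo --> f (x + h) by near: h.
  pose K := Num.max C (2 * be)^-1.
  have Kq n : `|q n (fun=> h)| <= K * 8^-1 ^+ n.
    by apply: le_trans (qgeo h ht n) _; rewrite ler_wpM2r ?exprn_ge0// le_max lexx orbT.
  have KP n : `|P n (fun=> h)| <= K * 8^-1 ^+ n.
    by apply: le_trans (Pgeo h hr n) _; rewrite ler_wpM2r ?exprn_ge0// le_max lexx.
  (* Cauchy products turn both bilinear terms into series; the recursion for [q], summed over all
     degrees, is then the equation for [w]. *)
  have cB := cauchy_product Bb Kq Kq (wcv h ht) (wcv h ht).
  have cB' := cauchy_product Bb' Kq KP (wcv h ht) cvf.
  apply: (cvg_unique _ (wcv h ht)); first exact: norm_hausdorff.
  rewrite [X in X @ _](_ : _ = fun N => series (fun n => P n (fun=> h)) N +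
    series (fun n => \sum_(k < n.+1) B (q k (fun=> h)) (q (n - k)%N (fun=> h))) N +
    series (fun n => \sum_(k < n.+1) B' (q k (fun=> h)) (P (n - k)%N (fun=> h))) N).
    by apply: cvgD cB'; apply: cvgD cvf cB.
  apply/funext => N; rewrite /series /= -!big_split; apply: eq_bigr => -[|n] _ /=.
    by rewrite !big_ord1 q0 P0 (blin0 (bbil_l Bb _)) (blin0 (bbil_l Bb' _)) !addr0.
  rewrite qE /Phi /= big_split /= addrA.
  (* The full Cauchy product has two terms more than the recursion, the first and the last; they
     vanish because [q 0] and [P 0] do. *)
  congr (_ + _ + _).
    rewrite big_ord_recl q0 (blin0 (bbil_l Bb _)) add0r big_ord_recr /= subnn.
    rewrite q0 (blin0 (bbil_r Bb _)) addr0; apply: eq_bigr => k _.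
    by rewrite /bump /= add1n subSS.
  rewrite big_ord_recl q0 (blin0 (bbil_l Bb' _)) add0r big_ord_recr /= subnn.
  rewrite P0 (blin0 (bbil_r Bb' _)) addr0; apply: eq_bigr => k _.
  by rewrite /bump /= add1n subSS.
Unshelve. all: by end_near. Qed.

End QuadraticFixpoint.

Section Neumann.
Variables (R : realType) (F : completeNormedModType R).

(* The solution of z + L z = y is the sum of the series of (- L)^n y. *)
Lemma neumann (L : F -> F) (c : R) :
  (forall a x y, L (a *: x + y) = a *: L x + L y) ->
  0 <= c < 1 -> (forall x, `|L x| <= c * `|x|) ->
  exists N : F -> F, [/\ blinear N, forall y, N y + L (N y) = y &
    forall x, N (x + L x) = x].
Proof.
move=> Ll /andP[c0 c1] Lc.
have Lb : blinear L by split=> //; exists c.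
have LI x y : x + L x = y + L y -> x = y.
  move=> xy; apply/eqP; rewrite -subr_eq0 -normr_le0.
  have e : x - y = - L (x - y).
    apply/eqP; rewrite eq_sym -subr_eq0 -opprD oppr_eq0 addrC (blinB Lb) addrACA -opprD.
    by rewrite xy subrr.
  have := Lc (x - y); rewrite -normrN -e => h.
  by rewrite -(pmulr_rle0 _ (_ : 0 < 1 - c)) ?subr_gt0// mulrBl mul1r subr_le0.
have ex y : exists z, z + L z = y.
  pose a n := iter n (fun z => - L z) y.
  have aE n : `|a n| <= `|y| * c ^+ n.
    elim: n => [|n IH]; first by rewrite expr0 mulr1.
    rewrite /a iterS normrN (le_trans (Lc _))// exprS mulrCA ler_wpM2l//.
  have acv : cvgn (series a).
    apply: normed_cvg; apply: (series_le_cvg (v_ := geometric `|y| c)) => //=.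
    - by move=> n; rewrite mulr_ge0// exprn_ge0.
    - by apply: is_cvg_geometric_series; rewrite ger0_norm.
  set z := lim (series a @ \oo) in acv *.
  exists z.
  have c2 : (fun n => series a n.+1) @ \oo --> y - L z.
    rewrite [X in X @ _](_ : _ = fun n => y - L (series a n)).
      apply: cvgB; first exact: cvg_cst.
      by apply: (@continuous_cvg _ _ _ _ _ (series a) L); [exact: blin_continuous|].
    apply/funext => n; rewrite /series /= big_nat_recl//= (blin_sum Lb) -sumrN.
    by congr (_ + _).
  have c1' : (fun n => series a n.+1) @ \oo --> z.
    by move: acv; rewrite -(cvg_shiftS (series a)).
  have zE : z = y - L z by apply: cvg_unique c1' c2; exact: norm_hausdorff.
  by rewrite {1}zE subrK.
have [N NP] := boolp.choice ex.
have Nl a x y : N (a *: x + y) = a *: N x + N y.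
  by apply: LI; rewrite NP Ll addrACA -scalerDr !NP.
exists N; split=> [|//|x]; last by apply: LI; rewrite NP.
split=> //; exists (1 - c)^-1; split; first by rewrite invr_ge0 subr_ge0 ltW.
move=> x; rewrite ler_pdivlMl ?subr_gt0// mulrBl mul1r lerBlDr.
have hx : `|x| = `|N x + L (N x)| by rewrite NP.
rewrite hx; have := Lc (N x).
have : `|N x| <= `|N x + L (N x)| + `|L (N x)|.
  by rewrite -{1}[N x](addrK (L (N x))) ler_normB.
by move=> h1 h2; apply: le_trans h1 _; rewrite lerD2l.
Qed.

End Neumann.

(** * Inverses and square roots of operators near the identity *)

Section OperatorAlgebra.
Variables (R : realType) (H : hilbertType R).
Notation A := (bop H).
Implicit Types (S T U K Z : A) (a : R).

Lemma bop_normM S T : `|S * T| <= `|S| * `|T|.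
Proof. by apply: opnorm_le; apply: op_bound_comp; exact: opnorm_bound. Qed.

Lemma bscaleAl a S T : a *: S * T = a *: (S * T).
Proof. exact: bop_ext. Qed.

Lemma bscaleAr a S T : S * (a *: T) = a *: (S * T).
Proof. by apply: bop_ext => x; exact: linearZZ. Qed.

Lemma bbil_mul : bbilinear (fun S T : A => S * T).
Proof.
split=> [T a S S'|S a T T'|].
- by rewrite mulrDl bscaleAl.
- by rewrite mulrDr bscaleAr.
- by exists 1; split=> // S T; rewrite mul1r bop_normM.
Qed.

Lemma blin_mull S : blinear (fun T : A => S * T).
Proof. exact: bbil_r bbil_mul S. Qed.

Lemma blin_mulr S : blinear (fun T : A => T * S).
Proof. exact: bbil_l bbil_mul S. Qed.

Lemma bop_contraction0 T (c : R) : 0 <= c < 1 -> `|T| <= c * `|T| -> T = 0.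
Proof.
move=> /andP[c0 c1] h; apply/eqP; rewrite -normr_le0.
by rewrite -(pmulr_rle0 _ (_ : 0 < 1 - c)) ?subr_gt0// mulrBl mul1r subr_le0.
Qed.

Lemma bop_half_double (x : A) : 2^-1 *: (x + x) = x.
Proof.
have -> : x + x = 2%:R *: x by rewrite scaler_nat mulr2n.
by rewrite scalerA mulVf ?pnatr_eq0// scale1r.
Qed.

Lemma bop_double_half (x : A) : 2^-1 *: x + 2^-1 *: x = x.
Proof. by rewrite -scalerDr bop_half_double. Qed.

(** A total function: the default value 0 is taken when there is no two-sided inverse. *)
Definition binv T : A := xget 0 [set U | U * T = 1 /\ T * U = 1].

Lemma binv_uniq T U : U * T = 1 -> T * U = 1 -> binv T = U.
Proof.
move=> UT TU; rewrite /binv; case: xgetP => [V _ [VT TV]|/(_ U) []//].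
have : V * (T * U) = U by rewrite mulrA VT mul1r.
by rewrite TU mulr1.
Qed.

Lemma binvP T : `|T - 1| < 1 -> binv T * T = 1 /\ T * binv T = 1.
Proof.
move=> T1.
have c01 : 0 <= `|T - 1| < 1 by rewrite normr_ge0.
have [N [_ NP _]] := neumann (blin_mull (T - 1)).1 c01 (fun S => bop_normM _ S).
have rc S : `|S * (T - 1)| <= `|T - 1| * `|S| by rewrite mulrC bop_normM.
have [N' [_ NP' _]] := neumann (blin_mulr (T - 1)).1 c01 rc.
have TN : T * N 1 = 1 by rewrite -[RHS](NP 1) mulrBl mul1r addrC subrK.
have N'T : N' 1 * T = 1 by rewrite -[RHS](NP' 1) mulrBr mulr1 addrC subrK.
have NN : N' 1 * (T * N 1) = N 1 by rewrite mulrA N'T mul1r.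
rewrite TN mulr1 in NN.
have NT : N 1 * T = 1 by rewrite -NN.
by rewrite (binv_uniq NT TN).
Qed.

Lemma near_norm_lt (E F : normedModType R) (f : E -> F) x (y : F) (e : R) :
  {for x, continuous f} -> `|f x - y| < e ->
  \forall h \near (0 : E), `|f (x + h) - y| < e.
Proof.
move=> fc fxy.
have : \forall z \near x, `|f z - y| < e.
  have : (fun z => `|f z - y|) @ x --> `|f x - y|.
    by apply: cvg_norm; apply: cvgB => //; exact: cvg_cst.
  by move/cvgr_lt; apply.
by move/nbhs0P.
Qed.

Section AnalyticInverse.
Variables (E : normedModType R).
Implicit Types (f g : E -> A).

Lemma analyticM f g x : analytic_at f x -> analytic_at g x ->
  analytic_at (fun y => f y * g y) x.
Proof. exact: analytic_bbil bbil_mul. Qed.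

Lemma analyticN f x : analytic_at f x -> analytic_at (fun y => - f y) x.
Proof.
move=> fa; rewrite (_ : (fun y => - f y) = fun y => (-1) *: f y).
  exact: (analytic_blin_comp (blin_scale (-1) (@blin_id R A)) fa).
by apply/funext => y; rewrite scaleN1r.
Qed.

(** Inverses call for the mixed term of [quadratic_fixpoint] only and square roots for the quadratic
    one only; this map stands for the other. *)
Lemma bbil_zero (F G : normedModType R) : bbilinear (fun (_ : F) (_ : F) => 0 : G).
Proof.
split=> [*|*|]; rewrite ?scaler0 ?addr0//; exists 0.
by split=> // *; rewrite normr0 !mul0r.
Qed.

(** With f y = f x + phi and inverse g0 + w, the equation is w = G - w phi g0, where G = - g0 phi
    g0. As phi g0 = - (f x) G, it reads w = G + w (f x) G, a mixed term in [w] and the analytic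
    datum [G]. *)
Lemma analytic_binv f x : analytic_at f x -> `|f x - 1| < 1 ->
  analytic_at (fun y => binv (f y)) x.
Proof.
move=> fa fx1; have [gf fg] := binvP fx1; set g0 := binv (f x) in gf fg.
pose phi y := f y - f x.
have phia : analytic_at phi x by apply: analyticD fa (analytic_cst _ _).
pose G y := - (g0 * phi y * g0).
have Ga : analytic_at G x.
  apply: analyticN; apply: analyticM (analytic_cst _ _).
  exact: analyticM (analytic_cst _ _) phia.
have G0 : G x = 0 by rewrite /G /phi subrr mulr0 mul0r oppr0.
have Bb : bbilinear (fun u v : A => u * (f x * v)).
  exact: bbil_comp bbil_mul (@blin_id R A) (blin_mull (f x)).
have [w [wa w0 wE]] := quadratic_fixpoint (@bbil_zero A A) Bb Ga G0.
apply: (@analytic_near _ _ _ (fun y => g0 + w y)); last exact: analyticD (analytic_cst _ _) wa.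
apply/nbhs0P; near=> h.
have fh : `|f (x + h) - 1| < 1.
  by near: h; apply: near_norm_lt => //; exact: analytic_continuous.
have [bf fb] := binvP fh.
have e : (g0 + w (x + h)) * f (x + h) = 1.
  have wh : w (x + h) = G (x + h) + 0 + w (x + h) * (f x * G (x + h)) by near: h.
  set y := x + h in wh *.
  have e1 : w y * f y = (w y + w y * phi y * g0) * f x.
    by rewrite mulrDl -[_ * g0 * _]mulrA gf mulr1 /phi mulrBr addrC subrK.
  have e2 : w y + w y * phi y * g0 = G y.
    rewrite {1}wh addr0 -addrA -[w y * phi y * g0]mulrA -mulrDr /G mulrN !mulrA fg mul1r.
    by rewrite addNr mulr0 addr0.
  rewrite mulrDl e1 e2 /G mulNr -[_ * g0 * _]mulrA gf mulr1 /phi mulrBr gf.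
  by rewrite opprB addrC subrK.
have : (g0 + w (x + h)) * (f (x + h) * binv (f (x + h))) = binv (f (x + h)).
  by rewrite mulrA e mul1r.
by rewrite fb mulr1.
Unshelve. all: by end_near. Qed.

End AnalyticInverse.

(** The ball of radius 1/2 around 1 selects the branch: it contains at most one root. The value is 0
    when it contains none. *)
Definition bsqrt T : A := xget 0 [set K : A | `|K - 1| <= 2^-1 /\ K * K = T].

(** For two roots L, K and D = L - K, L D + D K = L^2 - K^2 = 0, that is 2 D = - ((L - 1) D + D (K -
    1)). Hence |D| <= |D| / 2. *)
Lemma bsqrt_uniq T K : `|K - 1| <= 2^-1 -> K * K = T -> bsqrt T = K.
Proof.
move=> K1 KT; rewrite /bsqrt; case: xgetP => [L _ [L1 LT]|/(_ K) []//].
apply/eqP; rewrite -subr_eq0; apply/eqP.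
have dE : L - K = 2^-1 *: (- ((L - 1) * (L - K) + (L - K) * (K - 1))).
  rewrite -[LHS]bop_half_double; congr (_ *: _); apply/eqP.
  rewrite eq_sym -subr_eq0 -opprD oppr_eq0.
  rewrite !mulrBl !mulrBr !mul1r !mulr1 LT KT.
  apply/eqP; set z := L * K.
  have -> : z - L - (T - K) = z - T - (L - K).
    by rewrite !opprB [K - T]addrC [K - L]addrC addrACA.
  rewrite (_ : T - z - (L - K) + (z - T - (L - K)) = - ((L - K) + (L - K))) ?addNr//.
  by rewrite addrACA -(opprB T z) subrr add0r -opprD.
apply: (@bop_contraction0 _ 2^-1); first by rewrite invr_ge0 ler0n invf_lt1// ltr1n.
rewrite {1}dE normrZ ger0_norm ?invr_ge0// ler_wpM2l ?invr_ge0// normrN.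
rewrite (le_trans (ler_normD _ _))//.
have h1 : `|(L - 1) * (L - K)| <= 2^-1 * `|L - K|.
  by rewrite (le_trans (bop_normM _ _))// ler_wpM2r.
have h2 : `|(L - K) * (K - 1)| <= 2^-1 * `|L - K|.
  by rewrite (le_trans (bop_normM _ _))// mulrC ler_wpM2r.
by have := lerD h1 h2; lra.
Qed.

(** The same contraction: 2 Z = - ((K - 1) Z + Z (K - 1)) forces |Z| <= |Z| / 2. *)
Lemma sylvester0 K Z : `|K - 1| <= 2^-1 -> K * Z + Z * K = 0 -> Z = 0.
Proof.
move=> K1 KZ.
have dE : Z = 2^-1 *: (- ((K - 1) * Z + Z * (K - 1))).
  rewrite -[LHS]bop_half_double; congr (_ *: _).
  by rewrite mulrBl mulrBr mul1r mulr1 addrACA KZ add0r opprD !opprK.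
apply: (@bop_contraction0 _ 2^-1); first by rewrite invr_ge0 ler0n invf_lt1// ltr1n.
rewrite {1}dE normrZ ger0_norm ?invr_ge0// ler_wpM2l ?invr_ge0// normrN.
rewrite (le_trans (ler_normD _ _))//.
have h1 : `|(K - 1) * Z| <= 2^-1 * `|Z|.
  by rewrite (le_trans (bop_normM _ _))// ler_wpM2r.
have h2 : `|Z * (K - 1)| <= 2^-1 * `|Z|.
  by rewrite (le_trans (bop_normM _ _))// mulrC ler_wpM2r.
by have := lerD h1 h2; lra.
Qed.

(** The root is 1 + u with u = (T - 1) / 2 - u^2 / 2, and continuity of the solution keeps |u| below
    1/2. *)
Lemma bsqrt_exists : exists2 eta : R, 0 < eta & forall T, `|T - 1| < eta ->
  `|bsqrt T - 1| < 2^-1 /\ bsqrt T * bsqrt T = T.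
Proof.
have fa : analytic_at (fun T : A => 2^-1 *: (T - 1)) 1.
  apply: (analytic_blin_comp (blin_scale 2^-1 (@blin_id R A))).
  exact: analyticD (analytic_id _) (analytic_cst _ _).
have Bb : bbilinear (fun S T : A => - 2^-1 *: (S * T)).
  exact: blin_bbil_comp bbil_mul (blin_scale _ (@blin_id R A)).
have [|w [wa w0 wE]] := quadratic_fixpoint Bb (@bbil_zero A A) fa.
  by rewrite subrr scaler0.
have wc := analytic_continuous wa.
have w2 : \forall h \near (0 : A), `|w (1 + h) - 0| < 2^-1.
  by apply: near_norm_lt; rewrite // w0 subr0 normr0 invr_gt0.
have [e /= e0 he] : exists2 e : R, 0 < e & forall h : A, `|h| < e ->
    w (1 + h) = 2^-1 *: (1 + h - 1) + - 2^-1 *: (w (1 + h) * w (1 + h)) + 0 /\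
    `|w (1 + h) - 0| < 2^-1.
  have : \forall h \near (0 : A), w (1 + h) = 2^-1 *: (1 + h - 1) +
      - 2^-1 *: (w (1 + h) * w (1 + h)) + 0 /\ `|w (1 + h) - 0| < 2^-1.
    exact: filterI wE w2.
  by move/nbhs_norm0P => [e e0 he]; exists e.
exists e => // T /he; rewrite subrKC => -[].
set u := w T; rewrite addr0 subr0 => uE u2.
have e1 : (1 + u) * (1 + u) = T.
  have : u + u = T - 1 - u * u.
    by rewrite -[T - 1 - _](bop_double_half) [in LHS]uE [in RHS]scalerBr scaleNr.
  rewrite mulrDl mul1r mulrDr mulr1 addrA -[1 + u + u]addrA => ->.
  by rewrite addrA subrK addrC subrK.
have u3 : `|1 + u - 1| < 2^-1 by rewrite [1 + u]addrC addrK.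
by rewrite (bsqrt_uniq (ltW u3) e1).
Qed.

(** The commutator Z = K S - S K satisfies K Z + Z K = K^2 S - S K^2 = 0, so [sylvester0]
    applies. *)
Lemma bsqrt_commute T S K : `|K - 1| <= 2^-1 -> K * K = T -> T * S = S * T ->
  K * S = S * K.
Proof.
move=> K1 KT TS; apply/eqP; rewrite -subr_eq0; apply/eqP.
apply: (sylvester0 K1); rewrite mulrBr mulrBl.
by rewrite -!mulrA KT !mulrA KT -TS addrA subrK subrr.
Qed.

(** The increment u of the root K solves K u + u K = f y - f x - u^2. The left side is 2 (u + L u)
    with L of norm at most 1/2; the Neumann inverse [N] of 1 + L brings the equation to the form of
    [quadratic_fixpoint]. *)
Lemma analytic_bsqrt (E : normedModType R) (f : E -> A) x : analytic_at f x ->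
  `|bsqrt (f x) - 1| < 2^-1 -> bsqrt (f x) * bsqrt (f x) = f x ->
  analytic_at (fun y => bsqrt (f y)) x.
Proof.
move=> fa; set K := bsqrt (f x) => K1 KK.
pose L (Z : A) := 2^-1 *: ((K - 1) * Z + Z * (K - 1)).
have Lb : blinear L.
  exact: blin_comp (blin_scale _ (@blin_id R A)) (blin_add (blin_mull _) (blin_mulr _)).
have Lc Z : `|L Z| <= 2^-1 * `|Z|.
  rewrite normrZ ger0_norm ?invr_ge0// ler_wpM2l ?invr_ge0//.
  rewrite (le_trans (ler_normD _ _))//.
  have h1 : `|(K - 1) * Z| <= 2^-1 * `|Z|.
    by rewrite (le_trans (bop_normM _ _))// ler_wpM2r// ltW.
  have h2 : `|Z * (K - 1)| <= 2^-1 * `|Z|.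
    by rewrite (le_trans (bop_normM _ _))// mulrC ler_wpM2r// ltW.
  by have := lerD h1 h2; lra.
have c01 : 0 <= (2^-1 : R) < 1 by rewrite invr_ge0 ler0n invf_lt1// ltr1n.
have [N [Nb NP _]] := neumann Lb.1 c01 Lc.
pose G y := N (2^-1 *: (f y - f x)).
have Ga : analytic_at G x.
  apply: analytic_blin_comp Nb _.
  apply: (analytic_blin_comp (blin_scale 2^-1 (@blin_id R A))).
  exact: analyticD fa (analytic_cst _ _).
have Bb : bbilinear (fun S T : A => N (- 2^-1 *: (S * T))).
  exact: blin_bbil_comp (blin_bbil_comp bbil_mul (blin_scale _ (@blin_id R A))) Nb.
have [|w [wa w0 wE]] := quadratic_fixpoint Bb (@bbil_zero A A) Ga.
  by rewrite /G subrr scaler0 (blin0 Nb).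
have wa' : analytic_at (fun y => K + w y) x by exact: analyticD (analytic_cst _ _) wa.
have wc := analytic_continuous wa'.
apply: (analytic_near _ wa'); apply/nbhs0P; near=> h.
have Kw : `|K + w (x + h) - 1| < 2^-1.
  by near: h; apply: (near_norm_lt wc); rewrite w0 addr0.
apply/esym/bsqrt_uniq; first exact: ltW.
have wh : w (x + h) = G (x + h) + N (- 2^-1 *: (w (x + h) * w (x + h))) + 0 by near: h.
set y := x + h in wh Kw *; set u := w y in wh Kw *.
rewrite addr0 /G -(blinD Nb) scaleNr -scalerBr in wh.
have := NP (2^-1 *: (f y - f x - u * u)); rewrite -wh /L => e.
have {}e : u + u + ((K - 1) * u + u * (K - 1)) = f y - f x - u * u.
  by rewrite -[RHS]bop_double_half -e [RHS]addrACA bop_double_half.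
have {}e : K * u + u * K = f y - f x - u * u.
  by rewrite -e mulrBl mulrBr mul1r mulr1 [in RHS](addrACA (K * u)) -opprD [RHS]addrC subrK.
rewrite mulrDl !mulrDr KK addrA -[f x + _ + _]addrA e [f x + _]addrC.
by rewrite [_ - u * u + f x]addrAC subrK subrK.
Unshelve. all: by end_near. Qed.

End OperatorAlgebra.

(** * Adjoints *)

Section Adjoints.
Variables (R : realType) (H : hilbertType R).
Notation A := (bop H).
Implicit Types (S T U X : A).

Lemma conj_real_complex (a : R) : Num.conj (a%:C : R[i]) = a%:C.
Proof. exact: conjc_real. Qed.

Lemma adjK T : adj (adj T) = T.
Proof.
by apply/esym/adj_uniq => x y; rewrite dot_conj -adjP -dot_conj.
Qed.

Lemma adj1 : adj (1 : A) = 1.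
Proof. by apply/esym/adj_uniq. Qed.

Lemma adjM S T : adj (S * T) = adj T * adj S.
Proof.
by apply/esym/adj_uniq => x y; exact: etrans (adjP S _ _) (adjP T _ _).
Qed.

Lemma adj_linear (a : R) S T : adj (a *: S + T) = a *: adj S + adj T.
Proof.
apply/esym/adj_uniq => x y.
rewrite -[(a *: S + T) x]/(a%:C *: S x + T x).
rewrite -[(a *: adj S + adj T) y]/(a%:C *: adj S y + adj T y).
by rewrite dot_linearl dot_linearr !adjP conj_real_complex.
Qed.

Lemma dot_sqr_expand (u v : H) (s : R) (c : R[i]) : dot u v = c -> c^* = c ->
  `|u - s%:C *: v| ^+ 2 = `|u| ^+ 2 - 2 * s%:C * c + s%:C ^+ 2 * `|v| ^+ 2.
Proof.
move=> uv cc; have vu : dot v u = c by rewrite dot_conj uv.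
have -> : u - s%:C *: v = (- s%:C) *: v + u by rewrite scaleNr addrC.
rewrite -!dotxx dot_linearl !dot_linearr uv vu -rmorphN conj_real_complex rmorphN.
ring.
Qed.

(* Expand [|T (T* y) - |T|^2 y|^2 >= 0]. *)
Lemma norm_adj_le T : `|adj T| <= `|T|.
Proof.
have [T0|T0] := eqVneq `|T| 0.
  have -> : T = 0 by apply: normr0_eq0.
  have -> : adj (0 : A) = 0.
    have := adj_linear 1 0 0; rewrite !scale1r addr0 => e.
    by apply: (addIr (adj 0)); rewrite add0r -e.
  exact: lexx.
have Tp : 0 < `|T| by rewrite lt_def T0 normr_ge0.
apply: opnorm_le; split=> [|y]; first exact: normr_ge0.
set z := adj T y; set s := `|T| ^+ 2; have s0 : 0 < s by rewrite exprn_gt0.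
have uv : dot (T z) y = `|z| ^+ 2 by rewrite adjP dotxx.
have cc : (`|z| ^+ 2)^* = `|z| ^+ 2 by rewrite rnormE -rmorphXn conj_real_complex.
have := dot_sqr_expand s uv cc.
rewrite !rnormE -!rmorphXn -!rmorphM.
rewrite (_ : 2 = (2 : R)%:C) -?rmorphM -?rmorphB -?rmorphD; last by rewrite rmorph_nat.
move=> /complexI e.
have h1 : 0 <= rnorm (T z - s%:C *: y) ^+ 2 by exact: sqr_ge0.
have h2 : rnorm (T z) ^+ 2 <= s * rnorm z ^+ 2.
  by rewrite /s -exprMn lerXn2r ?nnegrE ?mulr_ge0 ?rnorm_ge0 ?bop_norm_le.
have h3 : s * rnorm z ^+ 2 <= s * (s * rnorm y ^+ 2).
  by rewrite e in h1; rewrite mulrA -expr2; lra.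
move: h3; rewrite ler_pM2l// /s -exprMn ler_sqr// nnegrE ?mulr_ge0 ?rnorm_ge0//.
Qed.

Lemma blin_adj : blinear (@adj R H).
Proof.
split; first exact: adj_linear.
by exists 1; split=> // T; rewrite mul1r norm_adj_le.
Qed.

Variables (J : A) (hJ : is_symmetry J).

Lemma symJJ : J * J = 1. Proof. by case: hJ. Qed.

Lemma norm_sym : `|J| <= 1.
Proof.
apply: opnorm_le; split=> // x; rewrite mul1r.
have e : dot (J x) (J x) = dot x x.
  by rewrite adjP hJ.1 -[J (J x)]/((J * J) x) symJJ.
move: e; rewrite !dotxx !rnormE -!rmorphXn => /complexI e.
by rewrite -ler_sqr ?nnegrE ?rnorm_ge0// e.
Qed.

Lemma blin_jadj : blinear (jadj J).
Proof. exact: blin_comp (blin_mulr J) (blin_comp (blin_mull J) blin_adj). Qed.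

Lemma jadj1 : jadj J 1 = 1.
Proof. by rewrite /jadj adj1 mulr1 symJJ. Qed.

Lemma jadjM S T : jadj J (S * T) = jadj J T * jadj J S.
Proof. by rewrite /jadj adjM !mulrA -[J * adj T * J * J]mulrA symJJ mulr1. Qed.

Lemma jadjK T : jadj J (jadj J T) = T.
Proof.
rewrite /jadj !adjM hJ.1 adjK !mulrA symJJ mul1r -mulrA symJJ mulr1 //.
Qed.

Lemma norm_jadj_le T : `|jadj J T| <= `|T|.
Proof.
rewrite (le_trans (bop_normM _ _))// (le_trans (ler_piMr _ norm_sym))//.
rewrite (le_trans (bop_normM _ _))// (le_trans (ler_piMl _ norm_sym))//.
exact: norm_adj_le.
Qed.

End Adjoints.

(** * Model spaces and charts *)

(* A complemented closed subspace is encoded by a bounded projection onto it,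
   so that it is a Banach space in its own right. *)
Record bproj (R : realType) (E : completeNormedModType R) := Bproj {
  bprojf :> E -> E ;
  bproj_lin : blinear bprojf ;
  bproj_idem : forall x, bprojf (bprojf x) = bprojf x }.

Record rng (R : realType) (E : completeNormedModType R) (p : bproj E) := Rng {
  rngv : E ;
  rngP : p rngv == rngv }.

Section RangeSpace.
Variables (R : realType) (E : completeNormedModType R) (p : bproj E).
Let pl := bproj_lin p.

HB.instance Definition _ := [isSub for @rngv R E p].
HB.instance Definition _ := [Choice of rng p by <:].

Lemma rng_inj (x y : rng p) : rngv x = rngv y -> x = y.
Proof. exact: val_inj. Qed.

Lemma rngE (x : rng p) : p (rngv x) = rngv x.
Proof. exact/eqP/rngP. Qed.

Fact rng_zero_subproof : p 0 == 0. Proof. by rewrite (blin0 pl). Qed.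
Fact rng_add_subproof (x y : rng p) : p (rngv x + rngv y) == rngv x + rngv y.
Proof. by rewrite (blinD pl) !rngE. Qed.
Fact rng_opp_subproof (x : rng p) : p (- rngv x) == - rngv x.
Proof. by rewrite (blinN pl) !rngE. Qed.
Fact rng_scale_subproof (a : R) (x : rng p) : p (a *: rngv x) == a *: rngv x.
Proof. by rewrite (blinZ pl) !rngE. Qed.

Definition rng_zero := Rng rng_zero_subproof.
Definition rng_add x y := Rng (rng_add_subproof x y).
Definition rng_opp x := Rng (rng_opp_subproof x).
Definition rng_scale a x := Rng (rng_scale_subproof a x).

Fact rng_addA : associative rng_add.
Proof. by move=> *; apply: rng_inj; apply: addrA. Qed.
Fact rng_addC : commutative rng_add.
Proof. by move=> *; apply: rng_inj; apply: addrC. Qed.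
Fact rng_add0 : left_id rng_zero rng_add.
Proof. by move=> *; apply: rng_inj; apply: add0r. Qed.
Fact rng_addN : left_inverse rng_zero rng_opp rng_add.
Proof. by move=> *; apply: rng_inj; apply: addNr. Qed.
HB.instance Definition _ :=
  GRing.isZmodule.Build (rng p) rng_addA rng_addC rng_add0 rng_addN.

Fact rng_scaleA a b x : rng_scale a (rng_scale b x) = rng_scale (a * b) x.
Proof. by apply: rng_inj; apply: scalerA. Qed.
Fact rng_scale1 : left_id 1 rng_scale.
Proof. by move=> x; apply: rng_inj; apply: scale1r. Qed.
Fact rng_scaleDr : right_distributive rng_scale +%R.
Proof. by move=> *; apply: rng_inj; apply: scalerDr. Qed.
Fact rng_scaleDl x : {morph rng_scale^~ x : a b / a + b}.
Proof. by move=> *; apply: rng_inj; apply: scalerDl. Qed.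
HB.instance Definition _ := GRing.Zmodule_isLmodule.Build R (rng p)
  rng_scaleA rng_scale1 rng_scaleDr rng_scaleDl.

Definition rng_norm (x : rng p) : R := `|rngv x|.
Fact rng_normD x y : rng_norm (x + y) <= rng_norm x + rng_norm y.
Proof. exact: ler_normD. Qed.
Fact rng_normZ (a : R) x : rng_norm (a *: x) = `|a| * rng_norm x.
Proof. exact: normrZ. Qed.
Fact rng_norm_eq0 x : rng_norm x = 0 -> x = 0.
Proof. by move=> /normr0_eq0 x0; apply: rng_inj. Qed.
HB.instance Definition _ := Lmodule_isNormed.Build R (rng p)
  rng_normD rng_normZ rng_norm_eq0.

Lemma blin_rngv : blinear (@rngv R E p).
Proof. by split=> //; exists 1; split=> // x; rewrite mul1r. Qed.

Definition rproj (x : E) : rng p := Rng (introT eqP (bproj_idem p x)).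

Lemma rngvK : cancel (@rngv R E p) rproj.
Proof. by move=> x; apply: rng_inj; exact: rngE. Qed.

Lemma blin_rproj : blinear rproj.
Proof.
split=> [a x y|]; first by apply: rng_inj; exact: pl.1.
by have [_ [M [M0 pM]]] := pl; exists M.
Qed.

(** The limit y is found in E; continuity of [rproj], which is the identity on the range, makes
    [rproj y] the limit in the range. *)
Lemma rng_complete (F : set_system (rng p)) : ProperFilter F -> cauchy F -> cvg F.
Proof.
move=> FF /cauchy_ballP Fc.
have cvE : cvg ((@rngv R E p) @ F).
  apply: cauchy_cvg; apply/cauchy_ballP => e e0.
  have [[B C] /= [FB FC] BC] := Fc e e0.
  exists (@rngv R E p @` B, @rngv R E p @` C) => /=.
    split; [apply: filterS FB|apply: filterS FC] => x Bx /=; by exists x.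
  move=> [_ _] /= [[x Bx <-] [y Cy <-]].
  have := BC (x, y) (conj Bx Cy); rewrite /= -!ball_normE /= .
  exact.
move/cvg_ex : cvE => [y Fy]; apply/cvg_ex; exists (rproj y).
have c : {for y, continuous rproj} by apply: blin_continuous; exact: blin_rproj.
have := @continuous_cvg _ _ _ F _ (@rngv R E p) rproj y c Fy.
have -> : rproj \o @rngv R E p = id by apply: funext => x; exact: rngvK.
by move=> h; exact: h.
Qed.
HB.instance Definition _ := Uniform_isComplete.Build (rng p) rng_complete.

End RangeSpace.

Section Charts.
Variable R : realType.

(** For W inside the domain, the image of W is the part of [B] that the inverse sends into W
    ([imE]). Openness in both directions thus reduces to openness of preimages. *)
Lemma is_chart_criterion T (M : manifold R T) (c : chart T (model M))
    (B : set (model M)) :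
  is_topology (carrier M) (opens M) ->
  opens M (chart_dom c) -> open B ->
  (forall x, chart_dom c x -> B (chart_fun c x) /\ chart_inv c (chart_fun c x) = x) ->
  (forall t, B t -> chart_dom c (chart_inv c t) -> chart_fun c (chart_inv c t) = t) ->
  (forall W, opens M W -> open (B `&` (chart_inv c) @^-1` W)) ->
  (forall O, open O -> opens M (chart_dom c `&` (chart_fun c) @^-1` O)) ->
  is_chart c.
Proof.
move=> [_ _ opI _] domO BO Bc cB invO funO.
have imE W : W `<=` chart_dom c ->
    chart_fun c @` W = B `&` (chart_inv c) @^-1` W.
  move=> WD; apply/seteqP; split=> [_ [x Wx <-]|t [Bt Wt]] /=.
    by have [h1 h2] := Bc x (WD _ Wx); split=> //; rewrite h2.
  by exists (chart_inv c t) => //; apply: cB => //; exact: WD.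
split=> //.
- by move=> x /Bc[].
- by rewrite imE//; exact: invO.
move=> W WD; split=> [WO|fWO]; first by rewrite imE//; exact: invO.
rewrite (_ : W = chart_dom c `&` (chart_fun c) @^-1` (chart_fun c @` W)); first exact: funO.
apply/seteqP; split=> [x Wx|x [Dx [y Wy yx]]]; first by split; [exact: WD|exists x].
have [_ <-] := Bc x Dx; rewrite -yx; have [_ ->] := Bc y (WD _ Wy).
by [].
Qed.

Lemma subspace_topology (T : topologicalType) (S : set T) :
  is_topology S (subspace_opens S).
Proof.
split.
- by move=> W [U _ ->] x [].
- by exists setT; [exact: openT|rewrite setIT].
- move=> V W [U1 U1o ->] [U2 U2o ->]; exists (U1 `&` U2); first exact: openI.
  by rewrite setIACA setIid.
- move=> F FS.
  exists (\bigcup_(O in [set O | open O /\ F (S `&` O)]) O); first by apply: bigcup_open => U [].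
  apply/seteqP; split=> [x [W FW Wx]|x [Sx [U [Uo FU] Ux]]].
    have [U Uo WE] := FS _ FW; rewrite WE in Wx FW.
    by case: Wx => Sx Ux; split=> //; exists U.
  by exists (S `&` U).
Qed.

Lemma subspace_hausdorff (E : normedModType R) (S : set E) :
  is_hausdorff S (subspace_opens S).
Proof.
move=> x y Sx Sy /eqP xy.
have := @norm_hausdorff _ E; rewrite open_hausdorff => /(_ x y xy).
move=> [[U V] /= [xU yV] [Uo Vo /eqP UV]].
rewrite inE in xU; rewrite inE in yV.
exists (S `&` U), (S `&` V); split=> //; try by [exists U|exists V].
by rewrite setIACA setIid UV setI0.
Qed.

Lemma quotient_topology T1 T2 (M : manifold R T1) (f : T1 -> T2) :
  is_topology (carrier M) (opens M) ->
  is_topology (f @` carrier M) (quotient_opens M f).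
Proof.
move=> [opS opT opI opU]; split.
- by move=> W [].
- split=> //; rewrite (_ : _ `&` _ = carrier M)//.
  by apply/seteqP; split=> [x []//|x Mx]; split=> //; exists x.
- move=> V W [VS VO] [WS WO]; split; first by move=> x [/VS].
  rewrite preimage_setI -[carrier M]setIid setIACA; exact: opI.
- move=> F FO; split; first by move=> x [W /FO[WS _]] /WS.
  rewrite preimage_bigcup setI_bigcupr.
  rewrite (_ : \bigcup_(i in F) _ =
    \bigcup_(W in (fun W => carrier M `&` f @^-1` W) @` F) W).
    by apply: opU => _ [W /FO[_ WO] <-].
  by rewrite bigcup_image.
Qed.

End Charts.

(** * Normal projections and unitaries for an involution *)

(* The J-adjoint enters only through the following properties. *)
Record involution (R : realType) (H : hilbertType R) (sh : bop H -> bop H) : Prop :=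
  Involution {
    star_lin : blinear sh;
    starM : forall S T, sh (S * T) = sh T * sh S;
    starK : forall T, sh (sh T) = T;
    star1 : sh 1 = 1;
    star_norm : forall T, `|sh T| <= `|T| }.

Lemma jadj_involution (R : realType) (H : hilbertType R) (J : bop H) :
  is_symmetry J -> involution (jadj J).
Proof.
move=> hJ; split; [exact: blin_jadj|exact: jadjM|exact: jadjK|exact: jadj1|].
exact: norm_jadj_le.
Qed.

Section StarAlgebra.
Variables (R : realType) (H : hilbertType R).
Notation A := (bop H).
Variables (sh : A -> A) (sh_inv : involution sh).
Implicit Types (Q T U V X Y Z : A) (i j : bool * bool).

Let shl : blinear sh := star_lin sh_inv.
Let shM S T : sh (S * T) = sh T * sh S := starM sh_inv S T.
Let shK T : sh (sh T) = T := starK sh_inv T.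
Let sh1 : sh 1 = 1 := star1 sh_inv.

Definition normal_proj : set A := [set Q | Q * Q = Q /\ Q * sh Q = sh Q * Q].
Definition unitary : set A := [set U | U * sh U = 1 /\ sh U * U = 1].
Definition conj_act Q U : A := U * Q * sh U.
Definition commutant Q : set A := [set U | unitary U /\ U * Q = Q * U].
Definition commutant_lie Q : set A := [set X | sh X = - X /\ X * Q = Q * X].

Definition half b X : A := if b then X else 1 - X.

(* The joint spectral projections of the commuting idempotents [X] and [X^#]. *)
Definition blk X i : A := half i.1 X * half i.2 (sh X).

Lemma sh_half b X : sh (half b X) = half b (sh X).
Proof. by case: b => //=; rewrite (blinB shl) sh1. Qed.

Lemma sh_blk X i : sh (blk X i) = blk X (i.2, i.1).
Proof. by rewrite shM !sh_half shK. Qed.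

Lemma sum_blk X : \sum_i blk X i = 1.
Proof.
rewrite -(pair_bigA _ (fun a b => half a X * half b (sh X))) /=.
by rewrite !big_bool /= -!mulrDr !subrKC !mulr1 subrKC.
Qed.

Lemma sum_blk_true X : \sum_b blk X (true, b) = X.
Proof. by rewrite big_bool /blk /= -mulrDr subrKC mulr1. Qed.

Lemma half_idem b c X : X * X = X ->
  half b X * half c X = if b == c then half b X else 0.
Proof.
move=> XX; case: b; case: c => //=.
all: by rewrite ?mulrBl ?mulrBr ?mul1r ?mulr1 ?XX ?subrr ?subr0.
Qed.

Lemma comm_half b X Y : X * Y = Y * X -> X * half b Y = half b Y * X.
Proof. by case: b => //= e; rewrite mulrBr mulrBl mulr1 mul1r e. Qed.

Lemma half_comm b c X Y : X * Y = Y * X -> half b X * half c Y = half c Y * half b X.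
Proof. by move=> XY; apply/comm_half/esym/comm_half. Qed.

Section NormalProjection.
Variables (X : A) (hX : normal_proj X).

Lemma blk_orth i j : blk X i * blk X j = if i == j then blk X i else 0.
Proof.
have [XX Xn] := hX; case: i j => [a b] [c d]; rewrite /blk /=.
have shXX : sh X * sh X = sh X by rewrite -shM XX.
rewrite mulrA -[_ * _ * half c X]mulrA (half_comm b c (esym Xn)) !mulrA.
rewrite (half_idem a c XX) -mulrA (half_idem b d shXX) xpair_eqE.
by case: eqP => _ /=; rewrite ?mul0r//; case: eqP; rewrite ?mulr0.
Qed.

Lemma sum_blk_l (F : bool * bool -> A) j :
  (\sum_i F i * blk X i) * blk X j = F j * blk X j.
Proof.
rewrite mulr_suml (bigD1 j)//= -mulrA blk_orth eqxx big1 ?addr0// => i ij.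
by rewrite -mulrA blk_orth (negbTE ij) mulr0.
Qed.

Lemma sum_blk_r (F : bool * bool -> A) j :
  blk X j * (\sum_i blk X i * F i) = blk X j * F j.
Proof.
rewrite mulr_sumr (bigD1 j)//= mulrA blk_orth eqxx big1 ?addr0// => i ij.
by rewrite mulrA blk_orth eq_sym (negbTE ij) mul0r.
Qed.

End NormalProjection.

Lemma unitary1 : unitary 1.
Proof. by rewrite /unitary /= sh1 mulr1. Qed.

Lemma unitaryM U V : unitary U -> unitary V -> unitary (U * V).
Proof.
move=> [U1 U2] [V1 V2]; rewrite /unitary /= shM; split.
  by rewrite mulrA -[U * V * _]mulrA V1 mulr1.
by rewrite mulrA -[sh V * _ * _]mulrA U2 mulr1.
Qed.

Lemma unitaryV U : unitary U -> unitary (sh U).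
Proof. by move=> [U1 U2]; rewrite /unitary /= shK. Qed.

Lemma act_sh Q V : sh (conj_act Q V) = conj_act (sh Q) V.
Proof. by rewrite /conj_act !shM shK mulrA. Qed.

Lemma act_mul X Y V : unitary V -> conj_act X V * conj_act Y V = conj_act (X * Y) V.
Proof.
move=> [_ VV]; have e : V * X * sh V * V = V * X by rewrite -mulrA VV mulr1.
by rewrite /conj_act !mulrA e.
Qed.

Lemma act_normal Q V : unitary V -> normal_proj Q ->
  normal_proj (conj_act Q V).
Proof.
move=> hV [QQ Qn]; split; first by rewrite act_mul// QQ.
by rewrite act_sh !act_mul// Qn.
Qed.

Lemma act_half b Q V : unitary V -> half b (conj_act Q V) = conj_act (half b Q) V.
Proof.
by move=> [VV _]; case: b; rewrite //= /conj_act mulrBr mulrBl mulr1 VV.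
Qed.

Lemma act_blk Q V i : unitary V -> blk (conj_act Q V) i = conj_act (blk Q i) V.
Proof. by move=> hV; rewrite /blk act_sh !act_half// act_mul. Qed.

(** Apply [sh] to the relation X Q = Q X. A skew element of the commutant of Q therefore commutes
    with all four blocks. *)
Lemma skew_comm_sh X Q : sh X = - X -> X * Q = Q * X -> X * sh Q = sh Q * X.
Proof.
move=> Xs XQ; have : sh (X * Q) = sh (Q * X) by rewrite XQ.
by rewrite !shM Xs mulrN mulNr => /oppr_inj.
Qed.

Lemma comm_blk X Q i : X * Q = Q * X -> X * sh Q = sh Q * X ->
  X * blk Q i = blk Q i * X.
Proof.
by move=> e1 e2; rewrite /blk mulrA (comm_half i.1 e1) -!mulrA (comm_half i.2 e2).
Qed.

Lemma comm_blk_inv X Q : (forall i, X * blk Q i = blk Q i * X) -> X * Q = Q * X.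
Proof.
move=> h; rewrite -[Q in X * Q]sum_blk_true -[Q in Q * X]sum_blk_true mulr_sumr mulr_suml.
by apply: eq_bigr => b _.
Qed.

Definition skew_part X : A := 2^-1 *: (X - sh X).

Lemma blin_skew : blinear skew_part.
Proof.
apply: (@blin_comp _ _ _ _ _ (fun X => X - sh X) (blin_scale _ (@blin_id R A))).
exact: blin_sub (@blin_id R A) shl.
Qed.

Lemma sh_skew X : sh (skew_part X) = - skew_part X.
Proof. by rewrite /skew_part (blinZ shl) (blinB shl) shK -scalerN opprB. Qed.

Lemma skew_id X : sh X = - X -> skew_part X = X.
Proof. by move=> Xs; rewrite /skew_part Xs opprK bop_half_double. Qed.

Lemma norm_skew_le X : `|skew_part X| <= `|X|.
Proof.
rewrite normrZ ger0_norm ?invr_ge0//.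
have h1 := ler_normB X (sh X); have h2 := star_norm sh_inv X.
by rewrite mulrC ler_pdivrMr//; lra.
Qed.

Section Pinching.
Variables (Q : A) (hQ : normal_proj Q).

Definition pinch X : A := \sum_i blk Q i * X * blk Q i.

Lemma blin_pinch : blinear pinch.
Proof.
have h1 i : blinear (fun X : A => blk Q i * X * blk Q i).
  exact: blin_comp (blin_mulr _) (blin_mull _).
have -> : pinch = fun X => blk Q (true, true) * X * blk Q (true, true) +
    (blk Q (true, false) * X * blk Q (true, false) +
    (blk Q (false, true) * X * blk Q (false, true) +
     blk Q (false, false) * X * blk Q (false, false))).
  apply/funext => X; rewrite /pinch.
  rewrite -(pair_bigA _ (fun a b => blk Q (a, b) * X * blk Q (a, b))) /=.
  by rewrite !big_bool /= !addrA.
by do !apply: blin_add.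
Qed.

Lemma pinch_comm_blk X i : pinch X * blk Q i = blk Q i * pinch X.
Proof.
rewrite [LHS]sum_blk_l // /pinch.
under [in RHS]eq_bigr do rewrite -mulrA.
by rewrite [RHS]sum_blk_r // mulrA.
Qed.

Lemma pinch_comm X : pinch X * Q = Q * pinch X.
Proof. exact/comm_blk_inv/pinch_comm_blk. Qed.

Lemma pinch_id X : X * Q = Q * X -> X * sh Q = sh Q * X -> pinch X = X.
Proof.
move=> e1 e2; rewrite /pinch.
under eq_bigr => i _ do rewrite -mulrA (comm_blk i e1 e2) mulrA (blk_orth hQ) eqxx.
by rewrite -mulr_suml sum_blk mul1r.
Qed.

Lemma pinch_comm_id X : (forall i, X * blk Q i = blk Q i * X) -> pinch X = X.
Proof.
move=> e; rewrite /pinch.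
under eq_bigr => i _ do rewrite -mulrA e mulrA (blk_orth hQ) eqxx.
by rewrite -mulr_suml sum_blk mul1r.
Qed.

Lemma pinch_idem X : pinch (pinch X) = pinch X.
Proof. exact/pinch_comm_id/pinch_comm_blk. Qed.

Lemma sh_pinch X : sh (pinch X) = pinch (sh X).
Proof.
rewrite /pinch (blin_sum shl).
rewrite (reindex_inj (h := fun i : bool * bool => (i.2, i.1))) /=; last first.
  by move=> [a b] [c d] [-> ->].
apply: eq_bigr => -[a b] _ /=.
by rewrite (shM (blk Q (b, a) * X)) (shM (blk Q (b, a)) X) sh_blk /= mulrA.
Qed.

Lemma pinch1 : pinch 1 = 1.
Proof. by apply: pinch_id; rewrite mulr1 mul1r. Qed.

Lemma pinch_skew X : pinch (skew_part X) = skew_part (pinch X).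
Proof.
by rewrite /skew_part (blinZ blin_pinch) (blinB blin_pinch) sh_pinch.
Qed.

Lemma skew_skew X : skew_part (skew_part X) = skew_part X.
Proof. exact/skew_id/sh_skew. Qed.

Definition isoproj : bproj A.
Proof.
apply: (@Bproj _ _ (pinch \o skew_part)); first exact: blin_comp blin_pinch blin_skew.
by move=> X /=; rewrite -pinch_skew pinch_idem skew_skew.
Defined.

Lemma isoprojE X : isoproj X = X <-> commutant_lie Q X.
Proof.
split=> [XE|[Xs XQ]].
  split; last by rewrite -XE; exact: pinch_comm.
  by rewrite -XE /= pinch_skew sh_skew.
by rewrite /= skew_id//; apply: pinch_id => //; exact: skew_comm_sh.
Qed.

(** The skew part minus [isoproj]. Its range, the off-diagonal skew elements, serves both as
    complement of the isotropy Lie algebra and as model space of the orbit. *)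
Definition coisoproj : bproj A.
Proof.
apply: (@Bproj _ _ (fun X => skew_part X - pinch (skew_part X))).
  exact: blin_sub blin_skew (bproj_lin isoproj).
move=> X; rewrite (blinB blin_skew) skew_skew -pinch_skew skew_skew.
by rewrite (blinB blin_pinch) pinch_idem subrr subr0.
Defined.

Lemma coisoprojE X : coisoproj X = X <-> sh X = - X /\ pinch X = 0.
Proof.
split=> [XE|[Xs pX]]; last by rewrite /= skew_id// pX subr0.
split.
  by rewrite -XE /= (blinB shl) sh_pinch !sh_skew (blinN blin_pinch) opprB opprK addrC.
by rewrite -XE /= (blinB blin_pinch) pinch_idem subrr.
Qed.

End Pinching.

End StarAlgebra.

(** * Square-root parametrization and local sections of the action *)

Section UnitarySections.
Variables (R : realType) (H : hilbertType R).
Notation A := (bop H).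
Variables (sh : A -> A) (sh_inv : involution sh).
Implicit Types (Q T U V X Y Z K : A) (i j : bool * bool).

Let shl : blinear sh := star_lin sh_inv.
Let shM S T : sh (S * T) = sh T * sh S := starM sh_inv S T.
Let shK T : sh (sh T) = T := starK sh_inv T.
Let sh1 : sh 1 = 1 := star1 sh_inv.

(** [sh] fixes 1 and does not increase norms, so it sends the root to a root of the same operator in
    the same ball. *)
Lemma sh_bsqrt X : `|bsqrt X - 1| <= 2^-1 -> bsqrt X * bsqrt X = X -> sh X = X ->
  sh (bsqrt X) = bsqrt X.
Proof.
move=> K1 KK Xs; apply/esym/bsqrt_uniq; last by rewrite -shM KK.
by rewrite -sh1 -(blinB shl) (le_trans (star_norm sh_inv _)).
Qed.

(* A parametrization of a neighborhood of 1 in the unitary group by skew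
   elements: [uni T] is the unitary element with skew part [T]. *)
Definition uni T : A := T + bsqrt (1 + T * T).

(** The bound 1/2 is the one that [uni_skew] puts on U - 1, so that one radius serves both
    directions between T and U. *)
Definition good_radius (d : R) : Prop :=
  [/\ 0 < d, d <= 2^-1 & forall T : A, `|T| < d ->
    `|bsqrt (1 + T * T) - 1| < 2^-1 /\
    bsqrt (1 + T * T) * bsqrt (1 + T * T) = 1 + T * T].

Lemma good_radius_exists : exists d, good_radius d.
Proof.
have [eta eta0 etaP] := bsqrt_exists H.
exists (Num.min 2^-1 eta); split.
- by rewrite lt_min eta0 invr_gt0 ltr0n.
- by rewrite ge_min lexx.
move=> T; rewrite lt_min => /andP[T2 Te]; apply: etaP.
rewrite addrC addKr (le_lt_trans (bop_normM _ _))//.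
apply: le_lt_trans Te; rewrite ler_piMl// (le_trans (ltW T2))// invf_le1// ler1n.
by [].
Qed.

Lemma analytic_uni (E : normedModType R) (f : E -> A) x d : good_radius d ->
  analytic_at f x -> `|f x| < d -> analytic_at (fun y => uni (f y)) x.
Proof.
move=> [_ _ dP] fa fx; have [h1 h2] := dP _ fx.
apply: (analyticD fa).
apply: (analytic_bsqrt (f := fun y => 1 + f y * f y)) => //.
exact: analyticD (analytic_cst _ _) (analyticM fa fa).
Qed.

Section Uni.
Variables (d : R) (hd : good_radius d) (T : A) (Td : `|T| < d).
Let k := bsqrt (1 + T * T).
Let kk : k * k = 1 + T * T. Proof. by have [_ _ /(_ T Td)[]] := hd. Qed.
Let k1 : `|k - 1| <= 2^-1. Proof. by have [_ _ /(_ T Td)[/ltW]] := hd. Qed.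

Lemma bsqrt_comm Z : T * Z = Z * T -> k * Z = Z * k.
Proof.
move=> TZ; apply: (bsqrt_commute k1 kk).
by rewrite mulrDl mulrDr mul1r mulr1 -mulrA TZ !mulrA TZ.
Qed.

Lemma uni_comm Z : T * Z = Z * T -> uni T * Z = Z * uni T.
Proof. by move=> TZ; rewrite /uni mulrDl mulrDr TZ bsqrt_comm. Qed.

Hypothesis Ts : sh T = - T.

Lemma sh_bsqrt_uni : sh k = k.
Proof. by apply: sh_bsqrt k1 kk _; rewrite (blinD shl) sh1 shM Ts mulrNN. Qed.

Lemma sh_uni : sh (uni T) = k - T.
Proof. by rewrite /uni (blinD shl) Ts sh_bsqrt_uni addrC. Qed.

(** The root k of 1 + T^2 commutes with T, so (T + k) (k - T) = k^2 - T^2 = 1. *)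
Lemma uni_unitary : unitary sh (uni T).
Proof.
have Tk : k * T = T * k by exact: bsqrt_comm.
split; rewrite sh_uni /uni -/k.
  by rewrite mulrDl !mulrBr kk Tk addrC addrA subrK addrK.
by rewrite mulrDr !mulrBl kk Tk addrC addrA subrK addrK.
Qed.

Lemma skew_uni : skew_part sh (uni T) = T.
Proof. by rewrite /skew_part sh_uni /uni -/k opprB addrACA subrr addr0 bop_half_double. Qed.

End Uni.

Lemma skew_norm_unitary U : `|skew_part sh U| <= `|U - 1|.
Proof.
have -> : skew_part sh U = skew_part sh (U - 1).
  by rewrite (blinB (blin_skew sh_inv)) [skew_part sh 1]/skew_part sh1 subrr scaler0 subr0.
exact: norm_skew_le.
Qed.

(* [(U + U^#)/2] squares to [1 + ((U - U^#)/2)^2] when [U U^# = U^# U = 1]. *)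
Lemma uni_skew U : unitary sh U -> `|U - 1| <= 2^-1 -> uni (skew_part sh U) = U.
Proof.
move=> [U1 U2] Un.
pose C := 2^-1 *: (U + sh U).
have UE : skew_part sh U + C = U.
  by rewrite /skew_part /C -scalerDr addrACA addNr addr0 bop_half_double.
rewrite /uni (@bsqrt_uniq _ _ _ C) //.
- have -> : C - 1 = 2^-1 *: ((U - 1) + sh (U - 1)).
    rewrite (blinB shl) sh1 addrACA -opprD scalerBr bop_half_double //.
  rewrite normrZ ger0_norm ?invr_ge0// -[leRHS]mulr1 ler_wpM2l ?invr_ge0//.
  apply: le_trans (ler_normD _ _) _.
  by have := star_norm sh_inv (U - 1); lra.
- rewrite /C /skew_part !bscaleAl !bscaleAr.
  have -> : (U + sh U) * (U + sh U) = (U - sh U) * (U - sh U) + ((1 + 1) + (1 + 1)).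
    rewrite !mulrDl !mulrDr !mulNr !mulrN U1 U2 opprK.
    rewrite [1 + sh U * sh U]addrC [- 1 + _]addrC [LHS]addrACA.
    by rewrite (addrACA (U * U) (- 1)) -opprD [RHS]addrA subrK.
  by rewrite !scalerDr !bop_double_half addrC.
Qed.

(* [section_map Q] is a local section of the action: near [Q], it sends a
   normal projection [X] to a unitary [U] with [U Q U^# = X], namely the
   unitary part of the intertwiner [intertwiner Q X]. *)
Definition intertwiner Q X : A := \sum_i blk sh X i * blk sh Q i.

Definition section_map Q X : A :=
  intertwiner Q X * binv (bsqrt (sh (intertwiner Q X) * intertwiner Q X)).

(** The first two conditions say that S^# S has a root near 1. The third makes S S^# invertible,
    which is what gives U U^# = 1 besides U^# U = 1. *)
Definition section_ok Q X : Prop :=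
  let S := intertwiner Q X in
  [/\ `|bsqrt (sh S * S) - 1| < 2^-1,
      bsqrt (sh S * S) * bsqrt (sh S * S) = sh S * S & `|S * sh S - 1| < 1].

Section Section_map.
Variables (Q : A) (hQ : normal_proj sh Q).

Section Intertwiner.
Variables (X : A) (hX : normal_proj sh X).
Let S := intertwiner Q X.

Lemma intertwiner_blk i : S * blk sh Q i = blk sh X i * S.
Proof. by rewrite [LHS](sum_blk_l sh_inv)// [RHS](sum_blk_r sh_inv). Qed.

Lemma sh_intertwiner : sh S = \sum_i blk sh Q i * blk sh X i.
Proof.
rewrite /S /intertwiner (blin_sum shl).
rewrite (reindex_inj (h := fun i : bool * bool => (i.2, i.1))) /=; last first.
  by move=> [a b] [c d] [-> ->].
apply: eq_bigr => -[a b] _ /=.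
by rewrite (shM (blk sh X (b, a))) !sh_blk.
Qed.

(** By orthogonality of the blocks both sides are the sum of e_i(Q) e_i(X) e_i(Q). Hence S^# S, its
    root and the inverse of the root commute with the blocks of Q, and normalizing S keeps the
    intertwining relation. *)
Lemma intertwiner_pinch : sh S * S = pinch sh Q S.
Proof.
rewrite [in LHS]/S /intertwiner mulr_sumr /pinch; apply: eq_bigr => i _.
rewrite mulrA sh_intertwiner (sum_blk_l sh_inv)// -mulrA.
by rewrite -[blk sh Q i * S * _]mulrA [S * _](sum_blk_l sh_inv).
Qed.

Hypothesis okX : section_ok Q X.
Let W := sh S * S.
Let K := bsqrt W.
Let U := section_map Q X.

Let KK : K * K = W. Proof. by case: okX. Qed.
Let K1 : `|K - 1| <= 2^-1. Proof. by case: okX => /ltW. Qed.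

Let Kinv : binv K * K = 1 /\ K * binv K = 1.
Proof. by apply: binvP; apply: le_lt_trans K1 _; rewrite invf_lt1// ltr1n. Qed.

Let KiK : binv K * K = 1. Proof. by case: Kinv. Qed.
Let KKi : K * binv K = 1. Proof. by case: Kinv. Qed.

Let shK' : sh K = K.
Proof. by apply: sh_bsqrt => //; rewrite /W shM shK. Qed.

Let shKi : sh (binv K) = binv K.
Proof.
have e1 : sh (K * binv K) = sh (binv K) * K by rewrite shM shK'.
have e2 : sh (binv K * K) = K * sh (binv K) by rewrite shM shK'.
by apply/esym/binv_uniq; rewrite -?e1 -?e2 ?KKi ?KiK sh1.
Qed.

Let K_blk i : K * blk sh Q i = blk sh Q i * K.
Proof.
apply: (bsqrt_commute K1 KK).
by rewrite /W intertwiner_pinch pinch_comm_blk.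
Qed.

Let Ki_blk i : binv K * blk sh Q i = blk sh Q i * binv K.
Proof.
have := K_blk i; move: (blk sh Q i) => b Kb.
have e : binv K * (K * b) * binv K = binv K * (b * K) * binv K by rewrite Kb.
by rewrite mulrA KiK mul1r -!mulrA KKi mulr1 in e; rewrite e.
Qed.

Lemma section_unitary : unitary sh U.
Proof.
have UE : U = S * binv K by [].
have shU : sh U = binv K * sh S by rewrite UE shM shKi.
have shUS : sh U * S = K by rewrite shU -mulrA -/W -KK mulrA KiK mul1r.
split; last by rewrite [X in _ * X = _]UE mulrA shUS KKi.
have UK : U * K = S by rewrite UE -mulrA KiK mulr1.
(* The defect U U^# - 1 annihilates S S^#, which is at distance less than 1 from the identity; this
   contracts the defect to 0. *)
have z : (U * sh U - 1) * (S * sh S) = 0.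
  by rewrite mulrA mulrBl -[U * sh U * S]mulrA shUS UK mul1r subrr mul0r.
apply/eqP; rewrite -subr_eq0; apply/eqP; set p := U * sh U - 1 in z *.
have [_ _ s1] := okX.
apply: (@bop_contraction0 _ _ _ `|S * sh S - 1|); first by rewrite normr_ge0.
have {1}-> : p = - (p * (S * sh S - 1)) by rewrite mulrBr z mulr1 sub0r opprK.
by rewrite normrN mulrC bop_normM.
Qed.

Lemma section_act : conj_act sh Q U = X.
Proof.
have e : U * Q = X * U.
  rewrite -[Q in LHS](sum_blk_true sh) -[X in RHS](sum_blk_true sh) mulr_sumr mulr_suml.
  apply: eq_bigr => b _; rewrite /U /section_map -/S -/W -/K.
  by rewrite -mulrA Ki_blk mulrA intertwiner_blk mulrA.
by rewrite /conj_act e -mulrA section_unitary.1 mulr1.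
Qed.

(** The inverse of K commutes with the blocks of Q, so it leaves the pinching as a right factor: the
    result is S^# S K^-1 = K. *)
Lemma pinch_section : pinch sh Q U = K.
Proof.
have -> : pinch sh Q U = pinch sh Q S * binv K.
  rewrite /pinch mulr_suml; apply: eq_bigr => i _.
  have := Ki_blk i; rewrite /U /section_map -/S -/W -/K; move: (blk sh Q i) => b e.
  by rewrite mulrA -[LHS]mulrA e mulrA.
by rewrite -intertwiner_pinch -/W -KK -mulrA KKi mulr1.
Qed.

Lemma pinch_skew_section : pinch sh Q (skew_part sh U) = 0.
Proof.
by rewrite (pinch_skew sh_inv) pinch_section /skew_part shK' subrr scaler0.
Qed.

End Intertwiner.

(** Put V = uni T. The blocks of V Q V^# are V e_i V^#, so the intertwiner is V times the pinching
    of V^# = k - T, that is V D. Then S^# S = D^2 has root D by uniqueness, and V D D^-1 = V. *)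
Lemma section_map_uni d T : good_radius d -> `|T| < d -> sh T = - T ->
  pinch sh Q T = 0 -> `|pinch sh Q (bsqrt (1 + T * T)) - 1| <= 2^-1 ->
  section_map Q (conj_act sh Q (uni T)) = uni T.
Proof.
move=> hd Td Ts pT; set k := bsqrt _; set D := pinch sh Q k => D1.
have hV : unitary sh (uni T) by exact: (uni_unitary hd Td Ts).
set V := uni T in hV *.
have shV : sh V = k - T by exact: (sh_uni hd Td Ts).
have SE : intertwiner Q (conj_act sh Q V) = V * D.
  have -> : D = pinch sh Q (sh V) by rewrite shV (blinB (blin_pinch sh Q)) pT subr0.
  rewrite /intertwiner /pinch mulr_sumr; apply: eq_bigr => i _.
  by rewrite (act_blk sh_inv)// /conj_act !mulrA.
have shD : sh D = D by rewrite /D (sh_pinch sh_inv) (sh_bsqrt_uni hd Td Ts).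
have WE : sh (V * D) * (V * D) = D * D.
  by rewrite shM shD -!mulrA [sh V * _]mulrA hV.2 mul1r.
rewrite /section_map SE WE (bsqrt_uniq D1) //.
have [|_ DD] := @binvP _ _ D; last by rewrite -mulrA DD mulr1.
by apply: le_lt_trans D1 _; rewrite invf_lt1// ltr1n.
Qed.

Lemma analytic_half (E : normedModType R) (f : E -> A) x b :
  analytic_at f x -> analytic_at (fun y => half b (f y)) x.
Proof.
move=> fa; case: b => //=; apply: analyticD (analytic_cst _ _) _.
exact: analyticN.
Qed.

Lemma analytic_intertwiner (E : normedModType R) (f : E -> A) x :
  analytic_at f x -> analytic_at (fun y => intertwiner Q (f y)) x.
Proof.
move=> fa; rewrite /intertwiner.
have h i : analytic_at (fun y => blk sh (f y) i * blk sh Q i) x.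
  apply: analyticM (analytic_cst _ _); apply: analyticM; first exact: analytic_half.
  by apply: analytic_half; exact: analytic_blin_comp shl fa.
elim: (index_enum _) => [|i s IH].
  by under eq_fun do rewrite big_nil; exact: analytic_cst.
by under eq_fun do rewrite big_cons; exact: analyticD.
Qed.

Lemma analytic_section (E : normedModType R) (f : E -> A) x :
  analytic_at f x -> section_ok Q (f x) ->
  analytic_at (fun y => section_map Q (f y)) x.
Proof.
move=> fa [h1 h2 _]; have Sa := analytic_intertwiner fa.
apply: analyticM => //; apply: analytic_binv.
  apply: (analytic_bsqrt (f := fun y => sh (intertwiner Q (f y)) * intertwiner Q (f y))) => //.
  by apply: analyticM => //; exact: analytic_blin_comp shl Sa.
by apply: lt_trans h1 _; rewrite invf_lt1// ltr1n.
Qed.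

Lemma intertwiner_id : intertwiner Q Q = 1.
Proof.
rewrite -[RHS](sum_blk sh Q); apply: eq_bigr => i _.
by rewrite (blk_orth sh_inv hQ) eqxx.
Qed.

Lemma bsqrt1 : bsqrt (1 : A) = 1.
Proof. by apply: bsqrt_uniq; rewrite ?subrr ?normr0 ?invr_ge0 ?mulr1. Qed.

Lemma section_map_id : section_map Q Q = 1.
Proof.
rewrite /section_map intertwiner_id sh1 mul1r mulr1 bsqrt1.
by apply: binv_uniq; rewrite mulr1.
Qed.

Lemma section_radius (e : R) : 0 < e -> exists2 d : R, 0 < d &
  forall X, `|X - Q| < d -> section_ok Q X /\ `|section_map Q X - 1| < e.
Proof.
move=> e0; have [eta eta0 etaP] := bsqrt_exists H.
have ida : analytic_at (@id A) Q by exact: analytic_id.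
have Sa := analytic_intertwiner ida.
have shSa := analytic_blin_comp shl Sa.
have okQ : section_ok Q Q.
  split; rewrite intertwiner_id sh1 mulr1 ?bsqrt1 ?subrr ?normr0 ?mulr1 ?invr_gt0//.
have h1 : \forall h \near (0 : A),
    `|sh (intertwiner Q (Q + h)) * intertwiner Q (Q + h) - 1| < eta.
  apply: (near_norm_lt (f := fun X => sh (intertwiner Q X) * intertwiner Q X)).
    by apply: analytic_continuous; exact: analyticM.
  by rewrite intertwiner_id sh1 mulr1 subrr normr0.
have h2 : \forall h \near (0 : A),
    `|intertwiner Q (Q + h) * sh (intertwiner Q (Q + h)) - 1| < 1.
  apply: (near_norm_lt (f := fun X => intertwiner Q X * sh (intertwiner Q X))).
    by apply: analytic_continuous; exact: analyticM.
  by rewrite intertwiner_id sh1 mulr1 subrr normr0.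
have h3 : \forall h \near (0 : A), `|section_map Q (Q + h) - 1| < e.
  apply: (near_norm_lt (f := section_map Q)); last by rewrite section_map_id subrr normr0.
  by apply: analytic_continuous; exact: analytic_section ida okQ.
have : \forall h \near (0 : A), section_ok Q (Q + h) /\ `|section_map Q (Q + h) - 1| < e.
  near=> h; have hh1 := near h1 h; have hh2 := near h2 h; have hh3 := near h3 h.
  split; last by apply: hh3.
  have [//|k1 k2] := etaP (sh (intertwiner Q (Q + h)) * intertwiner Q (Q + h)).
    exact: hh1.
  by split=> //; exact: hh2.
move/nbhs_norm0P => [d /= d0 dP]; exists d => // X Xd.
by have := dP (X - Q) Xd; rewrite /= subrKC.
Unshelve. all: by end_near. Qed.

Lemma pinch_radius (d : R) : good_radius d -> exists2 d' : R, 0 < d' <= d &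
  forall T, `|T| < d' -> `|pinch sh Q (bsqrt (1 + T * T)) - 1| <= 2^-1.
Proof.
move=> hd; have [d0 _ dP] := hd.
(* The difference [uni T - T] is the root of 1 + T^2, written so that [analytic_uni] applies. *)
have pa : analytic_at (fun T => pinch sh Q (uni T - T)) 0.
  apply: (analytic_blin_comp (blin_pinch sh Q)); apply: analyticD.
    by apply: (analytic_uni (f := id) hd (analytic_id _)); rewrite normr0.
  exact/analyticN/analytic_id.
have h : \forall h \near (0 : A), `|pinch sh Q (uni (0 + h) - (0 + h)) - 1| < 2^-1.
  apply: (near_norm_lt (f := fun T => pinch sh Q (uni T - T)) (analytic_continuous pa)).
  rewrite /uni mulr0 addr0 bsqrt1 add0r subr0 (pinch1 sh_inv hQ) subrr normr0.
  by rewrite invr_gt0.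
move/nbhs_norm0P : h => [e /= e0 eP]; exists (Num.min e d).
  by rewrite lt_min e0 d0 ge_min lexx orbT.
move=> T; rewrite lt_min => /andP[Te _].
by have := eP T Te; rewrite /= add0r /uni [T + _]addrC addrK => /ltW.
Qed.

End Section_map.

End UnitarySections.

(** * The unitary group and the isotropy group *)

Section LocalContinuity.
Variable R : realType.
Implicit Types E F : normedModType R.

Lemma open_local (T U : topologicalType) (B : set T) (f : T -> U) (O : set U) :
  open B -> (forall x, B x -> {for x, continuous f}) -> open O ->
  open (B `&` f @^-1` O).
Proof.
move=> Bo fc Oo; rewrite openE => x [Bx Ox].
apply: filterI; first exact: open_nbhs_nbhs.
by apply: (fc x Bx); exact: open_nbhs_nbhs.
Qed.

Lemma open_norm_lt E (a : E) (d : R) : open [set x | `|x - a| < d].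
Proof.
rewrite (_ : [set x | _] = setT `&` (fun x => `|x - a|) @^-1` [set r | r < d]).
  apply: open_local; [exact: openT| |exact: open_lt].
  move=> x _; apply: (@continuous_comp _ _ _ (fun x => x - a) Num.norm).
    by apply: cvgB; [exact: cvg_id|exact: cvg_cst].
  exact: norm_continuous.
by apply/seteqP; split=> x //= [].
Qed.

Lemma open_norm_lt0 E (d : R) : open [set x : E | `|x| < d].
Proof.
rewrite (_ : [set x : E | _] = [set x : E | `|x - 0| < d]); first exact: open_norm_lt.
by apply/seteqP; split=> x /=; rewrite subr0.
Qed.

Lemma diff_near E F (f g : E -> F) x : (\forall y \near x, f y = g y) ->
  analytic_at f x -> 'd f x = 'd g x :> (E -> F).
Proof.
move=> fg fa; have [df [dfl [K K0 est]]] := analytic_differential fa.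
have [_ ->] := diff_of_estimate dfl K0 est.
have est' : \forall h \near (0 : E), `|g (x + h) - g x - df h| <= K * `|h| ^+ 2.
  have fg0 := nbhs_singleton fg.
  have fg' : \forall h \near (0 : E), f (x + h) = g (x + h) by move/nbhs0P : fg.
  by near=> h; rewrite -fg0 -(near fg' h)//; near: h.
by have [_ ->] := diff_of_estimate dfl K0 est'.
Unshelve. all: by end_near. Qed.

Lemma diff_blinear E F (f : E -> F) x : blinear f -> 'd f x = f :> (E -> F).
Proof.
move=> fl; have [|_ ->//] := @diff_of_estimate _ _ _ f x f 0 fl (lexx _).
apply: nearW => h; rewrite (blinD fl) [f x + _]addrC addrK subrr normr0 mul0r.
by [].
Qed.

End LocalContinuity.

Section GroupManifold.
Variables (R : realType) (H : hilbertType R).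
Notation A := (bop H).
Variables (sh : A -> A) (sh_inv : involution sh).
Variables (Q : A) (hQ : normal_proj sh Q) (d : R) (hd : good_radius H d).

Let shl : blinear sh := star_lin sh_inv.
Let shM S T : sh (S * T) = sh T * sh S := starM sh_inv S T.
Let shK T : sh (sh T) = T := starK sh_inv T.
Let sh1 : sh 1 = 1 := star1 sh_inv.

Notation p := (isoproj sh_inv hQ).
Notation g := (rng p).
Notation G := (commutant sh Q).

Lemma commutant1 : G 1.
Proof. by split; [exact: unitary1|rewrite mulr1 mul1r]. Qed.

Lemma commutantM U V : G U -> G V -> G (U * V).
Proof.
move=> [uU cU] [uV cV]; split; first exact: unitaryM.
by rewrite -mulrA cV mulrA cU mulrA.
Qed.

Lemma commutantV U : G U -> G (sh U).
Proof.
move=> [uU cU]; split; first exact: unitaryV.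
have e : sh U * (U * Q) * sh U = sh U * (Q * U) * sh U by rewrite cU.
by rewrite mulrA uU.2 mul1r -!mulrA uU.1 mulr1 in e; rewrite e.
Qed.

Lemma commutant_group : is_group G *%R 1 sh.
Proof.
split; [exact: commutant1|exact: commutantM|exact: commutantV| |].
  by move=> *; rewrite mulrA.
by move=> x [[x1 x2] _]; rewrite mul1r mulr1.
Qed.

Lemma rng_lie (t : g) : commutant_lie sh Q (rngv t).
Proof. exact/isoprojE/rngE. Qed.

Lemma uni_commutant (t : g) : `|t| < d -> G (uni (rngv t)).
Proof.
move=> td; have [ts tQ] := rng_lie t.
by split; [exact: (uni_unitary sh_inv hd td ts)|exact: (uni_comm hd)].
Qed.

(** The group is stable under [sh], so the skew part of U commutes with Q and Q^# and is fixed by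
    the pinching. *)
Lemma isoproj_commutant U : G U -> p U = skew_part sh U.
Proof.
move=> hU; have cU := hU.2; have csU := (commutantV hU).2.
have cs : skew_part sh U * Q = Q * skew_part sh U.
  by rewrite /skew_part bscaleAl bscaleAr mulrBl mulrBr cU csU.
apply: (pinch_id sh_inv) => //; apply: skew_comm_sh => //.
exact: sh_skew.
Qed.

Lemma isoproj_uni (t : g) : `|t| < d -> p (uni (rngv t)) = rngv t.
Proof.
move=> td; rewrite isoproj_commutant; last exact: uni_commutant.
by apply: (skew_uni sh_inv hd) => //; have [] := rng_lie t.
Qed.

(** Left translates of one parametrization near 1. The forward map is the restriction of a bounded
    linear map of the whole algebra, so chart changes are analytic as soon as [uni] is. *)
Definition gchart V : chart A g :=
  Chart [set U : A | G U /\ `|sh V * U - 1| < d] (fun U => rproj p (sh V * U))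
    (fun t => V * uni (rngv t)).

Definition gman : manifold R A :=
  Manifold G (subspace_opens G) [set c : chart A g | exists2 V, G V & c = gchart V].

Lemma gchart_funP V U : G V -> chart_dom (gchart V) U ->
  let t := chart_fun (gchart V) U in
  [/\ `|t| < d, uni (rngv t) = sh V * U & chart_inv (gchart V) t = U].
Proof.
move=> hV [hU Ud] /=; have [_ d2 _] := hd.
have hW : G (sh V * U) by apply: commutantM => //; exact: commutantV.
have W2 : `|sh V * U - 1| <= 2^-1 by apply: le_trans d2; exact: ltW.
have tE : p (sh V * U) = skew_part sh (sh V * U) by exact: isoproj_commutant.
have uE : uni (skew_part sh (sh V * U)) = sh V * U by apply: uni_skew hW.1 W2.
split.
- rewrite [`|_|]/(`|p (sh V * U)|) tE; apply: le_lt_trans Ud.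
  exact: skew_norm_unitary.
- by rewrite /= -[X in uni X]/(p (sh V * U)) tE.
by rewrite -[X in uni X]/(p (sh V * U)) tE uE mulrA hV.1.1 mul1r.
Qed.

Lemma gchart_invK V t : G V -> `|t| < d ->
  chart_fun (gchart V) (chart_inv (gchart V) t) = t.
Proof.
move=> hV td; apply: rng_inj; rewrite /= mulrA hV.1.2 mul1r.
exact: isoproj_uni.
Qed.

Lemma analytic_gchart_inv V t : `|t| < d -> analytic_at (chart_inv (gchart V)) t.
Proof.
move=> td; apply: analyticM (analytic_cst _ _) _.
apply: (analytic_uni hd) => //; exact/analytic_blinear/blin_rngv.
Qed.

Lemma analytic_gchart_fun (E : normedModType R) (f : E -> A) V x :
  analytic_at f x -> analytic_at (fun y => chart_fun (gchart V) (f y)) x.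
Proof.
move=> fa; apply: analytic_blin_comp (blin_rproj p) _.
exact: analyticM (analytic_cst _ _) fa.
Qed.

Lemma gchart_fun_cont V : continuous (chart_fun (gchart V)).
Proof.
by move=> U; apply: analytic_continuous; apply: analytic_gchart_fun; exact: analytic_id.
Qed.

Lemma gchart_dom_open V : G V -> opens gman (chart_dom (gchart V)).
Proof.
move=> hV; exists ((fun U => sh V * U) @^-1` [set X : A | `|X - 1| < d]).
  rewrite -[X in open X]setTI; apply: open_local; [exact: openT| |exact: open_norm_lt].
  by move=> U _; exact: (blin_continuous (blin_mull _)).
by [].
Qed.

Lemma gchart_is_chart V : G V -> @is_chart R A gman (gchart V).
Proof.
move=> hV.
pose B0 : set g := [set t | `|t| < d].
have B0c t : B0 t -> {for t, continuous (chart_inv (gchart V))}.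
  by move=> td; exact/analytic_continuous/analytic_gchart_inv.
have uc (t : g) : B0 t -> {for t, continuous (fun t : g => uni (rngv t))}.
  move=> td; apply: analytic_continuous; apply: (analytic_uni hd) => //.
  exact/analytic_blinear/blin_rngv.
apply: (@is_chart_criterion R A gman (gchart V)
  (B0 `&` (fun t : g => uni (rngv t)) @^-1` [set X : A | `|X - 1| < d])).
- exact: subspace_topology.
- exact: gchart_dom_open.
- by apply: open_local => //; [exact: open_norm_lt0|exact: open_norm_lt].
- move=> U hU; have [h1 h2 h3] := gchart_funP hV hU; split=> //; split=> //=.
  by rewrite h2; case: hU.
- by move=> t [td _] _; exact: gchart_invK.
- move=> _ [P Po ->].
  rewrite (_ : _ `&` (chart_inv (gchart V)) @^-1` _ =
    (B0 `&` (fun t : g => uni (rngv t)) @^-1` [set X : A | `|X - 1| < d]) `&` (chart_inv (gchart V)) @^-1` P).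
    apply: open_local; [ |by move=> t [td _]; exact: B0c|exact: Po].
    by apply: open_local => //; [exact: open_norm_lt0|exact: open_norm_lt].
  apply/seteqP; split=> t [[td tu]]; first by move=> [_ tP].
  move=> tP; split=> //; split=> //=; apply: commutantM => //; exact: uni_commutant.
- move=> P Po; have [D Do DE] := gchart_dom_open hV.
  rewrite DE; exists (D `&` (chart_fun (gchart V)) @^-1` P); last by rewrite setIA.
  by apply: open_local => // U _; exact: gchart_fun_cont.
Qed.

Lemma gchart_dom_self V : G V -> chart_dom (gchart V) V.
Proof. by move=> hV; split=> //; rewrite hV.1.2 subrr normr0; case: hd. Qed.

Lemma gman_banach : banach_manifold gman.
Proof.
split.
- exact: subspace_topology.
- exact: subspace_hausdorff.
- by move=> _ [V hV ->]; exact: gchart_is_chart.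
- by move=> V hV; exists (gchart V); [exists V|exact: gchart_dom_self].
move=> _ _ [V hV ->] [W hW ->] _ [U [UV UW] <-].
have [td _ _] := gchart_funP hV UV.
by apply: analytic_gchart_fun; exact: analytic_gchart_inv.
Qed.

Lemma gman_mul : analytic_map (prod_manifold gman gman) gman (fun x => x.1 * x.2).
Proof.
split.
- by move=> [U V] [/= hU hV]; exact: commutantM.
- move=> _ [P Po ->] [U V] [[/= hU hV] [_ /= PUV]].
  have mc : (fun z : A * A => z.1 * z.2) @ (U, V) --> U * V.
    apply: (bbil_cvg (bbil_mul H)); first exact: cvg_fst.
    exact: cvg_snd.
  have [[/= P1 P2] [P1U P2V] P12] : nbhs (U, V) ((fun z : A * A => z.1 * z.2) @^-1` P).
    by apply: mc; exact: open_nbhs_nbhs.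
  exists (G `&` P1°), (G `&` P2°); split.
  + by exists P1° => //; exact: open_interior.
  + by exists P2° => //; exact: open_interior.
  + by split.
  + by split.
  move=> [S T] [/= [hS PS] [hT PT]]; split=> //=; split; first exact: commutantM.
  by apply: (P12 (S, T)); split; exact: interior_subset.
- move=> _ _ [_ [_ [[V hV ->] [W hW ->] ->]]] [Z hZ ->] _ [[S T] [/= [SV TW] _] <-].
  have [sd _ _] := gchart_funP hV SV; have [td _ _] := gchart_funP hW TW.
  apply: analytic_gchart_fun; apply: analyticM.
    apply: (analytic_comp_blin (@blin_fst R g g) (x := (_, _))).
    exact: analytic_gchart_inv.
  apply: (analytic_comp_blin (@blin_snd R g g) (x := (_, _))).
  exact: analytic_gchart_inv.
Qed.

Lemma gman_inv : analytic_map gman gman sh.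
Proof.
split.
- exact: commutantV.
- move=> _ [P Po ->]; exists (sh @^-1` P).
    rewrite -[X in open X]setTI; apply: open_local => //; first exact: openT.
    by move=> U _; exact: (blin_continuous shl).
  apply/seteqP; split=> U [hU]; first by move=> [_ hP].
  by move=> hP; split=> //; split=> //; exact: commutantV.
move=> _ _ [V hV ->] [W hW ->] _ [U [UV UW] <-].
have [td _ _] := gchart_funP hV UV.
apply: analytic_gchart_fun; apply: (analytic_blin_comp shl).
exact: analytic_gchart_inv.
Qed.

Lemma gman_incl : analytic_map gman (vector_manifold A) id.
Proof.
split=> //; first by move=> P Po; exists P.
move=> _ _ [V hV ->] -> _ [U [UV UW] <-].
have [td _ _] := gchart_funP hV UV.
exact: analytic_gchart_inv.
Qed.

(** The linear map [Phi] followed after the inverse chart gives the inclusion of the model space; by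
    the chain rule the differential is the first factor of an injective map. *)
Lemma gchart_diff_inj V : G V -> chart_dom (gchart V) 1 ->
  injective ('d (chart_inv (gchart V)) (chart_fun (gchart V) 1)).
Proof.
move=> hV V1; set t1 := chart_fun _ 1; set psi := chart_inv _.
have [td _ _] := gchart_funP hV V1.
have psia : analytic_at psi t1 by exact: analytic_gchart_inv.
pose Phi X := p (sh V * X).
have Phil : blinear Phi by exact: blin_comp (bproj_lin p) (blin_mull _).
have e : 'd (Phi \o psi) t1 = @rngv R A p :> (g -> A).
  rewrite -(diff_blinear t1 (blin_rngv p)); apply/esym/diff_near; last first.
    exact/analytic_blinear/blin_rngv.
  have : open_nbhs t1 [set t : g | `|t| < d] by split=> //; exact: open_norm_lt0.
  move/open_nbhs_nbhs; apply: filterS => t td' /=.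
  by rewrite -[in LHS](gchart_invK hV td').
rewrite diff_comp ?(diff_blinear _ Phil) in e; first last.
- exact/analytic_differentiable/analytic_blinear.
- exact: analytic_differentiable.
by move=> v w vw; apply: rng_inj; rewrite -e /= vw.
Qed.

Lemma gman_operator_lie_group : operator_lie_group gman sh.
Proof.
split=> //.
- split; [exact: gman_banach|exact: commutant_group|exact: gman_mul|exact: gman_inv].
- exact: gman_incl.
- by move=> _ [V hV ->]; exact: gchart_diff_inj.
Qed.

Lemma gchart1_fun1 : chart_fun (gchart 1) 1 = 0.
Proof.
apply: rng_inj; rewrite /= sh1 mulr1.
rewrite /skew_part sh1 subrr scaler0 (blin0 (blin_pinch sh Q)).
by [].
Qed.

(** The remainder is k - 1, and 2 (k - 1) = T^2 - (k - 1)^2 with |k - 1| < 1/2 gives |k - 1| <=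
    |T|^2. *)
Lemma gchart1_diff : 'd (chart_inv (gchart 1)) (0 : g) = @rngv R A p :> (g -> A).
Proof.
have est : \forall h \near (0 : g),
    `|chart_inv (gchart 1) (0 + h) - chart_inv (gchart 1) 0 - rngv h| <= 1 * `|h| ^+ 2.
  have [d0 _ dP] := hd.
  have hd0 : \forall h \near (0 : g), `|rngv h| < d by exact: (@nbhs0_lt R g d d0).
  near=> h; have hdd : `|rngv h| < d by near: h.
  have [k1 kk] := dP _ hdd.
  rewrite add0r /= !mul1r /uni mul0r addr0 bsqrt1 add0r.
  set T := rngv h in hdd k1 kk *; set k := bsqrt _ in k1 kk *.
  rewrite addrAC [T + k]addrC addrK.
  have e : (k - 1) + (k - 1) = T * T - (k - 1) * (k - 1).
    rewrite mulrBl !mulrBr kk !mul1r !mulr1 [1 + _]addrC -[T * T + 1 - k]addrA -(opprB k 1).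
    move: (k - 1) => m. by rewrite -addrA -opprD subKr.
  have n : `|(k - 1) + (k - 1)| = 2 * `|k - 1|.
    by rewrite -mulr2n normrMn mulr_natl.
  have h1 : `|T * T - (k - 1) * (k - 1)| <= `|T| ^+ 2 + 2^-1 * `|k - 1|.
    apply: le_trans (ler_normB _ _) _; rewrite lerD//; first exact: bop_normM.
    by apply: le_trans (bop_normM _ _) _; rewrite ler_wpM2r// ltW.
  rewrite -[`|h|]/(`|T|).
  have h2 : 0 <= `|k - 1| by [].
  by rewrite e in n; lra.
by have [_ ->] := diff_of_estimate (blin_rngv p) ler01 est.
Unshelve. all: by end_near. Qed.

(** [lie_algebra] admits every chart around 1. Near the point of 1 such an inverse chart factors
    through the chart centred at 1, whose differential is known. *)
Lemma gchart_diff_rng V v : G V -> chart_dom (gchart V) 1 ->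
  exists w, 'd (chart_inv (gchart V)) (chart_fun (gchart V) 1) v = @rngv R A p w.
Proof.
move=> hV V1; set t1 := chart_fun _ 1; set psi := chart_inv _.
have [td _ psi1] := gchart_funP hV V1.
have psia : analytic_at psi t1 by exact: analytic_gchart_inv.
pose tau t := chart_fun (gchart 1) (psi t).
have taua : analytic_at tau t1 by exact: analytic_gchart_fun.
have d0 : 0 < d by case: hd.
have tau1 : tau t1 = 0 by rewrite /tau [psi t1]psi1 gchart1_fun1.
have inva : analytic_at (chart_inv (gchart 1)) (tau t1).
  by rewrite tau1; apply: analytic_gchart_inv; rewrite normr0.
have e : 'd psi t1 = 'd (chart_inv (gchart 1) \o tau) t1 :> (g -> A).
  apply: (diff_near _ psia).
  have h1 : \forall t \near t1, `|t| < d.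
    by apply: (@open_nbhs_nbhs _ t1 [set t : g | `|t| < d]); split=> //; exact: open_norm_lt0.
  have h2 : \forall t \near t1, `|psi t - 1| < d.
    apply/nbhs0P; apply: (near_norm_lt (f := psi) (analytic_continuous psia)).
    by rewrite [psi t1]psi1 subrr normr0.
  near=> t; have [|_ _ /esym//] := @gchart_funP 1 (psi t) commutant1.
  have td' : `|t| < d by near: t.
  have td2 : `|psi t - 1| < d by near: t.
  split; last by rewrite sh1 mul1r.
  by apply: commutantM => //; exact: uni_commutant.
rewrite e diff_comp; first last.
- exact: analytic_differentiable.
- exact: analytic_differentiable.
by rewrite /= tau1 gchart1_diff; eexists.
Unshelve. all: by end_near. Qed.

Lemma gman_lie_algebra : lie_algebra gman = commutant_lie sh Q.
Proof.
apply/seteqP; split=> X.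
  move=> [_ [[V hV ->] V1 [v ->]]].
  by have [w ->] := gchart_diff_rng v hV V1; exact: rng_lie.
move=> hX; exists (gchart 1); split.
- by exists 1 => //; exact: commutant1.
- exact/gchart_dom_self/commutant1.
exists (rproj p X); rewrite gchart1_fun1 gchart1_diff.
by rewrite -[RHS]/(p X); apply/esym/isoprojE.
Qed.

End GroupManifold.

(** * The orbit *)

Section ClosedKernels.
Variable R : realType.
Implicit Types E F : normedModType R.

Lemma closed_kernel E F (f : E -> F) : continuous f -> closed [set v | f v = 0].
Proof.
move=> fc; rewrite (_ : [set v | _] = f @^-1` [set 0])//.
apply: closed_comp; first by move=> x _; exact: fc.
exact/accessible_closed_set1/hausdorff_accessible/norm_hausdorff.
Qed.

(** The complement is the range of the right inverse [s], described by s (D v) = v to make it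
    visibly closed; v splits as (v - s (D v)) + s (D v). *)
Lemma kernel_split E F (D : {linear E -> F}) (s : {linear F -> E}) :
  continuous D -> continuous s -> (forall w, D (s w) = w) ->
  closed_complemented [set v | D v = 0] setT.
Proof.
move=> Dc sc Ds; split=> //.
- by split=> [|a x y /= Dx Dy]; rewrite /= ?linear0// linearP Dx Dy scaler0 addr0.
- exact: closed_kernel.
exists [set v | s (D v) - v = 0]; split=> //.
- split=> [|a x y /= Dx Dy]; first by rewrite /= !linear0 ?subr0 ?addr0.
  by rewrite /= !linearP addrACA -scalerDr Dx Dy scaler0 addr0.
- apply: closed_kernel => v; apply: cvgB; last exact: cvg_id.
  by apply: (@continuous_comp _ _ _ D s); [exact: Dc|exact: sc].
- apply/seteqP; split=> v /=; last by move=> ->; rewrite !linear0 ?subr0 ?addr0.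
  by move=> [Dv]; rewrite Dv linear0 sub0r => /eqP; rewrite oppr_eq0 => /eqP.
move=> v _; exists (v - s (D v)), (s (D v)); split=> /=.
- by rewrite linearB Ds subrr.
- by rewrite Ds subrr.
by rewrite subrK.
Qed.

Lemma closed_fixed E (f : E -> E) : blinear f -> closed [set v | f v = v].
Proof.
move=> fl; rewrite (_ : [set v | _] = [set v | f v - v = 0]).
  apply: closed_kernel => v; apply: cvgB; last exact: cvg_id.
  exact: blin_continuous.
by apply/seteqP; split=> v /= => [->|/eqP]; rewrite ?subrr// subr_eq0 => /eqP.
Qed.

Lemma subspace_fixed E (f : E -> E) : blinear f -> is_subspace [set v | f v = v].
Proof.
move=> fl; split=> [|a x y /= fx fy]; first exact: blin0.
by rewrite fl.1 fx fy.
Qed.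

End ClosedKernels.

Section OrbitManifold.
Variables (R : realType) (H : hilbertType R).
Notation A := (bop H).
Variables (sh : A -> A) (sh_inv : involution sh).
Variables (Q : A) (hQ : normal_proj sh Q) (d : R) (hd : good_radius H d).

Let shl : blinear sh := star_lin sh_inv.
Let shM S T : sh (S * T) = sh T * sh S := starM sh_inv S T.
Let shK T : sh (sh T) = T := starK sh_inv T.
Let sh1 : sh 1 = 1 := star1 sh_inv.

Lemma normal_proj1 : normal_proj sh 1.
Proof. by split; rewrite ?sh1 ?mulr1. Qed.

Lemma commutant_1E : commutant sh 1 = unitary sh.
Proof. by apply/seteqP; split=> U; [case|move=> hU; split=> //; rewrite mulr1 mul1r]. Qed.

Lemma commutant_lie1E : commutant_lie sh 1 = [set X | sh X = - X].
Proof. by apply/seteqP; split=> X; [case|move=> hU; split=> //; rewrite mulr1 mul1r]. Qed.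

Notation UJ := (gman sh_inv normal_proj1 d).
Notation G := (gman sh_inv hQ d).

Lemma commutant_sub1 U : commutant sh Q U -> commutant sh 1 U.
Proof. by move=> [uU _]; rewrite commutant_1E. Qed.

Lemma gman_subgroup : banach_lie_subgroup G UJ sh.
Proof.
split.
- exact: gman_operator_lie_group.
- exact: commutant_sub1.
- split.
  + exact: commutant_sub1.
  + move=> _ [P Po ->]; exists P => //.
    apply/seteqP; split=> U [hU]; [case|move=> PU]; split=> //; split=> //.
    exact: commutant_sub1.
  move=> _ _ [V hV ->] [W hW ->] _ [U [UV UW] <-].
  have [td _ _] := gchart_funP hd hV UV.
  exact: (analytic_gchart_fun _ _ _ _ (analytic_gchart_inv hd V td)).
rewrite !gman_lie_algebra // commutant_lie1E.
have -> : commutant_lie sh Q = [set X | isoproj sh_inv hQ X = X].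
  by apply/seteqP; split=> X /isoprojE; apply.
have pl := bproj_lin (isoproj sh_inv hQ); have ql := bproj_lin (coisoproj sh_inv hQ).
split.
- exact: subspace_fixed.
- exact: closed_fixed.
- by move=> X /isoprojE[].
exists [set X | coisoproj sh_inv hQ X = X]; split.
- exact: subspace_fixed.
- exact: closed_fixed.
- by move=> X /coisoprojE[].
- apply/seteqP; split=> X; last by move=> ->; split; [exact: (blin0 pl)|exact: (blin0 ql)].
  move=> [/isoprojE[Xs XQ] /coisoprojE[_ pX]].
  by rewrite /= -pX pinch_id//; exact: skew_comm_sh.
move=> X Xs; exists (isoproj sh_inv hQ X), (coisoproj sh_inv hQ X); split.
- exact: bproj_idem.
- exact: bproj_idem.
by rewrite /= addrC subrK skew_id.
Qed.

(** Three nested scales: below [d] the map [uni] is available, below [d2] the pinched root stays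
    near 1 so that [section_map] recovers [uni T], and within [d1] of Q the section takes values
    within [d2] of 1. *)
Variables (d2 d1 : R) (d2_gt0 : 0 < d2) (d2d : d2 <= d).
Hypothesis pinchP : forall T : A, `|T| < d2 ->
  `|pinch sh Q (bsqrt (1 + T * T)) - 1| <= 2^-1.
Hypothesis d1_gt0 : 0 < d1.
Hypothesis sectionP : forall X : A, `|X - Q| < d1 ->
  section_ok sh Q X /\ `|section_map sh Q X - 1| < d2.

Notation p := (coisoproj sh_inv hQ).
Notation m := (rng p).
Notation act := (conj_act sh Q).

Definition orbit : set A := act @` unitary sh.

Definition ochart V : chart A m :=
  Chart [set X : A | orbit X /\ `|conj_act sh X (sh V) - Q| < d1]
    (fun X => rproj p (section_map sh Q (conj_act sh X (sh V))))
    (fun t => act (V * uni (rngv t))).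

Definition oman : manifold R A :=
  Manifold orbit (quotient_opens UJ act)
    [set c : chart A m | exists2 V, unitary sh V & c = ochart V].

Lemma rng_coiso (t : m) : sh (rngv t) = - rngv t /\ pinch sh Q (rngv t) = 0.
Proof. exact/coisoprojE/rngE. Qed.

Lemma uni_unitary_coiso (t : m) : `|t| < d2 -> unitary sh (uni (rngv t)).
Proof.
move=> td; have [ts _] := rng_coiso t.
by apply: (uni_unitary sh_inv hd) ts; exact: lt_le_trans td d2d.
Qed.

Lemma section_map_coiso (t : m) : `|t| < d2 ->
  section_map sh Q (act (uni (rngv t))) = uni (rngv t).
Proof.
move=> td; have [ts tp] := rng_coiso t.
by apply: (section_map_uni sh_inv hd) => //; [exact: lt_le_trans td d2d|exact: pinchP].
Qed.

Lemma coisoproj_uni (t : m) : `|t| < d2 -> p (uni (rngv t)) = rngv t.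
Proof.
move=> td; have [ts tp] := rng_coiso t.
by rewrite /= (skew_uni sh_inv hd) ?tp ?subr0//; exact: lt_le_trans td d2d.
Qed.

Lemma actA_unitary U V : conj_act sh (act V) U = act (U * V).
Proof. by rewrite /conj_act shM !mulrA. Qed.

Lemma act_cancel V X : unitary sh V -> conj_act sh (conj_act sh X (sh V)) V = X.
Proof.
by move=> [V1 _]; rewrite /conj_act shK !mulrA V1 mul1r -mulrA V1 mulr1.
Qed.

Lemma ochart_funP V X : unitary sh V -> chart_dom (ochart V) X ->
  let t := chart_fun (ochart V) X in
  [/\ `|t| < d2, act (uni (rngv t)) = conj_act sh X (sh V) &
      chart_inv (ochart V) t = X].
Proof.
move=> hV [[W hW WX] Xd] /=; set X' := conj_act sh X (sh V).
have [okX Ud] := sectionP Xd.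
have hX' : normal_proj sh X'.
  apply: (act_normal sh_inv); first exact: unitaryV.
  by rewrite -WX; exact: act_normal.
set U := section_map sh Q X' in Ud *.
have U2 : `|U - 1| <= 2^-1.
  by have [_ h _] := hd; apply: le_trans h; apply: le_trans d2d; exact: ltW.
have hU : unitary sh U := section_unitary sh_inv okX.
have pU : p U = skew_part sh U.
  by rewrite /= (pinch_skew_section sh_inv hQ hX' okX) subr0.
have uE : uni (p U) = U by rewrite pU; exact: uni_skew hU U2.
have aE : act U = X' := section_act sh_inv hQ hX' okX.
split.
- rewrite [`|_|]/(`|p U|) pU; apply: le_lt_trans Ud; exact: skew_norm_unitary.
- by rewrite -[X in uni X]/(p U) uE.
by rewrite -[X in uni X]/(p U) uE -actA_unitary aE act_cancel.
Qed.

Lemma ochart_invK V t : unitary sh V -> `|t| < d2 ->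
  chart_fun (ochart V) (chart_inv (ochart V) t) = t.
Proof.
move=> hV td; apply: rng_inj.
rewrite -[LHS]/(p (section_map sh Q (conj_act sh (act (V * uni (rngv t))) (sh V)))).
rewrite actA_unitary mulrA hV.2 mul1r section_map_coiso//.
exact: coisoproj_uni.
Qed.

Lemma analytic_act (E : normedModType R) (f : E -> A) x :
  analytic_at f x -> analytic_at (fun y => act (f y)) x.
Proof.
move=> fa; apply: analyticM; last exact: analytic_blin_comp shl fa.
exact: analyticM fa (analytic_cst _ _).
Qed.

Lemma analytic_conj_act (E : normedModType R) (f : E -> A) V x :
  analytic_at f x -> analytic_at (fun y => conj_act sh (f y) V) x.
Proof.
move=> fa; apply: analyticM; last exact: analytic_cst.
exact: analyticM (analytic_cst _ _) fa.
Qed.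

Lemma analytic_uni_coiso (t : m) : `|t| < d2 ->
  analytic_at (fun t : m => uni (rngv t)) t.
Proof.
move=> td; apply: (analytic_uni hd); first exact/analytic_blinear/blin_rngv.
exact: lt_le_trans td d2d.
Qed.

Lemma analytic_ochart_inv V t : `|t| < d2 -> analytic_at (chart_inv (ochart V)) t.
Proof.
move=> td; apply: analytic_act; apply: analyticM (analytic_cst _ _) _.
exact: analytic_uni_coiso.
Qed.

Lemma analytic_ochart_fun (E : normedModType R) (f : E -> A) V x :
  analytic_at f x -> `|conj_act sh (f x) (sh V) - Q| < d1 ->
  analytic_at (fun y => chart_fun (ochart V) (f y)) x.
Proof.
move=> fa fx; apply: analytic_blin_comp (blin_rproj p) _.
apply: (analytic_section sh_inv); first exact: analytic_conj_act.
by have [] := sectionP fx.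
Qed.

Lemma open_act_near V : open [set U : A | `|conj_act sh (act U) (sh V) - Q| < d1].
Proof.
rewrite (_ : [set U | _] = setT `&`
  (fun U => conj_act sh (act U) (sh V)) @^-1` [set X : A | `|X - Q| < d1]).
  apply: open_local; [exact: openT| |exact: open_norm_lt].
  move=> U _; apply: analytic_continuous; apply: analytic_conj_act.
  exact/analytic_act/analytic_id.
by rewrite setTI.
Qed.

Lemma orbit_UJ : act @` carrier UJ = orbit.
Proof. by rewrite /orbit -commutant_1E. Qed.

Lemma oman_topology : is_topology orbit (opens oman).
Proof. rewrite -orbit_UJ; apply: quotient_topology; exact: subspace_topology. Qed.

Lemma oman_opensP (W : set A) (P : set A) : W `<=` orbit -> open P ->
  (forall U, unitary sh U -> (W (act U) <-> P U)) -> opens oman W.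
Proof.
move=> WO Po WP; split; first by rewrite orbit_UJ.
exists P => //; rewrite /= commutant_1E.
by apply/seteqP; split=> U [hU] h; split=> //; exact/(WP U hU).
Qed.

(** The action is norm continuous, so the quotient topology refines the norm topology of the orbit,
    where points are already separated. *)
Lemma orbit_hausdorff : is_hausdorff orbit (opens oman).
Proof.
move=> X Y hX hY XY.
have [V [W [[P Po VE] [P' Po' WE] VX WY VW]]] := subspace_hausdorff hX hY XY.
have op (O : set A) : open O -> opens oman (orbit `&` O).
  move=> Oo; apply: (@oman_opensP _ (act @^-1` O)); first by move=> ? [].
    rewrite -[X in open X]setTI; apply: open_local => //; first exact: openT.
    by move=> U _; apply: analytic_continuous; exact/analytic_act/analytic_id.
  by move=> U hU; split=> [[]//|OU]; split=> //; exists U.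
by exists V, W; split=> //; rewrite ?VE ?WE; exact: op.
Qed.

Lemma ochart_is_chart V : unitary sh V -> @is_chart R A oman (ochart V).
Proof.
move=> hV.
pose B0 : set m := [set t | `|t| < d2].
have B0o : open B0 by exact: open_norm_lt0.
have uc (t : m) : B0 t -> {for t, continuous (fun t : m => uni (rngv t))}.
  by move=> td; apply: analytic_continuous; exact: analytic_uni_coiso.
have ac (t : m) : B0 t -> {for t, continuous (fun t : m => act (uni (rngv t)))}.
  by move=> td; apply/analytic_continuous/analytic_act/analytic_uni_coiso.
have vc (t : m) : B0 t -> {for t, continuous (fun t : m => V * uni (rngv t))}.
  move=> td; apply: analytic_continuous; apply: analyticM (analytic_cst _ _) _.
  exact: analytic_uni_coiso.
pose B := B0 `&` (fun t : m => act (uni (rngv t))) @^-1` [set X : A | `|X - Q| < d1].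
have Bo : open B by apply: open_local => //; exact: open_norm_lt.
apply: (@is_chart_criterion R A oman (ochart V) B) => //.
- exact: oman_topology.
- apply: (oman_opensP (P := [set U : A | `|conj_act sh (act U) (sh V) - Q| < d1])).
  + by move=> X [].
  + exact: open_act_near.
  by move=> U hU; split=> [[]//|UP]; split=> //; exists U.
- move=> X hX; have [h1 h2 h3] := ochart_funP hV hX; split=> //; split=> //=.
  by rewrite h2; case: hX.
- by move=> t [td _] _; exact: ochart_invK.
(* An open W of the quotient is known only through its preimage in the group. The inverse chart
   lifts to the continuous map t |-> V uni(t), so pulling W back amounts to pulling back the
   norm-open set [P]. *)
- move=> W [_ [P Po PE]].
  rewrite (_ : _ `&` _ = B `&` (fun t : m => V * uni (rngv t)) @^-1` P).
    by apply: open_local => // t [td _]; exact: vc.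
  have key t : B t -> W (act (V * uni (rngv t))) <-> P (V * uni (rngv t)).
    move=> [td _]; have hVu : commutant sh 1 (V * uni (rngv t)).
      by rewrite commutant_1E; apply: unitaryM => //; exact: uni_unitary_coiso.
    have E : (carrier UJ `&` act @^-1` W) (V * uni (rngv t)) <->
             (carrier UJ `&` P) (V * uni (rngv t)) by rewrite PE.
    by split=> h; [have [] := E.1 (conj hVu h)|have [] := E.2 (conj hVu h)].
  by apply/seteqP; split=> t [Bt tW]; split=> //; exact/(key t Bt).
move=> P Po.
pose D := [set U : A | `|conj_act sh (act U) (sh V) - Q| < d1].
apply: (oman_opensP (P := D `&` (fun U => chart_fun (ochart V) (act U)) @^-1` P)).
- by move=> X [[]].
- apply: open_local => //; first exact: open_act_near.
  move=> U UD; apply: analytic_continuous; apply: analytic_ochart_fun => //.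
  exact/analytic_act/analytic_id.
move=> U hU; split=> [[[_ UD] UP]//|[UD UP]]; split=> //.
by split=> //; exists U.
Qed.

Lemma ochart_dom_self V : unitary sh V -> chart_dom (ochart V) (act V).
Proof.
move=> hV; split; first by exists V.
rewrite actA_unitary hV.2 /conj_act sh1 mul1r mulr1 subrr normr0.
exact: d1_gt0.
Qed.

Lemma oman_banach : banach_manifold oman.
Proof.
split.
- exact: oman_topology.
- exact: orbit_hausdorff.
- by move=> _ [V hV ->]; exact: ochart_is_chart.
- by move=> _ [V hV <-]; exists (ochart V); [exists V|exact: ochart_dom_self].
move=> _ _ [V hV ->] [W hW ->] _ [X [XV XW] <-].
have [td _ e] := ochart_funP hV XV.
apply: analytic_ochart_fun; first exact: analytic_ochart_inv.
by rewrite e; case: XW.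
Qed.

Lemma act_analytic_map : analytic_map UJ oman act.
Proof.
split.
- by move=> U [hU _]; exists U.
- by move=> W [].
move=> _ _ [V hV ->] [W hW ->] _ [U [UV UW] <-].
have [td _ e] := gchart_funP hd hV UV.
apply: analytic_ochart_fun.
  by apply: analytic_act; exact: analytic_gchart_inv.
by rewrite e; case: UW.
Qed.

(* The surjectivity of the differential and the complement of its kernel come
   from a local section through the given point. *)
Lemma act_submersion : submersion UJ oman act.
Proof.
split; first exact: act_analytic_map.
move=> x _ _ [V hV ->] [W hW ->] xV fxW.
have [sd _ psix] := gchart_funP hd hV xV.
have [td ue psit] := ochart_funP hW fxW.
set c := gchart _ _ d V in xV sd psix *; set o := ochart W in fxW td ue psit *.
set F := local_rep _ _ _; set s0 := chart_fun c x in sd psix *.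
set t0 := chart_fun o (act x) in td ue psit.
have Fa : analytic_at F s0.
  apply: analytic_ochart_fun; last by rewrite psix; case: fxW.
  by apply: analytic_act; exact: analytic_gchart_inv.
have hx : unitary sh x by case: xV => -[].
pose w0 := W * uni (rngv t0).
have hw0 : unitary sh w0 by apply: unitaryM => //; exact: uni_unitary_coiso.
(* [x] and the lift [w0] of its image differ by the isotropy element [k]; translating the section by
   [k] on the right makes it pass through [x] at [t0]. *)
pose k := sh w0 * x.
have hk : unitary sh k by apply: unitaryM => //; exact: unitaryV.
have actk : act k = Q.
  rewrite -actA_unitary -psit -[chart_inv o t0]/(act w0) actA_unitary hw0.2.
  by rewrite /conj_act sh1 mul1r mulr1.
pose y (t : m) := W * uni (rngv t) * k.
have y0 : y t0 = x by rewrite /y -/w0 /k mulrA hw0.1 mul1r.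
have ya : analytic_at y t0.
  apply: analyticM (analytic_cst _ _); apply: analyticM (analytic_cst _ _) _.
  exact: analytic_uni_coiso.
pose sig t := chart_fun c (y t).
have siga : analytic_at sig t0 by exact: analytic_gchart_fun.
have sig0 : sig t0 = s0 by rewrite /sig y0.
have Fa' : analytic_at F (sig t0) by rewrite sig0.
(* Since [k] fixes Q, acting by y t gives the same point as W uni(t), whose coordinate is t. So F o
   sig is the identity near [t0], and its differential there makes that of [sig] a right inverse of
   that of [F]. *)
have Fsig : 'd (F \o sig) t0 = id :> (m -> m).
  rewrite -(diff_blinear t0 (@blin_id R m)); apply/esym/diff_near; last exact: analytic_id.
  have n1 : \forall t \near t0, `|t| < d2.
    by apply: (@open_nbhs_nbhs _ t0 [set t : m | `|t| < d2]); split=> //; exact: open_norm_lt0.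
  have n2 : \forall t \near t0, `|sh V * y t - 1| < d.
    apply/nbhs0P; apply: (near_norm_lt (f := fun t => sh V * y t)).
      by apply: analytic_continuous; exact: analyticM (analytic_cst _ _) ya.
    by rewrite y0; case: xV.
  have n3 : \forall t \near t0, `|act (uni (rngv t)) - Q| < d1.
    apply/nbhs0P; apply: (near_norm_lt (f := fun t : m => act (uni (rngv t)))).
      by apply/analytic_continuous/analytic_act/analytic_uni_coiso.
    by rewrite ue; case: fxW.
  near=> t.
  have t2 : `|t| < d2 by near: t.
  have yd : `|sh V * y t - 1| < d by near: t.
  have ydom : chart_dom c (y t).
    split=> //; rewrite commutant_1E; apply: unitaryM => //; apply: unitaryM => //.
    exact: uni_unitary_coiso.
  have [_ _ ye] := gchart_funP hd hV ydom.
  have Fe : F (sig t) = chart_fun o (act (chart_inv c (sig t))) by [].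
  rewrite -[RHS]/(F (sig t)) Fe [chart_inv c (sig t)]ye /y -actA_unitary actk.
  by apply/esym; exact: (ochart_invK hW).
have [Fd sd'] := (analytic_differentiable Fa', analytic_differentiable siga).
rewrite diff_comp// in Fsig.
have Ds v : 'd F s0 ('d sig t0 v) = v.
  by rewrite -[RHS]/(id v) -Fsig /= sig0.
split; first by move=> v; exists ('d sig t0 v).
apply: (kernel_split (s := 'd sig t0)) => //.
- by apply: diff_continuous; rewrite sig0 in Fd.
- exact: diff_continuous.
Unshelve. all: by end_near. Qed.

End OrbitManifold.

Theorem proposition3p1 (R : realType) (H : hilbertType R) (hH : separable_space H)
    (J : bop H) (hJ : is_symmetry J) (Q0 : bop H)
    (hQ0 : jnormal_projections J Q0) :
  analytic_homogeneous_space J Q0.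
Proof.
have sh_inv := jadj_involution hJ.
have hQ : normal_proj (jadj J) Q0 by exact: hQ0.
have [d hd] := good_radius_exists H.
have [d2 /andP[d2_gt0 d2d] pinchP] := pinch_radius sh_inv hQ hd.
have [d1 d1_gt0 sectionP] := section_radius sh_inv hQ d2_gt0.
exists (gman sh_inv (normal_proj1 sh_inv) d), (gman sh_inv hQ d),
  (oman sh_inv hQ d d1); split; split.
- exact: commutant_1E.
- exact: gman_operator_lie_group.
- by rewrite gman_lie_algebra// commutant_lie1E.
- by [].
- exact: gman_subgroup.
- exact: gman_lie_algebra.
- by [].
- by [].
- exact: (@oman_banach _ _ _ sh_inv _ hQ _ hd _ _ d2d pinchP d1_gt0 sectionP).
- exact: (@act_submersion _ _ _ sh_inv _ hQ _ hd _ _ d2d pinchP sectionP).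
Qed.
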